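(* Let $G$ be a group, $X$ a right $G$-set and $A$ a $G$-graded $k$-algebra. There is an exact sequence of groups $$1\to\mathcal{K}\to\mathrm{Aut}_k((G,X,A))\xrightarrow{\ \Theta\ }\mathrm{Pic}_k(A\otimes kX)\simeq\mathrm{Pic}_k(gr\text{-}(A,X,G)),$$ where $\Theta$ sends $(f,\varphi,\alpha)$ to the isomorphism class of the bicomodule ${}_{(\alpha\otimes\gamma,\alpha)}(A\otimes kX)$ with $\gamma:kX\to kX$ the $k$-linear extension of $\varphi$, and $\mathcal{K}=\ker\Theta$ is the set of $(f,\varphi,\alpha)\in\mathrm{Aut}_k((G,X,A))$ such that there is an invertible $p\in(A\otimes kX)^*$ satisfying 1) $p(a\otimes x)=\alpha(a)p(1_A\otimes x)$ for all $x\in X$, $a\in A$, and 2) $p(1_A\otimes x)_h=0$ for all $x\in X$, $h\in G$ such that $\varphi(x)h\neq x$.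
   Context: $k$ is a commutative ring. $gr\text{-}(A,X,G)$: right $A$-modules $M=\bigoplus_{x\in X}M_x$ with $M_xA_g\subset M_{xg}$, with $A$-linear grading-preserving maps. For $b\in A$ and $h\in G$, $b_h$ is the homogeneous component of degree $h$. $\mathrm{Aut}_k((G,X,A))$ is the group (under composition) of triples $(f,\varphi,\alpha)$ with $f:G\to G$ a group automorphism, $\varphi:X\to X$ a bijection and $\alpha:A\to A$ a $k$-algebra automorphism, which are automorphisms in the category of such triples, i.e. $\varphi(xg)=\varphi(x)f(g)$ and $\alpha(A_g)\subset A_{f(g)}$ for all $x\in X$, $g\in G$ (and likewise for the inverse). $\mathfrak C=A\otimes kX$ ($kX$ the free $k$-module on $X$) is an $A$-coring: $b(a\otimes x)=ba\otimes x$; $(a\otimes x)b=ab\otimes xg$ for $b\in A_g$; $\Delta(a\otimes x)=(a\otimes x)\otimes_A(1_A\otimes x)$; $\epsilon(a\otimes x)=a$. Its category of right comodules is isomorphic to $gr\text{-}(A,X,G)$. It is coseparable. $\mathfrak C^*=\mathrm{Hom}_{-A}(\mathfrak C,A)$ (right $A$-linear maps) is a $k$-algebra with product $(f*^rg)(c)=\sum g(f(c_{(1)})c_{(2)})$ and unit $\epsilon$; invertibility of $p$ refers to this algebra. $\mathrm{Pic}_k(\mathfrak C)$ is the group of isomorphism classes of $\mathfrak C$-bicomodules $Y$ such that $-\square_{\mathfrak C}Y$ is an autoequivalence of the category $\mathcal M^{\mathfrak C}$ of right $\mathfrak C$-comodules, with product induced by the cotensor product $\square_{\mathfrak C}$ ($M\square_{\mathfrak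 C}N=\ker(\rho_M\otimes_AN-M\otimes_A\lambda_N)$; for this coseparable coring left and right invertibility coincide). $\mathrm{Pic}_k$ of a $k$-abelian category is the group of isomorphism classes of its $k$-linear autoequivalences, with $(T)(S)=(ST)$. For a coring automorphism $(\phi,\rho)$ of $\mathfrak C$ ($\rho$ an algebra automorphism of $A$, $\phi$ a compatible bijection of $\mathfrak C$), ${}_{(\phi,\rho)}\mathfrak C$ is (up to isomorphism) $\mathfrak C$ as a right comodule, with left action $a\cdot c=\rho^{-1}(a)c$ and left coaction $c\mapsto\sum\phi(c_{(1)})\otimes_Ac_{(2)}$. *)

(* Defs.v *)
From HB Require Import structures.
From mathcomp Require Import all_boot all_order all_algebra.
From mathcomp Require Import mathcomp_extra boolp classical_sets functions.
From mathcomp Require Import cardinality fsbigop.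

Set Implicit Arguments.
Unset Strict Implicit.
Unset Printing Implicit Defensive.

Import GRing.Theory.
Local Open Scope ring_scope.
Local Open Scope classical_set_scope.
Local Open Scope quotient_scope.

HB.mixin Record isRightModule (A : pzRingType) V of GRing.Zmodule V := {
  ract : V -> A -> V;
  ractA : forall m a b, ract (ract m a) b = ract m (a * b);
  ract1 : forall m, ract m 1 = m;
  ractDl : forall m n a, ract (m + n) a = ract m a + ract n a;
  ractDr : forall m a b, ract m (a + b) = ract m a + ract m b
}.

#[short(type="rmodType")]
HB.structure Definition RModule (A : pzRingType) :=
  {V of GRing.Zmodule V & isRightModule A V}.

Notation "m *r a" := (ract m a) (at level 40, left associativity) : ring_scope.

HB.mixin Record isBimodule (A : pzRingType) V
    of GRing.Lmodule A V & RModule A V := {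
  lractA : forall (a : A) (m : V) (b : A), (a *: m) *r b = a *: (m *r b)
}.

#[short(type="bimodType")]
HB.structure Definition Bimodule (A : pzRingType) :=
  {V of GRing.Lmodule A V & RModule A V & isBimodule A V}.

Section RightModuleTheory.
Variables (A : pzRingType) (M : rmodType A).
Implicit Types (m : M) (a : A).

Lemma ract0l a : (0 : M) *r a = 0.
Proof. by apply: (addrI (0 *r a)); rewrite -ractDl !addr0. Qed.

Lemma ract0r m : m *r 0 = 0.
Proof. by apply: (addrI (m *r 0)); rewrite -ractDr !addr0. Qed.

Lemma ractNl m a : (- m) *r a = - (m *r a).
Proof. by apply: (addrI (m *r a)); rewrite -ractDl !subrr ract0l. Qed.

Lemma ractNr m a : m *r (- a) = - (m *r a).
Proof. by apply: (addrI (m *r a)); rewrite -ractDr !subrr ract0r. Qed.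

Lemma ract_suml I (r : seq I) (F : I -> M) a :
  (\sum_(i <- r) F i) *r a = \sum_(i <- r) F i *r a.
Proof.
by apply: (big_morph (fun m => m *r a)) => [x y|]; rewrite ?ractDl ?ract0l.
Qed.

End RightModuleTheory.

Definition rlinear (A : pzRingType) (M N : rmodType A) (f : M -> N) : Prop :=
  (forall m n, f (m + n) = f m + f n) /\ (forall m a, f (m *r a) = f m *r a).

Definition llinear (A : pzRingType) (M N : lmodType A) (f : M -> N) : Prop :=
  (forall m n, f (m + n) = f m + f n) /\ (forall a m, f (a *: m) = a *: f m).

Lemma additive0 (U V : zmodType) (f : U -> V) :
  (forall u v, f (u + v) = f u + f v) -> f 0 = 0.
Proof. by move=> fD; apply: (addrI (f 0)); rewrite -fD !addr0. Qed.

Lemma additive_sum (U V : zmodType) (f : U -> V) I (r : seq I) (F : I -> U) :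
  (forall u v, f (u + v) = f u + f v) ->
  f (\sum_(i <- r) F i) = \sum_(i <- r) f (F i).
Proof. by move=> fD; apply: (big_morph f fD); apply: additive0. Qed.

(* The tensor product over A is the abelian monoid of formal finite sums of
   pairs modulo the congruence generated by the relations below; opposites
   come from (- m, n). *)
Section Tensor.
Variables (A : pzRingType) (M : rmodType A) (N : lmodType A).

Inductive tensor_rel : seq (M * N) -> seq (M * N) -> Prop :=
| tr_refl s : tensor_rel s s
| tr_sym s t : tensor_rel s t -> tensor_rel t s
| tr_trans s t u : tensor_rel s t -> tensor_rel t u -> tensor_rel s u
| tr_cat s s' t t' :
    tensor_rel s s' -> tensor_rel t t' -> tensor_rel (s ++ t) (s' ++ t')
| tr_comm s t : tensor_rel (s ++ t) (t ++ s)
| tr_zero n : tensor_rel [:: (0, n)] [::]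
| tr_addl m m' n : tensor_rel [:: (m + m', n)] [:: (m, n); (m', n)]
| tr_addr m n n' : tensor_rel [:: (m, n + n')] [:: (m, n); (m, n')]
| tr_bal m a n : tensor_rel [:: (m *r a, n)] [:: (m, a *: n)].

Definition tensor_relb (s t : seq (M * N)) : bool := `[< tensor_rel s t >].

Lemma tensor_relb_equiv : equiv_class_of tensor_relb.
Proof.
split=> [s|s t|t s u].
- by apply/asboolP; exact: tr_refl.
- by apply/asboolP/asboolP; exact: tr_sym.
- move=> /asboolP st /asboolP tu; apply/asboolP; exact: tr_trans st tu.
Qed.

Canonical tensor_equiv := EquivRelPack tensor_relb_equiv.

Definition tensor : Type := {eq_quot tensor_equiv}.
HB.instance Definition _ := Choice.on tensor.
HB.instance Definition _ := EqQuotient.on tensor.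

Definition tensor_of (s : seq (M * N)) : tensor := \pi_tensor s.

Lemma tensor_ofP s t : tensor_of s = tensor_of t <-> tensor_rel s t.
Proof.
split=> [/eqP|st]; first by rewrite /tensor_of piE => /asboolP.
by apply/eqP; rewrite /tensor_of piE; apply/asboolP.
Qed.

Lemma tensor_reprK (t : tensor) : tensor_of (repr t) = t.
Proof. exact: reprK. Qed.

Lemma tensor_of_repr s : tensor_rel (repr (tensor_of s)) s.
Proof. by apply/tensor_ofP; rewrite tensor_reprK. Qed.

Definition tensor_add (s t : tensor) := tensor_of (repr s ++ repr t).
Definition tensor_opp (t : tensor) :=
  tensor_of [seq (- p.1, p.2) | p <- repr t].

Lemma tensor_of_cat s t :
  tensor_of (s ++ t) = tensor_add (tensor_of s) (tensor_of t).
Proof. by apply/tensor_ofP/tr_cat; apply: tr_sym; exact: tensor_of_repr. Qed.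

Fact tensor_addC : commutative tensor_add.
Proof. by move=> s t; apply/tensor_ofP; exact: tr_comm. Qed.

Fact tensor_addA : associative tensor_add.
Proof.
move=> s t u; rewrite -(tensor_reprK s) -(tensor_reprK t) -(tensor_reprK u).
by rewrite -!tensor_of_cat catA.
Qed.

Fact tensor_add0 : left_id (tensor_of [::]) tensor_add.
Proof. by move=> s; rewrite -(tensor_reprK s) -tensor_of_cat. Qed.

Fact tensor_addN : left_inverse (tensor_of [::]) tensor_opp tensor_add.
Proof.
move=> s; rewrite -{2}(tensor_reprK s) -tensor_of_cat; apply/tensor_ofP.
elim: (repr s) => [|[m n] r IH] /=; first exact: tr_refl.
set r' := [seq _ | p <- r] in IH *.
have := tr_addl (- m) m n; rewrite addNr => mn0.
apply: (@tr_trans _ ([:: (- m, n)] ++ (([:: (m, n)] ++ r') ++ r))).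
  rewrite -[X in tensor_rel X _]/([:: (- m, n)] ++ (r' ++ ([:: (m, n)] ++ r))).
  rewrite (catA r'). apply: tr_cat; first exact: tr_refl.
  by apply: tr_cat; [exact: tr_comm | exact: tr_refl].
apply: (@tr_trans _ ([::] ++ [::])); last exact: tr_refl.
rewrite -(catA [:: (m, n)]) (catA [:: (- m, n)] [:: (m, n)]).
apply: (@tr_cat _ [::] _ [::]) => //.
exact: tr_trans (tr_sym mn0) (tr_zero n).
Qed.

HB.instance Definition _ := GRing.isZmodule.Build tensor
  tensor_addA tensor_addC tensor_add0 tensor_addN.

Definition tens (m : M) (n : N) : tensor := tensor_of [:: (m, n)].

Lemma tensDl m m' n : tens (m + m') n = tens m n + tens m' n.
Proof.
rewrite -[RHS]/(tensor_add _ _) -tensor_of_cat; apply/tensor_ofP.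
exact: tr_addl.
Qed.

Lemma tensDr m n n' : tens m (n + n') = tens m n + tens m n'.
Proof.
rewrite -[RHS]/(tensor_add _ _) -tensor_of_cat; apply/tensor_ofP.
exact: tr_addr.
Qed.

Lemma tens_bal m a n : tens (m *r a) n = tens m (a *: n).
Proof. by apply/tensor_ofP; exact: tr_bal. Qed.

Lemma tensor_ofE s : tensor_of s = \sum_(p <- s) tens p.1 p.2.
Proof.
elim: s => [|[m n] s IH]; first by rewrite big_nil.
by rewrite big_cons -IH -cat1s tensor_of_cat.
Qed.

Lemma tensorE (t : tensor) : t = \sum_(p <- repr t) tens p.1 p.2.
Proof. by rewrite -tensor_ofE tensor_reprK. Qed.

Definition balanced (V : zmodType) (f : M -> N -> V) : Prop :=
  [/\ forall m m' n, f (m + m') n = f m n + f m' n,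
      forall m n n', f m (n + n') = f m n + f m n'
    & forall m a n, f (m *r a) n = f m (a *: n)].

(* The map induced on the tensor product by f; meaningful when f is balanced
   (tliftE). *)
Definition tlift (V : zmodType) (f : M -> N -> V) (t : tensor) : V :=
  \sum_(p <- repr t) f p.1 p.2.

Lemma tensor_rel_sum (V : zmodType) (f : M -> N -> V) s t : balanced f ->
  tensor_rel s t -> \sum_(p <- s) f p.1 p.2 = \sum_(p <- t) f p.1 p.2.
Proof.
case=> fDl fDr fb; elim=> //=.
- by move=> s1 t1 u1 _ -> _ ->.
- by move=> s1 s1' t1 t1' _ IHs _ IHt; rewrite !big_cat /= IHs IHt.
- by move=> s1 t1; rewrite !big_cat /= addrC.
- move=> n; rewrite big_seq1 big_nil /=.
  by apply: (addrI (f 0 n)); rewrite -fDl !addr0.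
- by move=> m m' n; rewrite !big_cons !big_nil /= !addr0 fDl.
- by move=> m n n'; rewrite !big_cons !big_nil /= !addr0 fDr.
- by move=> m a n; rewrite !big_seq1 /= fb.
Qed.

Lemma tlift_of (V : zmodType) (f : M -> N -> V) s : balanced f ->
  tlift f (tensor_of s) = \sum_(p <- s) f p.1 p.2.
Proof. by move=> fb; apply: tensor_rel_sum (tensor_of_repr s). Qed.

Lemma tliftE (V : zmodType) (f : M -> N -> V) m n : balanced f ->
  tlift f (tens m n) = f m n.
Proof. by move=> fb; rewrite tlift_of // big_seq1. Qed.

Lemma tliftD (V : zmodType) (f : M -> N -> V) s t : balanced f ->
  tlift f (s + t) = tlift f s + tlift f t.
Proof.
move=> fb; rewrite -(tensor_reprK s) -(tensor_reprK t).
by rewrite -[X in tlift f X]/(tensor_add _ _) -tensor_of_cat !tlift_of // big_cat.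
Qed.

Lemma tlift_comp (U V : zmodType) (h : U -> V) (f : M -> N -> U) t :
  (forall u v, h (u + v) = h u + h v) ->
  h (tlift f t) = tlift (fun m n => h (f m n)) t.
Proof. by move=> hD; rewrite /tlift additive_sum. Qed.

Lemma tlift_tens (t : tensor) : tlift tens t = t.
Proof. by rewrite /tlift -tensorE. Qed.

Lemma eq_tlift (V : zmodType) (f g : M -> N -> V) t :
  (forall m n, f m n = g m n) -> tlift f t = tlift g t.
Proof. by move=> fg; apply: eq_bigr => p _. Qed.

Lemma tensor_ext (V : zmodType) (f g : tensor -> V) :
  (forall s t, f (s + t) = f s + f t) -> (forall s t, g (s + t) = g s + g t) ->
  (forall m n, f (tens m n) = g (tens m n)) -> forall t, f t = g t.
Proof.
move=> fD gD fg t; rewrite [t]tensorE !additive_sum //.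
by apply: eq_bigr => p _.
Qed.

Lemma balanced_tens : balanced tens.
Proof. by split; [exact: tensDl | exact: tensDr | exact: tens_bal]. Qed.

End Tensor.

Section TensorActions.
Variables (A : pzRingType).

Definition tensor_lact (M : bimodType A) (N : lmodType A) (a : A) :
  tensor M N -> tensor M N := tlift (fun m n => tens (a *: m) n).

Lemma tensor_lact_bal (M : bimodType A) (N : lmodType A) a :
  balanced (fun (m : M) (n : N) => tens (a *: m) n).
Proof.
split=> *; rewrite ?scalerDr ?tensDl ?tensDr //.
by rewrite -lractA tens_bal.
Qed.

Definition tensor_ract (M : rmodType A) (N : bimodType A)
  (t : tensor M N) (a : A) : tensor M N :=
  tlift (fun m n => tens m (n *r a)) t.

Lemma tensor_ract_bal (M : rmodType A) (N : bimodType A) a :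
  balanced (fun (m : M) (n : N) => tens m (n *r a)).
Proof.
split=> *; rewrite ?ractDl ?tensDl ?tensDr //.
by rewrite lractA tens_bal.
Qed.

Lemma tensor_lactD (M : bimodType A) (N : lmodType A) a (s t : tensor M N) :
  tensor_lact a (s + t) = tensor_lact a s + tensor_lact a t.
Proof. exact/tliftD/tensor_lact_bal. Qed.

Lemma tensor_ractD (M : rmodType A) (N : bimodType A) a (s t : tensor M N) :
  tensor_ract (s + t) a = tensor_ract s a + tensor_ract t a.
Proof. exact/tliftD/tensor_ract_bal. Qed.

Lemma tensor_lactE (M : bimodType A) (N : lmodType A) a (m : M) (n : N) :
  tensor_lact a (tens m n) = tens (a *: m) n.
Proof. exact/tliftE/tensor_lact_bal. Qed.

Lemma tensor_ractE (M : rmodType A) (N : bimodType A) a (m : M) (n : N) :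
  tensor_ract (tens m n) a = tens m (n *r a).
Proof. exact/tliftE/tensor_ract_bal. Qed.

Section Left.
Variables (M : bimodType A) (N : lmodType A).

Fact tensor_lactA a b (t : tensor M N) :
  tensor_lact a (tensor_lact b t) = tensor_lact (a * b) t.
Proof.
move: t; apply: tensor_ext => [s t|s t|m n]; rewrite ?tensor_lactD //.
by rewrite !tensor_lactE scalerA.
Qed.

Fact tensor_lact1 : left_id 1 (@tensor_lact M N).
Proof.
apply: (tensor_ext (g := id)) => [s t|//|m n]; rewrite ?tensor_lactD //.
by rewrite tensor_lactE scale1r.
Qed.

Fact tensor_lactDr : right_distributive (@tensor_lact M N) +%R.
Proof. by move=> a s t; rewrite tensor_lactD. Qed.

Fact tensor_lactDl t : {morph (@tensor_lact M N)^~ t : a b / a + b}.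
Proof.
move=> a b; move: t; apply: tensor_ext => [s t|s t|m n].
- by rewrite tensor_lactD.
- by rewrite !tensor_lactD addrACA.
- by rewrite !tensor_lactE scalerDl tensDl.
Qed.

HB.instance Definition _ := GRing.Zmodule_isLmodule.Build A (tensor M N)
  tensor_lactA tensor_lact1 tensor_lactDr tensor_lactDl.

Lemma tens_lact a (m : M) (n : N) : a *: tens m n = tens (a *: m) n.
Proof. exact: tensor_lactE. Qed.

End Left.

Section Right.
Variables (M : rmodType A) (N : bimodType A).

Fact tensor_ractA (t : tensor M N) a b :
  tensor_ract (tensor_ract t a) b = tensor_ract t (a * b).
Proof.
move: t; apply: tensor_ext => [s t|s t|m n]; rewrite ?tensor_ractD //.
by rewrite !tensor_ractE ractA.
Qed.

Fact tensor_ract1 (t : tensor M N) : tensor_ract t 1 = t.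
Proof.
move: t; apply: (tensor_ext (g := id)) => [s t|//|m n];
  rewrite ?tensor_ractD //.
by rewrite tensor_ractE ract1.
Qed.

Fact tensor_ractDl (s t : tensor M N) a :
  tensor_ract (s + t) a = tensor_ract s a + tensor_ract t a.
Proof. exact: tensor_ractD. Qed.

Fact tensor_ractDr (t : tensor M N) a b :
  tensor_ract t (a + b) = tensor_ract t a + tensor_ract t b.
Proof.
move: t; apply: tensor_ext => [s t|s t|m n].
- by rewrite tensor_ractD.
- by rewrite !tensor_ractD addrACA.
- by rewrite !tensor_ractE ractDr tensDr.
Qed.

HB.instance Definition _ := isRightModule.Build A (tensor M N)
  tensor_ractA tensor_ract1 tensor_ractDl tensor_ractDr.

Lemma tens_ract (m : M) (n : N) a : tens m n *r a = tens m (n *r a).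
Proof. exact: tensor_ractE. Qed.

End Right.

Section Bi.
Variables (M N : bimodType A).

Fact tensor_biact a (t : tensor M N) b : (a *: t) *r b = a *: (t *r b).
Proof.
move: t; apply: tensor_ext => [s t|s t|m n].
- by rewrite scalerDr ractDl.
- by rewrite ractDl scalerDr.
- by rewrite tens_lact !tens_ract tens_lact.
Qed.

HB.instance Definition _ := isBimodule.Build A (tensor M N) tensor_biact.

End Bi.

End TensorActions.

Section TensorMaps.
Variable A : pzRingType.

Definition tmap (M M' : rmodType A) (N N' : lmodType A)
  (f : M -> M') (g : N -> N') : tensor M N -> tensor M' N' :=
  tlift (fun m n => tens (f m) (g n)).

Definition tassoc (M : rmodType A) (N : bimodType A) (P : lmodType A) :
  tensor (tensor M N) P -> tensor M (tensor N P) :=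
  tlift (fun s p => tlift (fun m n => tens m (tens n p)) s).

Lemma tmap_bal (M M' : rmodType A) (N N' : lmodType A)
    (f : M -> M') (g : N -> N') :
  rlinear f -> llinear g -> balanced (fun m n => tens (f m) (g n)).
Proof.
case=> fD fZ [gD gZ]; split=> *.
- by rewrite fD tensDl.
- by rewrite gD tensDr.
- by rewrite fZ gZ tens_bal.
Qed.

Lemma tmapE (M M' : rmodType A) (N N' : lmodType A)
    (f : M -> M') (g : N -> N') m n :
  rlinear f -> llinear g -> tmap f g (tens m n) = tens (f m) (g n).
Proof. by move=> flin glin; exact/tliftE/tmap_bal. Qed.

Lemma tmapD (M M' : rmodType A) (N N' : lmodType A)
    (f : M -> M') (g : N -> N') s t :
  rlinear f -> llinear g -> tmap f g (s + t) = tmap f g s + tmap f g t.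
Proof. by move=> flin glin; exact/tliftD/tmap_bal. Qed.

Section Assoc.
Variables (M : rmodType A) (N : bimodType A) (P : lmodType A).

Lemma tassoc_bal1 (p : P) :
  balanced (fun (m : M) (n : N) => tens m (tens n p)).
Proof. by split=> *; rewrite ?tensDl ?tensDr // tens_bal tens_lact. Qed.

Lemma tassoc_bal : balanced
  (fun (s : tensor M N) (p : P) => tlift (fun m n => tens m (tens n p)) s).
Proof.
split=> [s t p|s p q|s a p].
- exact/tliftD/tassoc_bal1.
- move: s; apply: tensor_ext => [s t|s t|m n].
  + exact/tliftD/tassoc_bal1.
  + by rewrite !(tliftD _ _ (tassoc_bal1 _)) addrACA.
  + by rewrite !(tliftE _ _ (tassoc_bal1 _)) tensDr tensDr.
- move: s; apply: tensor_ext => [s t|s t|m n].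
  + by rewrite ractDl; exact/tliftD/tassoc_bal1.
  + exact/tliftD/tassoc_bal1.
  + by rewrite tens_ract !(tliftE _ _ (tassoc_bal1 _)) -tens_bal.
Qed.

Lemma tassocD (s t : tensor (tensor M N) P) :
  tassoc (s + t) = tassoc s + tassoc t.
Proof. exact/tliftD/tassoc_bal. Qed.

Lemma tassocE (m : M) (n : N) (p : P) :
  tassoc (tens (tens m n) p) = tens m (tens n p).
Proof.
by rewrite /tassoc (tliftE _ _ tassoc_bal) (tliftE _ _ (tassoc_bal1 p)).
Qed.

End Assoc.

Lemma rlinear_id (M : rmodType A) : rlinear (@id M). Proof. by []. Qed.
Lemma llinear_id (M : lmodType A) : llinear (@id M). Proof. by []. Qed.

End TensorMaps.

#[global] Hint Resolve rlinear_id llinear_id : core.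

(* The zero algebra is allowed, unlike with algType. *)
Record kalgebra (k : comPzRingType) := KAlgebra {
  kalg_ring :> pzRingType;
  kunit : {rmorphism k -> kalg_ring};
  kunitC : forall c a, kunit c * a = a * kunit c
}.

Definition kcentral (k : comPzRingType) (A : kalgebra k) (M : bimodType A) :=
  forall (c : k) (m : M), kunit A c *: m = m *r kunit A c.

Record coring (k : comPzRingType) (A : kalgebra k) := Coring {
  coring_mod :> bimodType A;
  coring_k : kcentral coring_mod;
  comul : coring_mod -> tensor coring_mod coring_mod;
  counit : coring_mod -> A;
  comul_l : llinear comul;
  comul_r : rlinear comul;
  counitD : forall c d, counit (c + d) = counit c + counit d;
  counitZl : forall a c, counit (a *: c) = a * counit c;
  counitZr : forall c a, counit (c *r a) = counit c * a;
  comulA : forall c, tassoc (tmap comul id (comul c)) = tmap id comul (comul c);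
  comul1l : forall c, tlift (fun c1 c2 => counit c1 *: c2) (comul c) = c;
  comul1r : forall c, tlift (fun c1 c2 => c1 *r counit c2) (comul c) = c
}.

Section Comodules.
Variables (k : comPzRingType) (A : kalgebra k) (C : coring A).

Record comodule := Comodule {
  comod_mod :> rmodType A;
  coact : comod_mod -> tensor comod_mod C;
  coact_r : rlinear coact;
  coactA : forall m, tassoc (tmap coact id (coact m))
                     = tmap id (@comul _ _ C) (coact m);
  coact1 : forall m, tlift (fun m c => m *r counit c) (coact m) = m
}.

(* k acts centrally on bicomodules, so that cotensoring is k-linear. *)
Record bicomodule := Bicomodule {
  bicomod_mod :> bimodType A;
  bicomod_k : kcentral bicomod_mod;
  lcoact : bicomod_mod -> tensor C bicomod_mod;
  rcoact : bicomod_mod -> tensor bicomod_mod C;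
  lcoact_l : llinear lcoact;
  lcoact_r : rlinear lcoact;
  rcoact_l : llinear rcoact;
  rcoact_r : rlinear rcoact;
  lcoactA : forall y, tassoc (tmap (@comul _ _ C) id (lcoact y))
                      = tmap id lcoact (lcoact y);
  lcoact1 : forall y, tlift (fun c y => counit c *: y) (lcoact y) = y;
  rcoactA : forall y, tassoc (tmap rcoact id (rcoact y))
                      = tmap id (@comul _ _ C) (rcoact y);
  rcoact1 : forall y, tlift (fun y c => y *r counit c) (rcoact y) = y;
  bicoact : forall y, tassoc (tmap lcoact id (rcoact y))
                      = tmap id rcoact (lcoact y)
}.

Definition right_comodule (Y : bicomodule) : comodule :=
  Comodule (@rcoact_r Y) (@rcoactA Y) (@rcoact1 Y).

Definition comodule_map (M N : comodule) (f : M -> N) : Prop :=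
  rlinear f /\ forall m, coact (f m) = tmap f id (coact m).

Definition bicomodule_iso (Y Z : bicomodule) : Prop :=
  exists f : Y -> Z, [/\ bijective f, llinear f, rlinear f,
    forall y, lcoact (f y) = tmap id f (lcoact y)
    & forall y, rcoact (f y) = tmap f id (rcoact y)].

(* The injection i identifies P with the kernel M [] Y of
   coact (x) Y - M (x) lcoact in M (x) Y, with the coaction induced by rcoact.
   The induced coaction is pinned down by the last clause as soon as i (x) C is
   injective, in particular when C is flat as a left A-module, as is the case
   for A (x) kX. *)
Definition is_cotensor (M : comodule) (Y : bicomodule) (P : comodule)
  (i : P -> tensor M Y) : Prop :=
  [/\ rlinear i, injective i,
      forall t, (exists p, i p = t) <->
        tassoc (tmap (@coact M) id t) = tmap id (@lcoact Y) t
    & forall p, tassoc (tmap i id (coact p)) = tmap id (@rcoact Y) (i p)].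

(* W is Y [] Z as a bicomodule. *)
Definition is_bicotensor (Y Z W : bicomodule) : Prop :=
  exists i : W -> tensor Y Z,
    [/\ @is_cotensor (right_comodule Y) Z (right_comodule W) i, llinear i
      & forall w, tmap id i (lcoact w) = tassoc (tmap (@lcoact Y) id (i w))].

End Comodules.

(* The algebra of right A-linear maps from C to A, with the product
   (f * g)(c) = sum g(f(c_1) c_2). *)
Section CoringDual.
Variables (k : comPzRingType) (A : kalgebra k) (C : coring A).

Definition in_dual (f : C -> A) : Prop :=
  (forall c d, f (c + d) = f c + f d) /\ (forall c a, f (c *r a) = f c * a).

Definition dual_mul (f g : C -> A) (c : C) : A :=
  tlift (fun c1 c2 => g (f c1 *: c2)) (comul c).

Definition dual_unit (f : C -> A) : Prop :=
  exists g, [/\ in_dual g, dual_mul f g =1 @counit _ _ C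
              & dual_mul g f =1 @counit _ _ C].

End CoringDual.

Record kcategory (k : comPzRingType) := KCategory {
  ob : Type;
  hom : ob -> ob -> lmodType k;
  idm : forall a, hom a a;
  cmp : forall a b c, hom b c -> hom a b -> hom a c;
  cmpA : forall a b c d (h : hom c d) (g : hom b c) (f : hom a b),
    cmp h (cmp g f) = cmp (cmp h g) f;
  cmp1l : forall a b (f : hom a b), cmp (idm b) f = f;
  cmp1r : forall a b (f : hom a b), cmp f (idm a) = f;
  cmpDl : forall a b c (g h : hom b c) (f : hom a b),
    cmp (g + h) f = cmp g f + cmp h f;
  cmpDr : forall a b c (g : hom b c) (e f : hom a b),
    cmp g (e + f) = cmp g e + cmp g f;
  cmpZl : forall a b c (x : k) (g : hom b c) (f : hom a b),
    cmp (x *: g) f = x *: cmp g f;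
  cmpZr : forall a b c (x : k) (g : hom b c) (f : hom a b),
    cmp g (x *: f) = x *: cmp g f
}.

Record kfunctor (k : comPzRingType) (C D : kcategory k) := KFunctor {
  fob :> ob C -> ob D;
  fmor : forall a b, hom a b -> hom (fob a) (fob b);
  fmorD : forall a b (f g : hom a b), fmor (f + g) = fmor f + fmor g;
  fmorZ : forall a b (x : k) (f : hom a b), fmor (x *: f) = x *: fmor f;
  fmor1 : forall a, fmor (idm a) = idm (fob a);
  fmorM : forall a b c (g : hom b c) (f : hom a b),
    fmor (cmp g f) = cmp (fmor g) (fmor f)
}.

Section Functors.
Variable k : comPzRingType.

Program Definition fun_id (C : kcategory k) : kfunctor C C :=
  {| fob := id; fmor := fun a b f => f |}.

Program Definition fun_comp (C D E : kcategory k)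
  (G : kfunctor D E) (F : kfunctor C D) : kfunctor C E :=
  {| fob := fun a => G (F a); fmor := fun a b f => fmor G (fmor F f) |}.
Next Obligation. by move=> *; rewrite !fmorD. Qed.
Next Obligation. by move=> *; rewrite !fmorZ. Qed.
Next Obligation. by move=> *; rewrite !fmor1. Qed.
Next Obligation. by move=> *; rewrite !fmorM. Qed.

Definition is_iso (C : kcategory k) (a b : ob C) (f : hom a b) : Prop :=
  exists g : hom b a, cmp g f = idm a /\ cmp f g = idm b.

Definition nat_iso (C D : kcategory k) (F G : kfunctor C D) : Prop :=
  exists eta : forall a, hom (F a) (G a),
    (forall a, is_iso (eta a)) /\
    (forall a b (f : hom a b),
       cmp (eta b) (fmor F f) = cmp (fmor G f) (eta a)).

Definition is_equivalence (C D : kcategory k) (F : kfunctor C D) : Prop :=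
  exists G : kfunctor D C, nat_iso (fun_comp G F) (fun_id C) /\
                           nat_iso (fun_comp F G) (fun_id D).

Record autoequivalence (C : kcategory k) := Autoequivalence {
  aeq_fun :> kfunctor C C;
  aeqP : is_equivalence aeq_fun
}.

End Functors.

Section ModuleHoms.
Variables (k : comPzRingType) (A : kalgebra k).

Record hom_pred (M N : rmodType A) := HomPred {
  hom_prop :> (M -> N) -> Prop;
  hom_prop0 : hom_prop (fun=> 0);
  hom_propN : forall f, hom_prop f -> hom_prop (fun m => - f m);
  hom_propD : forall f g, hom_prop f -> hom_prop g ->
    hom_prop (fun m => f m + g m);
  hom_propZ : forall (c : k) f, hom_prop f ->
    hom_prop (fun m => f m *r kunit A c)
}.

Record homs (M N : rmodType A) (P : hom_pred M N) := Hom {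
  hom_fun :> M -> N;
  hom_funP : P hom_fun
}.

Variables (M N : rmodType A) (P : hom_pred M N).

Lemma homsP (f g : homs P) : (forall m, f m = g m) -> f = g.
Proof.
case: f g => [f fP] [g gP] /= /funext fg; case: _ / fg gP => gP.
by congr Hom; exact: Prop_irrelevance.
Qed.

HB.instance Definition _ := gen_eqMixin (homs P).
HB.instance Definition _ := gen_choiceMixin (homs P).

Definition homs0 : homs P := Hom (hom_prop0 P).
Definition homsN (f : homs P) : homs P := Hom (hom_propN (hom_funP f)).
Definition homsD (f g : homs P) : homs P :=
  Hom (hom_propD (hom_funP f) (hom_funP g)).
Definition homsZ (c : k) (f : homs P) : homs P :=
  Hom (hom_propZ c (hom_funP f)).

Fact homsDA : associative homsD.
Proof. by move=> f g h; apply: homsP => m /=; rewrite addrA. Qed.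
Fact homsDC : commutative homsD.
Proof. by move=> f g; apply: homsP => m /=; rewrite addrC. Qed.
Fact homsD0 : left_id homs0 homsD.
Proof. by move=> f; apply: homsP => m /=; rewrite add0r. Qed.
Fact homsDN : left_inverse homs0 homsN homsD.
Proof. by move=> f; apply: homsP => m /=; rewrite addNr. Qed.

HB.instance Definition _ :=
  GRing.isZmodule.Build (homs P) homsDA homsDC homsD0 homsDN.

Fact homsZA c d f : homsZ c (homsZ d f) = homsZ (c * d) f.
Proof. by apply: homsP => m /=; rewrite ractA -rmorphM mulrC. Qed.
Fact homsZ1 : left_id 1 homsZ.
Proof. by move=> f; apply: homsP => m /=; rewrite rmorph1 ract1. Qed.
Fact homsZDr : right_distributive homsZ +%R.
Proof. by move=> c f g; apply: homsP => m /=; rewrite ractDl. Qed.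
Fact homsZDl f : {morph homsZ^~ f : c d / c + d}.
Proof. by move=> c d; apply: homsP => m /=; rewrite rmorphD ractDr. Qed.

HB.instance Definition _ := GRing.Zmodule_isLmodule.Build k (homs P)
  homsZA homsZ1 homsZDr homsZDl.

Lemma rlinear0 : rlinear (fun _ : M => 0 : N).
Proof. by split=> *; rewrite ?addr0 ?ract0l. Qed.
Lemma rlinearN (f : M -> N) : rlinear f -> rlinear (fun m => - f m).
Proof. by case=> fD fZ; split=> *; rewrite ?fD ?fZ ?opprD ?ractNl. Qed.
Lemma rlinearD (f g : M -> N) :
  rlinear f -> rlinear g -> rlinear (fun m => f m + g m).
Proof.
by case=> fD fZ [gD gZ]; split=> *; rewrite ?fD ?fZ ?gD ?gZ ?ractDl // addrACA.
Qed.
Lemma rlinearZ (c : k) (f : M -> N) :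
  rlinear f -> rlinear (fun m => f m *r kunit A c).
Proof.
by case=> fD fZ; split=> *; rewrite ?fD ?fZ ?ractDl // !ractA kunitC.
Qed.

End ModuleHoms.

Section ComoduleCategory.
Variables (k : comPzRingType) (A : kalgebra k) (C : coring A).

Section Hom.
Variables M N : comodule C.

Fact comodule_map0 : comodule_map (fun _ : M => 0 : N).
Proof.
split; first exact: rlinear0.
move=> m; rewrite (additive0 (proj1 (coact_r N))) /tmap /tlift big1 // => p _.
by apply: (addrI (tens 0 p.2)); rewrite -tensDl !addr0.
Qed.

Fact comodule_mapN (f : M -> N) :
  comodule_map f -> comodule_map (fun m => - f m).
Proof.
case=> flin fco; split; first exact: rlinearN.
move=> m; have [cD _] := coact_r N.
have -> : coact (- f m) = - coact (f m).
  by apply: (addrI (coact (f m))); rewrite -cD !subrr additive0.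
rewrite fco /tmap /tlift -sumrN; apply: eq_bigr => p _.
apply: (addrI (tens (f p.1) p.2)); rewrite -tensDl !subrr.
by apply: (addrI (tens 0 p.2)); rewrite -tensDl !addr0.
Qed.

Fact comodule_mapD (f g : M -> N) : comodule_map f -> comodule_map g ->
  comodule_map (fun m => f m + g m).
Proof.
case=> flin fco [glin gco]; split; first exact: rlinearD.
move=> m; have [-> _] := coact_r N; rewrite fco gco /tmap /tlift -big_split.
by apply: eq_bigr => p _; rewrite tensDl.
Qed.

Fact comodule_mapZ (c : k) (f : M -> N) :
  comodule_map f -> comodule_map (fun m => f m *r kunit A c).
Proof.
case=> flin fco; split; first exact: rlinearZ.
move=> m; have [_ ->] := coact_r N; rewrite fco /tmap /tlift ract_suml.
by apply: eq_bigr => p _; rewrite tens_ract tens_bal coring_k.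
Qed.

Definition comodule_hom_pred : hom_pred M N :=
  HomPred comodule_map0 comodule_mapN comodule_mapD comodule_mapZ.

End Hom.

Definition comodule_hom (M N : comodule C) : lmodType k :=
  homs (comodule_hom_pred M N).

Fact comodule_map_id (M : comodule C) : comodule_map (@id M).
Proof. by split=> // m; rewrite /tmap tlift_tens. Qed.

Fact comodule_map_comp (M N P : comodule C) (g : N -> P) (f : M -> N) :
  comodule_map g -> comodule_map f -> comodule_map (fun m => g (f m)).
Proof.
case=> -[gD gZ] gco [[fD fZ] fco]; split.
  by split=> *; rewrite ?fD ?fZ ?gD ?gZ.
have tgD s t : tmap g (@id C) (s + t) = tmap g id s + tmap g id t.
  exact: tmapD.
move=> m; rewrite gco fco -[tmap f id _]/(tlift _ _) (tlift_comp _ _ tgD).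
by apply: eq_tlift => m1 c; rewrite tmapE.
Qed.

Definition comodule_cmp (M N P : comodule C)
  (g : comodule_hom N P) (f : comodule_hom M N) : comodule_hom M P :=
  Hom (P := comodule_hom_pred M P)
    (comodule_map_comp (hom_funP g) (hom_funP f)).

Lemma comodule_homP (M N : comodule C) (f g : homs (comodule_hom_pred M N)) :
  (forall m, f m = g m) -> f = g :> comodule_hom M N.
Proof. exact: homsP. Qed.

Fact comodule_cmpDr (M N P : comodule C) (g : comodule_hom N P)
    (e f : comodule_hom M N) :
  comodule_cmp g (e + f) = comodule_cmp g e + comodule_cmp g f.
Proof.
by case: g => g [[gD gZ] gco]; apply: comodule_homP => m; rewrite /= gD.
Qed.

Fact comodule_cmpZr (M N P : comodule C) x (g : comodule_hom N P)
    (f : comodule_hom M N) :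
  comodule_cmp g (x *: f) = x *: comodule_cmp g f.
Proof.
by case: g => g [[gD gZ] gco]; apply: comodule_homP => m; rewrite /= gZ.
Qed.

Definition comodule_cat : kcategory k.
Proof.
exists (comodule C) comodule_hom
  (fun M => Hom (P := comodule_hom_pred M M) (comodule_map_id M))
  comodule_cmp.
all: try by move=> *; exact: comodule_homP.
- exact: comodule_cmpDr.
- exact: comodule_cmpZr.
Defined.

(* F is the functor - [] Y. *)
Definition is_cotensor_functor (Y : bicomodule C)
  (F : kfunctor comodule_cat comodule_cat) : Prop :=
  exists i : forall M : comodule C, (F M : comodule C) -> tensor M Y,
    (forall M, is_cotensor (i M)) /\
    (forall (M N : comodule C) (f : comodule_hom M N) (z : (F M : comodule C)),
       i N ((fmor F (f : @hom _ comodule_cat M N) : comodule_hom _ _) z)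
       = tmap f id (i M z)).

Definition invertible (Y : bicomodule C) : Prop :=
  exists F, is_cotensor_functor Y F /\ is_equivalence F.

Record inv_bicomodule := InvBicomodule {
  inv_bicomod :> bicomodule C;
  inv_bicomodP : invertible inv_bicomod
}.

End ComoduleCategory.

(* Groups whose elements may be classes of large objects: the carriers of
   groupType live in too small a universe. *)
Record lgroup := LGroup {
  lg_car :> Type;
  lg_mul : lg_car -> lg_car -> lg_car;
  lg_one : lg_car;
  lg_inv : lg_car -> lg_car;
  lg_mulA : associative lg_mul;
  lg_mul1 : left_id lg_one lg_mul;
  lg_mulr1 : right_id lg_one lg_mul;
  lg_mulV : left_inverse lg_one lg_inv lg_mul;
  lg_mulrV : right_inverse lg_one lg_inv lg_mul
}.

Definition lgroup_hom (G H : lgroup) (f : G -> H) : Prop :=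
  {morph f : x y / lg_mul x y >-> lg_mul x y}.

(* The Picard group of C, that is, a group structure on the set of isomorphism
   classes of invertible bicomodules with product the cotensor product. *)
Record Pic_coring (k : comPzRingType) (A : kalgebra k) (C : coring A) :=
  PicCoring {
  picr_group :> lgroup;
  picr_class : inv_bicomodule C -> picr_group;
  picr_surj : forall p, exists Y, picr_class Y = p;
  picr_eq : forall Y Z, picr_class Y = picr_class Z <-> bicomodule_iso Y Z;
  picr_mul : forall Y Z W,
    lg_mul (picr_class Y) (picr_class Z) = picr_class W <-> is_bicotensor Y Z W
}.

(* Products are reversed compositions: (T)(S) = (ST). *)
Record Pic_category (k : comPzRingType) (D : kcategory k) := PicCategory {
  picc_group :> lgroup;
  picc_class : autoequivalence D -> picc_group;
  picc_surj : forall p, exists T, picc_class T = p;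
  picc_eq : forall S T, picc_class S = picc_class T <-> nat_iso S T;
  picc_mul : forall S T U : autoequivalence D,
    lg_mul (picc_class T) (picc_class S) = picc_class U <->
    nat_iso U (fun_comp S T)
}.

Definition fin_supp (I : Type) (V : zmodType) (f : I -> V) : Prop :=
  finite_set [set i | f i <> 0].

(* The sum of a finitely supported family; junk otherwise. *)
Definition fsum (I : Type) (V : zmodType) (f : I -> V) : V :=
  \sum_(i \in [set: {classic I}]) f i.

Section FiniteSums.
Variables (I : Type) (V : zmodType).
Implicit Types f g : I -> V.

Lemma fsum_seq (s : seq {classic I}) f : uniq s ->
  (forall i : {classic I}, i \notin s -> f i = 0) ->
  fsum f = \sum_(i <- s) f i.
Proof.
move=> us sf; rewrite /fsum (fsbigE s) //.
- by apply: eq_bigl => i; rewrite in_setT.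
- by move=> i _ /sf.
Qed.

Lemma fin_suppP f : fin_supp f -> exists s : seq {classic I},
  uniq s /\ forall i : {classic I}, i \notin s -> f i = 0.
Proof.
move=> /(@finite_seqP {classic I}) [s fs]; exists (undup s).
split=> [|i]; first exact: undup_uniq.
rewrite mem_undup => nis; apply: contrapT => fi0.
have : [set i | f i <> 0] i by [].
by rewrite fs /= (negPf nis).
Qed.

Lemma fin_supp_seq (s : seq {classic I}) f :
  (forall i : {classic I}, i \notin s -> f i = 0) -> fin_supp f.
Proof.
move=> sf; apply: (@sub_finite_set _ _ [set` s]); last exact: finite_seq.
by move=> i /= fi0; apply: contrapT => /negP /sf.
Qed.

Lemma fin_supp2 f g : fin_supp f -> fin_supp g -> exists s : seq {classic I},
  [/\ uniq s, forall i : {classic I}, i \notin s -> f i = 0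
    & forall i : {classic I}, i \notin s -> g i = 0].
Proof.
move=> /fin_suppP [s [_ sf]] /fin_suppP [t [_ tg]].
exists (undup (s ++ t)); split=> [|i|i]; first exact: undup_uniq.
- by rewrite mem_undup mem_cat negb_or => /andP[/sf].
- by rewrite mem_undup mem_cat negb_or => /andP[_ /tg].
Qed.

Lemma fin_supp0 : fin_supp (fun _ : I => 0 : V).
Proof. exact: (@fin_supp_seq [::]). Qed.

Lemma fin_suppD f g :
  fin_supp f -> fin_supp g -> fin_supp (fun i => f i + g i).
Proof.
move=> ff fg; have [s [_ sf sg]] := fin_supp2 ff fg.
by apply: (@fin_supp_seq s) => i nis; rewrite sf // sg // addr0.
Qed.

Lemma fsumD f g : fin_supp f -> fin_supp g ->
  fsum (fun i => f i + g i) = fsum f + fsum g.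
Proof.
move=> ff fg; have [s [us sf sg]] := fin_supp2 ff fg.
rewrite !(fsum_seq us) ?big_split //.
by move=> i nis; rewrite sf // sg // addr0.
Qed.

Lemma eq_fsum f g : (forall i, f i = g i) -> fsum f = fsum g.
Proof. by move=> /funext ->. Qed.

Lemma fsum0 f : (forall i, f i = 0) -> fsum f = 0.
Proof. by move=> f0; rewrite (@fsum_seq [::]) ?big_nil. Qed.

Lemma fin_supp1 i f : (forall j, j <> i -> f j = 0) -> fin_supp f.
Proof.
move=> fi; apply: (@fin_supp_seq [:: (i : {classic I})]) => j.
by rewrite inE => /eqP /fi.
Qed.

Lemma fsum1 i f : (forall j, j <> i -> f j = 0) -> fsum f = f i.
Proof.
move=> fi; rewrite (@fsum_seq [:: (i : {classic I})]) ?big_seq1 // => j.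
by rewrite inE => /eqP /fi.
Qed.

End FiniteSums.

Section FiniteSumMorphism.
Variables (I : Type) (V W : zmodType).
Implicit Types f : I -> V.

Lemma fin_supp_morph (h : V -> W) f :
  (forall u v, h (u + v) = h u + h v) -> fin_supp f ->
  fin_supp (fun i => h (f i)).
Proof.
move=> hD; apply: sub_finite_set => i /= hf fi; apply: hf.
by rewrite fi additive0.
Qed.

Lemma fsum_morph (h : V -> W) f :
  (forall u v, h (u + v) = h u + h v) -> fin_supp f ->
  h (fsum f) = fsum (fun i => h (f i)).
Proof.
move=> hD /fin_suppP [s [us sf]].
rewrite (fsum_seq us sf) additive_sum // (fsum_seq us) //.
by move=> i /sf ->; rewrite additive0.
Qed.

End FiniteSumMorphism.

(* V is the internal direct sum of the subgroups P i. *)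
Record direct_sum (V : zmodType) (I : Type) (P : I -> set V) : Prop :=
  DirectSum {
  ds_zero : forall i, P i 0;
  ds_sub : forall i u v, P i u -> P i v -> P i (u - v);
  ds_span : forall v, exists f : I -> V,
    [/\ forall i, P i (f i), fin_supp f & fsum f = v];
  ds_free : forall f g : I -> V, (forall i, P i (f i)) ->
    (forall i, P i (g i)) -> fin_supp f -> fin_supp g -> fsum f = fsum g ->
    forall i, f i = g i
}.

(* hcomp dsP v i is the component of v in P i. *)
Definition hcomp (V : zmodType) (I : Type) (P : I -> set V)
  (dsP : direct_sum P) (v : V) : I -> V := projT1 (cid (ds_span dsP v)).

Section DirectSum.
Variables (V : zmodType) (I : Type) (P : I -> set V) (dsP : direct_sum P).

Lemma hcompP v i : P i (hcomp dsP v i).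
Proof. by rewrite /hcomp; case: cid => f []. Qed.

Lemma hcomp_fin v : fin_supp (hcomp dsP v).
Proof. by rewrite /hcomp; case: cid => f []. Qed.

Lemma hcomp_sum v : fsum (hcomp dsP v) = v.
Proof. by rewrite /hcomp; case: cid => f []. Qed.

Lemma ds_add i u v : P i u -> P i v -> P i (u + v).
Proof.
move=> Pu Pv; rewrite -[v]opprK; apply: ds_sub => //.
by rewrite -sub0r; apply: ds_sub => //; exact: ds_zero.
Qed.

Lemma hcomp_uniq f v : (forall i, P i (f i)) -> fin_supp f -> fsum f = v ->
  forall i, hcomp dsP v i = f i.
Proof.
move=> Pf ff fv; apply: (ds_free dsP) => //.
- exact: hcompP.
- exact: hcomp_fin.
- by rewrite hcomp_sum fv.
Qed.

Lemma hcompD u v i : hcomp dsP (u + v) i = hcomp dsP u i + hcomp dsP v i.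
Proof.
apply: (hcomp_uniq (f := fun i => hcomp dsP u i + hcomp dsP v i)).
- by move=> j; apply: ds_add; exact: hcompP.
- by apply: fin_suppD; exact: hcomp_fin.
- by rewrite fsumD ?hcomp_sum //; exact: hcomp_fin.
Qed.

Lemma hcomp_hom i v j :
  P i v -> hcomp dsP v j = if pselect (j = i) then v else 0.
Proof.
move=> Pv.
apply: (hcomp_uniq (f := fun j => if pselect (j = i) then v else 0)).
- by move=> l; case: pselect => [li|_] /=; [rewrite li | exact: ds_zero].
- by apply: (@fin_supp1 _ _ i) => l li; case: pselect.
- rewrite (@fsum1 _ _ i) => [|l li]; first by case: pselect.
  by case: pselect.
Qed.

Lemma hcomp_id i v : P i v -> hcomp dsP v i = v.
Proof. by move=> /(hcomp_hom i) ->; case: pselect. Qed.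

Lemma hcomp_ne i v j : P i v -> j <> i -> hcomp dsP v j = 0.
Proof. by move=> /(hcomp_hom j) -> ?; case: pselect. Qed.

Lemma ds_ext (W : zmodType) (f g : V -> W) :
  (forall u v, f (u + v) = f u + f v) -> (forall u v, g (u + v) = g u + g v) ->
  (forall i v, P i v -> f v = g v) -> forall v, f v = g v.
Proof.
move=> fD gD fg v; rewrite -(hcomp_sum v).
rewrite !fsum_morph //; try exact: hcomp_fin.
by apply: eq_fsum => i; apply/fg/hcompP.
Qed.

End DirectSum.

Section Graded.
Variables (k : comPzRingType) (G : groupType).

Record gset := GSet {
  gset_car :> Type;
  gact : gset_car -> G -> gset_car;
  gact1 : forall x, gact x 1%g = x;
  gactM : forall x g h, gact (gact x g) h = gact x (g * h)%g
}.

(* gra_one is a consequence of the other axioms, as G is a group. *)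
Record graded_algebra := GradedAlgebra {
  gra_alg :> kalgebra k;
  gra_part : G -> set gra_alg;
  gra_sum : direct_sum gra_part;
  gra_scale : forall g c a, gra_part g a -> gra_part g (kunit gra_alg c * a);
  gra_one : gra_part 1%g 1;
  gra_mul : forall g h a b,
    gra_part g a -> gra_part h b -> gra_part (g * h)%g (a * b)
}.

Definition gra_comp (A : graded_algebra) (b : A) (h : G) : A :=
  hcomp (gra_sum A) b h.

Record graded_module (X : gset) (A : graded_algebra) := GradedModule {
  grm_mod :> rmodType A;
  grm_part : X -> set grm_mod;
  grm_sum : direct_sum grm_part;
  grm_act : forall x g m a,
    grm_part x m -> gra_part g a -> grm_part (gact x g) (m *r a)
}.

End Graded.

Section GradedCategory.
Variables (k : comPzRingType) (G : groupType).
Variables (X : gset G) (A : graded_algebra k G).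

Definition graded_map (M N : graded_module X A) (f : M -> N) : Prop :=
  rlinear f /\ forall x m, grm_part x m -> grm_part x (f m).

Lemma kunit_part (c : k) : gra_part 1%g (kunit A c).
Proof. by rewrite -[kunit A c]mulr1; apply/gra_scale/gra_one. Qed.

Section Hom.
Variables M N : graded_module X A.

Fact graded_map0 : graded_map (fun _ : M => 0 : N).
Proof.
by split=> [|x m _]; [exact: rlinear0 | exact: ds_zero (grm_sum N) _].
Qed.

Fact graded_mapN (f : M -> N) : graded_map f -> graded_map (fun m => - f m).
Proof.
case=> flin fgr; split=> [|x m /fgr fm]; first exact: rlinearN.
rewrite -sub0r; apply: (ds_sub (grm_sum N)) => //.
exact: ds_zero (grm_sum N) _.
Qed.

Fact graded_mapD (f g : M -> N) :
  graded_map f -> graded_map g -> graded_map (fun m => f m + g m).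
Proof.
case=> flin fgr [glin ggr]; split=> [|x m Pm]; first exact: rlinearD.
by apply: (ds_add (grm_sum N)); [exact: fgr | exact: ggr].
Qed.

Fact graded_mapZ (c : k) (f : M -> N) :
  graded_map f -> graded_map (fun m => f m *r kunit A c).
Proof.
case=> flin fgr; split=> [|x m /fgr fm]; first exact: rlinearZ.
by rewrite -[x]gact1; apply: grm_act => //; exact: kunit_part.
Qed.

Definition graded_hom_pred : hom_pred M N :=
  HomPred graded_map0 graded_mapN graded_mapD graded_mapZ.

End Hom.

Definition graded_hom (M N : graded_module X A) : lmodType k :=
  homs (graded_hom_pred M N).

Fact graded_map_id (M : graded_module X A) : graded_map (@id M).
Proof. by []. Qed.

Fact graded_map_comp (M N P : graded_module X A) (g : N -> P) (f : M -> N) :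
  graded_map g -> graded_map f -> graded_map (fun m => g (f m)).
Proof.
case=> -[gD gZ] ggr [[fD fZ] fgr]; split; last by move=> x m /fgr /ggr.
by split=> *; rewrite ?fD ?fZ ?gD ?gZ.
Qed.

Definition graded_cmp (M N P : graded_module X A)
  (g : graded_hom N P) (f : graded_hom M N) : graded_hom M P :=
  Hom (P := graded_hom_pred M P) (graded_map_comp (hom_funP g) (hom_funP f)).

Lemma graded_homP (M N : graded_module X A) (f g : homs (graded_hom_pred M N)) :
  (forall m, f m = g m) -> f = g :> graded_hom M N.
Proof. exact: homsP. Qed.

Fact graded_cmpDr (M N P : graded_module X A) (g : graded_hom N P)
    (e f : graded_hom M N) :
  graded_cmp g (e + f) = graded_cmp g e + graded_cmp g f.
Proof.
by case: g => g [[gD gZ] ggr]; apply: graded_homP => m; rewrite /= gD.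
Qed.

Fact graded_cmpZr (M N P : graded_module X A) x (g : graded_hom N P)
    (f : graded_hom M N) :
  graded_cmp g (x *: f) = x *: graded_cmp g f.
Proof.
by case: g => g [[gD gZ] ggr]; apply: graded_homP => m; rewrite /= gZ.
Qed.

Definition graded_cat : kcategory k.
Proof.
exists (graded_module X A) graded_hom
  (fun M => Hom (P := graded_hom_pred M M) (graded_map_id M))
  graded_cmp.
all: try by move=> *; exact: graded_homP.
- exact: graded_cmpDr.
- exact: graded_cmpZr.
Defined.

End GradedCategory.

Record free_mod (A : pzRingType) (X : Type) := FreeMod {
  fm_fun :> X -> A;
  fm_fin : fin_supp fm_fun
}.

Section FreeModule.
Variables (A : pzRingType) (X : Type).
Implicit Types f g : free_mod A X.

Lemma free_modP f g : (forall x, f x = g x) -> f = g.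
Proof.
case: f g => [f ff] [g gf] /= /funext fg; case: _ / fg gf => gf.
by congr FreeMod; exact: Prop_irrelevance.
Qed.

HB.instance Definition _ := gen_eqMixin (free_mod A X).
HB.instance Definition _ := gen_choiceMixin (free_mod A X).

Fact fmN_fin f : fin_supp (fun x => - f x).
Proof. by apply: (fin_supp_morph _ (fm_fin f)) => u v; rewrite opprD. Qed.
Fact fmZ_fin a f : fin_supp (fun x => a * f x).
Proof. by apply: (fin_supp_morph _ (fm_fin f)) => u v; rewrite mulrDr. Qed.

Definition fm0 : free_mod A X := FreeMod (fin_supp0 X A).
Definition fmN f : free_mod A X := FreeMod (fmN_fin f).
Definition fmD f g : free_mod A X := FreeMod (fin_suppD (fm_fin f) (fm_fin g)).
Definition fmZ (a : A) f : free_mod A X := FreeMod (fmZ_fin a f).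

Fact fmDA : associative fmD.
Proof. by move=> f g h; apply: free_modP => m /=; rewrite addrA. Qed.
Fact fmDC : commutative fmD.
Proof. by move=> f g; apply: free_modP => m /=; rewrite addrC. Qed.
Fact fmD0 : left_id fm0 fmD.
Proof. by move=> f; apply: free_modP => m /=; rewrite add0r. Qed.
Fact fmDN : left_inverse fm0 fmN fmD.
Proof. by move=> f; apply: free_modP => m /=; rewrite addNr. Qed.

HB.instance Definition _ :=
  GRing.isZmodule.Build (free_mod A X) fmDA fmDC fmD0 fmDN.

Fact fmZA a b f : fmZ a (fmZ b f) = fmZ (a * b) f.
Proof. by apply: free_modP => m /=; rewrite mulrA. Qed.
Fact fmZ1 : left_id 1 fmZ.
Proof. by move=> f; apply: free_modP => m /=; rewrite mul1r. Qed.
Fact fmZDr : right_distributive fmZ +%R.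
Proof. by move=> c f g; apply: free_modP => m /=; rewrite mulrDr. Qed.
Fact fmZDl f : {morph fmZ^~ f : c d / c + d}.
Proof. by move=> c d; apply: free_modP => m /=; rewrite mulrDl. Qed.

HB.instance Definition _ := GRing.Zmodule_isLmodule.Build A (free_mod A X)
  fmZA fmZ1 fmZDr fmZDl.

(* a (x) x *)
Definition single (x : X) (a : A) : free_mod A X.
Proof.
exists (fun y => if pselect (y = x) then a else 0).
by apply: (@fin_supp1 _ _ x) => y yx; case: pselect.
Defined.

Lemma singleD x a b : single x (a + b) = single x a + single x b.
Proof.
apply: free_modP => y; rewrite -[RHS]/(single x a y + single x b y) /=.
by case: pselect => yx //=; rewrite addr0.
Qed.

Lemma single_scale a x b : a *: single x b = single x (a * b).
Proof.
apply: free_modP => y; rewrite -[LHS]/(a * single x b y) /=.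
by case: pselect => yx //=; rewrite mulr0.
Qed.

Definition fm_lift (V : zmodType) (h : X -> A -> V) f : V :=
  fsum (fun x => h x (f x)).

Section Lift.
Variables (V : zmodType) (h : X -> A -> V).
Hypothesis hD : forall x a b, h x (a + b) = h x a + h x b.

Fact fm_lift_fin f : fin_supp (fun x => h x (f x)).
Proof.
apply: sub_finite_set (fm_fin f) => x /= hf fx; apply: hf.
by rewrite fx additive0.
Qed.

Lemma fm_liftD f g : fm_lift h (f + g) = fm_lift h f + fm_lift h g.
Proof.
rewrite /fm_lift -fsumD; try exact: fm_lift_fin.
by apply: eq_fsum => x; rewrite -hD.
Qed.

Lemma fm_lift_single x a : fm_lift h (single x a) = h x a.
Proof.
rewrite /fm_lift (@fsum1 _ _ x) => [|y yx] /=; case: pselect => yx' //=.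
exact: additive0.
Qed.

End Lift.

Lemma fm_ext (V : zmodType) (u v : free_mod A X -> V) :
  (forall f g, u (f + g) = u f + u g) -> (forall f g, v (f + g) = v f + v g) ->
  (forall x a, u (single x a) = v (single x a)) -> forall f, u f = v f.
Proof.
move=> uD vD uv f.
suff -> : f = fm_lift single f.
  have sf : fin_supp (fun x => single x (f x)).
    by apply: fm_lift_fin => x a b; exact: singleD.
  by rewrite /fm_lift !fsum_morph //; apply: eq_fsum.
apply: free_modP => x.
pose ev (g : free_mod A X) := g x.
have evD g h : ev (g + h) = ev g + ev h by [].
rewrite -[RHS]/(ev _) /fm_lift fsum_morph //; last first.
  by apply: fm_lift_fin => y a b; exact: singleD.
rewrite (@fsum1 _ _ x) /ev => [|y yx] /=; first by case: pselect.
by case: pselect => // xy; case: yx.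
Qed.

End FreeModule.

(* A (x) kX, realized as the free left A-module on X. *)
Definition AkX (k : comPzRingType) (G : groupType) (X : gset G)
  (A : graded_algebra k G) : Type := free_mod A X.

Section GradedCoring.
Variables (k : comPzRingType) (G : groupType).
Variables (X : gset G) (A : graded_algebra k G).

Local Notation C := (AkX X A).

HB.instance Definition _ := GRing.Lmodule.on C.

Definition AkX_single (x : X) (a : A) : C := single x a.
Local Notation "a # x" := (AkX_single x a) (at level 35).

Lemma AkX_singleD x (a b : A) : (a + b) # x = a # x + b # x.
Proof. exact: singleD. Qed.

Lemma AkX_single_scale (a : A) x b : a *: (b # x) = (a * b) # x.
Proof. exact: single_scale. Qed.

Lemma AkX_ext (V : zmodType) (u v : C -> V) :
  (forall f g, u (f + g) = u f + u g) -> (forall f g, v (f + g) = v f + v g) ->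
  (forall x a, u (a # x) = v (a # x)) -> forall f, u f = v f.
Proof. exact: fm_ext. Qed.

Lemma gra_compD (a b : A) g : gra_comp (a + b) g = gra_comp a g + gra_comp b g.
Proof. exact: hcompD. Qed.

(* (a (x) x) b = sum_g a b_g (x) x g *)
Definition AkX_ract1 (x : X) (a b : A) : C :=
  fsum (fun g => (a * gra_comp b g) # gact x g).

Definition AkX_ract (f : C) (b : A) : C :=
  fm_lift (fun x a => AkX_ract1 x a b) f.

Lemma AkX_ract1_fin (x : X) (a b : A) :
  fin_supp (fun g => (a * gra_comp b g) # gact x g).
Proof.
apply: sub_finite_set (hcomp_fin (gra_sum A) b) => g /= sg bg; apply: sg.
rewrite /gra_comp bg mulr0; apply: (addrI (0 # gact x g)).
by rewrite -AkX_singleD !addr0.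
Qed.

Lemma AkX_ract1D (x : X) (a b c : A) :
  AkX_ract1 x (a + b) c = AkX_ract1 x a c + AkX_ract1 x b c.
Proof.
rewrite /AkX_ract1 -fsumD; try exact: AkX_ract1_fin.
by apply: eq_fsum => g; rewrite mulrDl AkX_singleD.
Qed.

Lemma AkX_ract1Dr (x : X) (a b c : A) :
  AkX_ract1 x a (b + c) = AkX_ract1 x a b + AkX_ract1 x a c.
Proof.
rewrite /AkX_ract1 -fsumD; try exact: AkX_ract1_fin.
by apply: eq_fsum => g; rewrite gra_compD mulrDr AkX_singleD.
Qed.

Fact AkX_ractDl (f g : C) a : AkX_ract (f + g) a = AkX_ract f a + AkX_ract g a.
Proof. by apply: fm_liftD => *; exact: AkX_ract1D. Qed.

Lemma AkX_ract_single1 x (a b : A) : AkX_ract (a # x) b = AkX_ract1 x a b.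
Proof. by apply: fm_lift_single => *; exact: AkX_ract1D. Qed.

Fact AkX_ractDr (f : C) a b : AkX_ract f (a + b) = AkX_ract f a + AkX_ract f b.
Proof.
move: f; apply: AkX_ext => [f g|f g|x c]; first exact: AkX_ractDl.
- by rewrite !AkX_ractDl addrACA.
- by rewrite !AkX_ract_single1 AkX_ract1Dr.
Qed.

Lemma AkX_ract_single x (a b : A) g :
  gra_part g b -> AkX_ract (a # x) b = (a * b) # gact x g.
Proof.
move=> bg; rewrite AkX_ract_single1 /AkX_ract1 (@fsum1 _ _ g) => [|h hg].
  by rewrite /gra_comp (hcomp_id _ bg).
rewrite /gra_comp (hcomp_ne _ bg hg) mulr0.
by apply: (addrI (0 # gact x h)); rewrite -AkX_singleD !addr0.
Qed.

Lemma gra_ext (W : zmodType) (f g : A -> W) :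
  (forall u v, f (u + v) = f u + f v) -> (forall u v, g (u + v) = g u + g v) ->
  (forall h v, gra_part h v -> f v = g v) -> forall v, f v = g v.
Proof. exact: ds_ext (gra_sum A) _ _ _. Qed.

Fact AkX_ractA (f : C) a b : AkX_ract (AkX_ract f a) b = AkX_ract f (a * b).
Proof.
move: f; apply: AkX_ext => [f g|f g|x c]; rewrite ?AkX_ractDl //.
move: a; apply: gra_ext => [u v|u v|g a ag].
- by rewrite AkX_ractDr AkX_ractDl.
- by rewrite mulrDl AkX_ractDr.
move: b; apply: gra_ext => [u v|u v|h b bh].
- by rewrite AkX_ractDr.
- by rewrite mulrDr AkX_ractDr.
rewrite (AkX_ract_single _ _ ag) (AkX_ract_single _ _ bh).
by rewrite (AkX_ract_single _ _ (gra_mul ag bh)) gactM mulrA.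
Qed.

Fact AkX_ract_1 (f : C) : AkX_ract f 1 = f.
Proof.
move: f; apply: (AkX_ext (v := id)) => [f g|//|x c]; first exact: AkX_ractDl.
by rewrite (AkX_ract_single _ _ (gra_one A)) gact1 mulr1.
Qed.

HB.instance Definition _ := isRightModule.Build A C
  AkX_ractA AkX_ract_1 AkX_ractDl AkX_ractDr.

Lemma AkX_single_ract x (a b : A) g :
  gra_part g b -> (a # x) *r b = (a * b) # gact x g.
Proof. exact: AkX_ract_single. Qed.

Fact AkX_biact a (f : C) b : (a *: f) *r b = a *: (f *r b).
Proof.
move: f; apply: AkX_ext => [f g|f g|x c].
- by rewrite scalerDr ractDl.
- by rewrite ractDl scalerDr.
move: b; apply: gra_ext => [u v|u v|g b bg].
- by rewrite ractDr.
- by rewrite ractDr scalerDr.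
by rewrite AkX_single_scale !(AkX_single_ract _ _ bg) AkX_single_scale mulrA.
Qed.

HB.instance Definition _ := isBimodule.Build A C AkX_biact.

Fact AkX_k : kcentral (A := A) C.
Proof.
move=> c; apply: AkX_ext => [f g|f g|x a]; rewrite ?scalerDr ?ractDl //.
by rewrite AkX_single_scale (AkX_single_ract _ _ (kunit_part A c)) gact1 kunitC.
Qed.

Definition AkX_comul : C -> tensor C C :=
  fm_lift (fun x (a : A) => tens (a # x) (1 # x)).

Definition AkX_counit : C -> A := fm_lift (fun x (a : A) => a).

Lemma AkX_comulD f g : AkX_comul (f + g) = AkX_comul f + AkX_comul g.
Proof. by apply: fm_liftD => *; rewrite AkX_singleD tensDl. Qed.

Lemma AkX_comul_single x a : AkX_comul (a # x) = tens (a # x) (1 # x).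
Proof.
by apply: (fm_lift_single (V := tensor C C)) => *; rewrite AkX_singleD tensDl.
Qed.

Lemma AkX_counitD f g : AkX_counit (f + g) = AkX_counit f + AkX_counit g.
Proof. exact: fm_liftD. Qed.

Lemma AkX_counit_single x a : AkX_counit (a # x) = a.
Proof. exact: fm_lift_single. Qed.

Fact AkX_comul_l : llinear AkX_comul.
Proof.
split=> [|a]; first exact: AkX_comulD.
apply: AkX_ext => [f g|f g|x b]; rewrite ?scalerDr ?AkX_comulD ?scalerDr //.
by rewrite AkX_single_scale !AkX_comul_single tens_lact AkX_single_scale.
Qed.

Fact AkX_comul_r : rlinear AkX_comul.
Proof.
split=> [|f b]; first exact: AkX_comulD.
move: f; apply: AkX_ext => [f g|f g|x a]; rewrite ?ractDl ?AkX_comulD ?ractDl //.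
move: b; apply: gra_ext => [u v|u v|g b bg].
- by rewrite ractDr AkX_comulD.
- by rewrite ractDr.
rewrite (AkX_single_ract _ _ bg) !AkX_comul_single tens_ract.
rewrite (AkX_single_ract _ _ bg) mul1r.
have -> : b # gact x g = b *: (1 # gact x g) by rewrite AkX_single_scale mulr1.
by rewrite -tens_bal (AkX_single_ract _ _ bg).
Qed.

Fact AkX_counitZl a f : AkX_counit (a *: f) = a * AkX_counit f.
Proof.
move: f; apply: AkX_ext => [f g|f g|x b].
- by rewrite scalerDr AkX_counitD.
- by rewrite AkX_counitD mulrDr.
- by rewrite AkX_single_scale !AkX_counit_single.
Qed.

Fact AkX_counitZr f a : AkX_counit (f *r a) = AkX_counit f * a.
Proof.
move: f; apply: AkX_ext => [f g|f g|x b].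
- by rewrite ractDl AkX_counitD.
- by rewrite AkX_counitD mulrDl.
move: a; apply: gra_ext => [u v|u v|g a ag].
- by rewrite ractDr AkX_counitD.
- by rewrite mulrDr.
- by rewrite (AkX_single_ract _ _ ag) !AkX_counit_single.
Qed.

Fact AkX_comulA f :
  tassoc (tmap AkX_comul id (AkX_comul f)) = tmap id AkX_comul (AkX_comul f).
Proof.
have rl := AkX_comul_r; have ll := AkX_comul_l.
move: f; apply: AkX_ext => [f g|f g|x a].
- by rewrite AkX_comulD (tmapD _ _ rl) // tassocD.
- by rewrite AkX_comulD (tmapD _ _ _ ll).
- by rewrite AkX_comul_single !tmapE // !AkX_comul_single tassocE.
Qed.

Lemma AkX_counit_ball :
  balanced (fun c1 c2 : C => AkX_counit c1 *: c2).
Proof.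
split=> *; rewrite ?AkX_counitD ?scalerDl ?scalerDr //.
by rewrite AkX_counitZr scalerA.
Qed.

Lemma AkX_counit_balr :
  balanced (fun c1 c2 : C => c1 *r AkX_counit c2).
Proof.
split=> *; rewrite ?AkX_counitD ?ractDl ?ractDr //.
by rewrite AkX_counitZl ractA.
Qed.

Fact AkX_comul1l f :
  tlift (fun c1 c2 : C => AkX_counit c1 *: c2) (AkX_comul f) = f.
Proof.
have bal := AkX_counit_ball.
move: f; apply: (AkX_ext (v := id)) => [f g|//|x a].
- by rewrite AkX_comulD (tliftD _ _ bal).
- rewrite AkX_comul_single (tliftE _ _ bal) AkX_counit_single.
  by rewrite AkX_single_scale mulr1.
Qed.

Fact AkX_comul1r f :
  tlift (fun c1 c2 : C => c1 *r AkX_counit c2) (AkX_comul f) = f.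
Proof.
have bal := AkX_counit_balr.
move: f; apply: (AkX_ext (v := id)) => [f g|//|x a].
- by rewrite AkX_comulD (tliftD _ _ bal).
- by rewrite AkX_comul_single (tliftE _ _ bal) AkX_counit_single ract1.
Qed.

Definition AkX_coring : coring A :=
  Coring AkX_k AkX_comul_l AkX_comul_r AkX_counitD AkX_counitZl AkX_counitZr
    AkX_comulA AkX_comul1l AkX_comul1r.

End GradedCoring.

Section GradedToComodule.
Variables (k : comPzRingType) (G : groupType).
Variables (X : gset G) (A : graded_algebra k G).
Local Notation C := (AkX_coring X A).

Section Object.
Variable M : graded_module X A.

Definition grm_coact (m : M) : tensor M C :=
  fsum (fun x => tens (hcomp (grm_sum M) m x) (AkX_single x 1 : C)).

Lemma tens0l (m : C) : tens (0 : M) m = 0.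
Proof. by apply: (addrI (tens 0 m)); rewrite -tensDl !addr0. Qed.

Lemma grm_coact_fin (m : M) : fin_supp
  (fun x => tens (hcomp (grm_sum M) m x) (AkX_single x 1 : C)).
Proof.
apply: sub_finite_set (hcomp_fin (grm_sum M) m) => x /= tx mx; apply: tx.
by rewrite mx tens0l.
Qed.

Lemma grm_coactD (m n : M) : grm_coact (m + n) = grm_coact m + grm_coact n.
Proof.
rewrite /grm_coact -fsumD; try exact: grm_coact_fin.
by apply: eq_fsum => x; rewrite hcompD tensDl.
Qed.

Lemma grm_coact_hom x (m : M) :
  grm_part x m -> grm_coact m = tens m (AkX_single x 1 : C).
Proof.
move=> mx; rewrite /grm_coact (@fsum1 _ _ x) => [|y yx].
  by rewrite (hcomp_id _ mx).
by rewrite (hcomp_ne _ mx yx) tens0l.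
Qed.

Lemma grm_ext (W : zmodType) (f g : M -> W) :
  (forall u v, f (u + v) = f u + f v) -> (forall u v, g (u + v) = g u + g v) ->
  (forall x v, grm_part x v -> f v = g v) -> forall v, f v = g v.
Proof. exact: ds_ext (grm_sum M) _ _ _. Qed.

Fact grm_coact_r : rlinear grm_coact.
Proof.
split=> [|m b]; first exact: grm_coactD.
move: m; apply: grm_ext => [m n|m n|x m mx];
  rewrite ?ractDl ?grm_coactD ?ractDl //.
move: b; apply: gra_ext => [u v|u v|g b bg].
- by rewrite ractDr grm_coactD.
- by rewrite ractDr.
rewrite (grm_coact_hom (grm_act mx bg)) (grm_coact_hom mx) tens_ract.
by rewrite tens_bal AkX_single_scale (AkX_single_ract _ _ bg) mul1r mulr1.
Qed.

Fact grm_coactA m : tassoc (tmap grm_coact (@id C) (grm_coact m))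
                    = tmap id (@comul _ _ C) (grm_coact m).
Proof.
have rl := grm_coact_r; have ll := @comul_l _ _ C.
move: m; apply: grm_ext => [m n|m n|x m mx].
- by rewrite grm_coactD (tmapD _ _ rl) // tassocD.
- by rewrite grm_coactD (tmapD _ _ _ ll).
- rewrite (grm_coact_hom mx) !tmapE // (grm_coact_hom mx) tassocE.
  by rewrite [comul _]AkX_comul_single.
Qed.

Fact grm_coact1 m :
  tlift (fun (m : M) (c : C) => m *r counit c) (grm_coact m) = m.
Proof.
have bal : balanced (fun (m : M) (c : C) => m *r counit c).
  split=> *; rewrite ?counitD ?ractDl ?ractDr //.
  by rewrite counitZl ractA.
move: m; apply: (grm_ext (g := id)) => [m n|//|x m mx].
- by rewrite grm_coactD (tliftD _ _ bal).
- rewrite (grm_coact_hom mx) (tliftE _ _ bal) [counit _]AkX_counit_single.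
  exact: ract1.
Qed.

Definition grm_comodule : comodule C :=
  Comodule grm_coact_r grm_coactA grm_coact1.

End Object.

Fact grm_comodule_map (M N : graded_module X A) (f : M -> N) :
  graded_map f -> comodule_map (M := grm_comodule M) (N := grm_comodule N) f.
Proof.
case=> flin fgr; split=> // m; have [fD _] := flin.
change (grm_coact (f m) = tmap f (@id C) (grm_coact m)); move: m.
apply: grm_ext => [m n|m n|x m mx].
- by rewrite fD grm_coactD.
- by rewrite grm_coactD (tmapD _ _ flin).
- by rewrite (grm_coact_hom (fgr _ _ mx)) (grm_coact_hom mx) tmapE.
Qed.

(* The graded module M, with coaction m |-> sum_x m_x (x) (1 (x) x). *)
Definition graded_to_comodule : kfunctor (graded_cat X A) (comodule_cat C).
Proof.
exists (grm_comodule : ob (graded_cat X A) -> ob (comodule_cat C))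
  (fun (M N : graded_module X A) (f : graded_hom M N) =>
     Hom (P := comodule_hom_pred (grm_comodule M) (grm_comodule N))
       (grm_comodule_map (hom_funP f))).
all: by move=> *; exact: comodule_homP.
Defined.

End GradedToComodule.

Lemma bijective_inv (T U : Type) (f : T -> U) :
  bijective f -> exists g, cancel f g /\ cancel g f.
Proof. by case=> g fg gf; exists g. Qed.

Definition binv (T U : Type) (f : T -> U) (fP : bijective f) : U -> T :=
  projT1 (cid (bijective_inv fP)).

Lemma binvK (T U : Type) (f : T -> U) (fP : bijective f) :
  cancel f (binv fP) /\ cancel (binv fP) f.
Proof. exact: projT2 (cid (bijective_inv fP)). Qed.

Lemma bijective_binv (T U : Type) (f : T -> U) (fP : bijective f) :
  bijective (binv fP).
Proof. by have [fK Kf] := binvK fP; exists f. Qed.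

Record kalg_aut (k : comPzRingType) (A : kalgebra k) (r : A -> A) : Prop :=
  KAlgAut {
  kaut_bij : bijective r;
  kautD : forall a b, r (a + b) = r a + r b;
  kautM : forall a b, r (a * b) = r a * r b;
  kaut_unit : forall c, r (kunit A c) = kunit A c
}.

Section KAlgAut.
Variables (k : comPzRingType) (A : kalgebra k).

Lemma kaut1 (r : A -> A) : kalg_aut r -> r 1 = 1.
Proof. by move=> ra; have := kaut_unit ra 1; rewrite rmorph1. Qed.

Lemma kaut_id : kalg_aut (@id A).
Proof. by split=> //; exists id. Qed.

Lemma kaut_comp (r s : A -> A) : kalg_aut r -> kalg_aut s -> kalg_aut (r \o s).
Proof.
move=> [rb rD rM ru] [sb sD sM su]; split=> [|a b|a b|c] /=.
- exact: bij_comp.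
- by rewrite sD rD.
- by rewrite sM rM.
- by rewrite su ru.
Qed.

Lemma kaut_inv (r : A -> A) (ra : kalg_aut r) : kalg_aut (binv (kaut_bij ra)).
Proof.
have [rK Kr] := binvK (kaut_bij ra); split=> [|a b|a b|c].
- exact: bijective_binv.
- by apply: (can_inj rK); rewrite (kautD ra) !Kr.
- by apply: (can_inj rK); rewrite (kautM ra) !Kr.
- by apply: (can_inj rK); rewrite (kaut_unit ra) !Kr.
Qed.

End KAlgAut.

Record coring_aut (k : comPzRingType) (A : kalgebra k) (C : coring A) :=
  CoringAut {
  caut :> C -> C;
  caut_alg : A -> A;
  caut_algP : kalg_aut caut_alg;
  caut_bij : bijective caut;
  cautD : forall c d, caut (c + d) = caut c + caut d;
  cautZl : forall a c, caut (a *: c) = caut_alg a *: caut c;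
  cautZr : forall c a, caut (c *r a) = caut c *r caut_alg a;
  caut_comul : forall c, comul (caut c) = tmap caut caut (comul c);
  caut_counit : forall c, counit (caut c) = caut_alg (counit c)
}.

Section Coassociativity.
Variables (k : comPzRingType) (A : kalgebra k) (C : coring A).

(* A map out of C (x) (C (x) C), applied to both sides of coassociativity. *)
Lemma comulA_lift (V : zmodType) (F : C -> C -> C -> V) (c : C) :
  (forall m m' n p, F (m + m') n p = F m n p + F m' n p) ->
  (forall m n n' p, F m (n + n') p = F m n p + F m n' p) ->
  (forall m n p p', F m n (p + p') = F m n p + F m n p') ->
  (forall m a n p, F (m *r a) n p = F m (a *: n) p) ->
  (forall m n a p, F m (n *r a) p = F m n (a *: p)) ->
  tlift (fun m n => tlift (fun m1 m2 => F m1 m2 n) (comul m)) (comul c)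
  = tlift (fun m n => tlift (F m) (comul n)) (comul c).
Proof.
move=> F1 F2 F3 F12 F23.
have bin m : balanced (F m) by split.
have bout : balanced (fun (m : C) (t : tensor C C) => tlift (F m) t).
  split=> [m m' t|m t u|m a t]; first 2 last.
  - move: t; apply: tensor_ext => [t u|t u|n p].
    + exact: tliftD.
    + by rewrite scalerDr; exact: tliftD.
    + by rewrite tens_lact !tliftE.
  - move: t; apply: tensor_ext => [t u|t u|n p].
    + exact: tliftD.
    + by rewrite !(tliftD _ _ (bin _)) addrACA.
    + by rewrite !tliftE.
  - exact: tliftD.
have oD t u := tliftD t u bout; have oE m t := tliftE m t bout.
set o := tlift _ in oD oE.
have -> : tlift (fun m n => tlift (F m) (comul n)) (comul c)
    = o (tmap id (@comul _ _ C) (comul c)).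
  rewrite /tmap (tlift_comp _ _ oD).
  by apply: eq_tlift => m n; rewrite -oE.
rewrite -comulA /tmap (tlift_comp _ _ (@tassocD _ C C C)) (tlift_comp _ _ oD).
apply: eq_tlift => m n.
have bF : balanced (fun m1 m2 => F m1 m2 n).
  by split=> *; rewrite ?F1 ?F2 ?F12.
move: (comul m); apply: tensor_ext => [t u|t u|m1 m2].
- exact: tliftD.
- by rewrite tensDl tassocD oD.
- by rewrite tassocE oE !tliftE.
Qed.

End Coassociativity.

(* C as a right comodule, with left action a . c = rho^-1(a) c and left
   coaction c |-> phi(c_1) (x) c_2. *)
Section Twist.
Variables (k : comPzRingType) (A : kalgebra k) (C : coring A).

Definition twisted (s : coring_aut C) : Type := C.

Variable s : coring_aut C.
Local Notation phi := (caut s).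
Local Notation rho := (caut_alg s).
Local Notation rho' := (binv (kaut_bij (caut_algP s))).
Local Notation T := (twisted s).

HB.instance Definition _ := RModule.on T.

Let rhoK : cancel rho rho' := proj1 (binvK (kaut_bij (caut_algP s))).
Let Krho : cancel rho' rho := proj2 (binvK (kaut_bij (caut_algP s))).
Let rho'P : kalg_aut rho' := kaut_inv (caut_algP s).

Definition twisted_scale (a : A) (c : T) : T := rho' a *: (c : C).

Fact twisted_scaleA a b c :
  twisted_scale a (twisted_scale b c) = twisted_scale (a * b) c.
Proof. by rewrite /twisted_scale scalerA (kautM rho'P). Qed.
Fact twisted_scale1 : left_id 1 twisted_scale.
Proof. by move=> c; rewrite /twisted_scale (kaut1 rho'P) scale1r. Qed.
Fact twisted_scaleDr : right_distributive twisted_scale +%R.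
Proof. by move=> a c d; rewrite /twisted_scale scalerDr. Qed.
Fact twisted_scaleDl c : {morph twisted_scale^~ c : a b / a + b}.
Proof. by move=> a b; rewrite /twisted_scale (kautD rho'P) scalerDl. Qed.

HB.instance Definition _ := GRing.Zmodule_isLmodule.Build A T
  twisted_scaleA twisted_scale1 twisted_scaleDr twisted_scaleDl.

Fact twisted_biact a (c : T) b : (a *: c) *r b = a *: (c *r b).
Proof. exact: (@lractA _ C). Qed.

HB.instance Definition _ := isBimodule.Build A T twisted_biact.

Lemma twisted_scaleE a (c : T) : a *: c = rho' a *: (c : C) :> C.
Proof. by []. Qed.

Fact twisted_k : kcentral (A := A) T.
Proof.
by move=> c t; rewrite [LHS]twisted_scaleE (kaut_unit rho'P) coring_k.
Qed.

Definition twisted_lcoact (c : T) : tensor C T :=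
  tlift (fun c1 c2 : C => tens (phi c1) (c2 : T)) (comul c).

Definition twisted_rcoact (c : T) : tensor T C :=
  tlift (fun c1 c2 : C => tens (c1 : T) c2) (comul c).

Lemma twisted_lbal : balanced (fun c1 c2 : C => tens (phi c1) (c2 : T)).
Proof.
split=> *; rewrite ?cautD ?tensDl ?tensDr // cautZr tens_bal.
by congr tens; rewrite [LHS]twisted_scaleE rhoK.
Qed.

Lemma twisted_rbal : balanced (fun c1 c2 : C => tens (c1 : T) c2).
Proof. by split=> *; rewrite ?tensDl ?tensDr // -tens_bal. Qed.

Let lD u v := tliftD u v twisted_lbal.
Let lE u v := tliftE u v twisted_lbal.
Let rD u v := tliftD u v twisted_rbal.
Let rE u v := tliftE u v twisted_rbal.

Lemma twisted_lcoactD c d :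
  twisted_lcoact (c + d) = twisted_lcoact c + twisted_lcoact d.
Proof. by rewrite /twisted_lcoact (proj1 (comul_l C)) lD. Qed.

Lemma twisted_rcoactD c d :
  twisted_rcoact (c + d) = twisted_rcoact c + twisted_rcoact d.
Proof. by rewrite /twisted_rcoact (proj1 (comul_l C)) rD. Qed.

Fact twisted_lcoact_l : llinear twisted_lcoact.
Proof.
split=> [|a c]; first exact: twisted_lcoactD.
rewrite /twisted_lcoact [a *: c]twisted_scaleE (proj2 (comul_l C)).
move: (comul _); apply: tensor_ext => [t u|t u|c1 c2].
- by rewrite scalerDr lD.
- by rewrite lD scalerDr.
- by rewrite tens_lact !lE tens_lact cautZl Krho.
Qed.

Fact twisted_lcoact_r : rlinear twisted_lcoact.
Proof.
split=> [|c a]; first exact: twisted_lcoactD.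
rewrite /twisted_lcoact [comul _](proj2 (comul_r C)).
move: (comul _); apply: tensor_ext => [t u|t u|c1 c2].
- by rewrite ractDl lD.
- by rewrite lD ractDl.
- by rewrite tens_ract !lE tens_ract.
Qed.

Fact twisted_rcoact_l : llinear twisted_rcoact.
Proof.
split=> [|a c]; first exact: twisted_rcoactD.
rewrite /twisted_rcoact [a *: c]twisted_scaleE (proj2 (comul_l C)).
move: (comul _); apply: tensor_ext => [t u|t u|c1 c2].
- by rewrite scalerDr rD.
- by rewrite rD scalerDr.
- by rewrite tens_lact !rE tens_lact.
Qed.

Fact twisted_rcoact_r : rlinear twisted_rcoact.
Proof.
split=> [|c a]; first exact: twisted_rcoactD.
rewrite /twisted_rcoact [comul _](proj2 (comul_r C)).
move: (comul _); apply: tensor_ext => [t u|t u|c1 c2].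
- by rewrite ractDl rD.
- by rewrite rD ractDl.
- by rewrite tens_ract !rE tens_ract.
Qed.

Lemma tens_tliftl (M : rmodType A) (N : lmodType A) (P : rmodType A)
    (Q : lmodType A) (f : P -> Q -> M) t (n : N) :
  tens (tlift f t) n = tlift (fun p q => tens (f p q) n) t.
Proof.
by rewrite (tlift_comp (h := fun m => tens m n)) // => *; exact: tensDl.
Qed.

Lemma tens_tliftr (M : rmodType A) (N : lmodType A) (P : rmodType A)
    (Q : lmodType A) (f : P -> Q -> N) t (m : M) :
  tens m (tlift f t) = tlift (fun p q => tens m (f p q)) t.
Proof.
by rewrite (tlift_comp (h := tens m)) // => *; exact: tensDr.
Qed.

Fact twisted_lcoactA (c : T) :
  tassoc (tmap (@comul _ _ C) id (twisted_lcoact c))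
  = tmap id twisted_lcoact (twisted_lcoact c).
Proof.
have cr := comul_r C; have ll := twisted_lcoact_l.
have tD (t u : tensor C T) := tmapD (g := @id T) t u cr (@llinear_id _ T).
have tD' t u := tmapD (f := @id C) t u (@rlinear_id _ C) ll.
rewrite {1 3}/twisted_lcoact (tlift_comp _ _ tD) (tlift_comp _ _ tD').
rewrite (tlift_comp _ _ (@tassocD _ C C T)).
pose F (m n p : C) := tens (phi m) (tens (phi n) (p : T)).
transitivity (tlift (fun m n => tlift (fun m1 m2 => F m1 m2 n) (comul m))
                (comul c)).
  apply: eq_tlift => m n; rewrite tmapE // caut_comul /tmap tens_tliftl.
  rewrite (tlift_comp _ _ (@tassocD _ C C T)).
  by apply: eq_tlift => m1 m2; rewrite tassocE.
rewrite comulA_lift /F.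
- by apply: eq_tlift => m n; rewrite tmapE // tens_tliftr.
- by move=> *; rewrite cautD tensDl.
- by move=> *; rewrite cautD tensDl tensDr.
- by move=> *; rewrite !tensDr.
- by move=> *; rewrite cautZr tens_bal tens_lact cautZl.
- move=> m n b p; rewrite cautZr tens_bal; congr (tens _ (tens _ _)).
  by rewrite twisted_scaleE rhoK.
Qed.

Fact twisted_rcoactA (c : T) :
  tassoc (tmap twisted_rcoact id (twisted_rcoact c))
  = tmap id (@comul _ _ C) (twisted_rcoact c).
Proof.
have cl := comul_l C; have rr := twisted_rcoact_r.
have tD (t u : tensor T C) := tmapD (g := @id C) t u rr (@llinear_id _ C).
have tD' t u := tmapD (f := @id T) t u (@rlinear_id _ T) cl.
rewrite {2 3}/twisted_rcoact (tlift_comp _ _ tD) (tlift_comp _ _ tD').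
rewrite (tlift_comp _ _ (@tassocD _ T C C)).
pose F (m n p : C) := tens (m : T) (tens n p).
transitivity (tlift (fun m n => tlift (fun m1 m2 => F m1 m2 n) (comul m))
                (comul c)).
  apply: eq_tlift => m n; rewrite tmapE // /twisted_rcoact tens_tliftl.
  rewrite (tlift_comp _ _ (@tassocD _ T C C)).
  by apply: eq_tlift => m1 m2; rewrite tassocE.
rewrite comulA_lift /F.
- apply: eq_tlift => m n; rewrite tmapE //.
  by rewrite -[comul n in RHS]tlift_tens tens_tliftr.
- by move=> *; rewrite -tensDl.
- by move=> *; rewrite tensDl tensDr.
- by move=> *; rewrite !tensDr.
- by move=> *; rewrite -tens_lact -tens_bal.
- by move=> *; rewrite tens_bal.
Qed.

Fact twisted_bicoact (c : T) :
  tassoc (tmap twisted_lcoact id (twisted_rcoact c))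
  = tmap id twisted_rcoact (twisted_lcoact c).
Proof.
have lr := twisted_lcoact_r; have rl := twisted_rcoact_l.
have tD (t u : tensor T C) := tmapD (g := @id C) t u lr (@llinear_id _ C).
have tD' t u := tmapD (f := @id C) t u (@rlinear_id _ C) rl.
rewrite {1}/twisted_rcoact {2}/twisted_lcoact.
rewrite (tlift_comp _ _ tD) (tlift_comp _ _ tD').
rewrite (tlift_comp _ _ (@tassocD _ C T C)).
pose F (m n p : C) := tens (phi m) (tens (n : T) p).
transitivity (tlift (fun m n => tlift (fun m1 m2 => F m1 m2 n) (comul m))
                (comul c)).
  apply: eq_tlift => m n; rewrite tmapE // /twisted_lcoact tens_tliftl.
  rewrite (tlift_comp _ _ (@tassocD _ C T C)).
  by apply: eq_tlift => m1 m2; rewrite tassocE.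
rewrite comulA_lift /F.
- by apply: eq_tlift => m n; rewrite tmapE // tens_tliftr.
- by move=> *; rewrite cautD tensDl.
- by move=> *; rewrite -tensDr -tensDl.
- by move=> *; rewrite !tensDr.
- move=> m a n p; rewrite cautZr tens_bal tens_lact; congr (tens _ (tens _ _)).
  by rewrite twisted_scaleE rhoK.
- by move=> *; rewrite -tens_bal.
Qed.

Fact twisted_lcoact1 (c : T) :
  tlift (fun (d : C) (y : T) => counit d *: y) (twisted_lcoact c) = c.
Proof.
have bal : balanced (fun (d : C) (y : T) => counit d *: y).
  by split=> *; rewrite ?counitD ?scalerDl ?scalerDr // counitZr scalerA.
have bD t u := tliftD t u bal.
rewrite /twisted_lcoact (tlift_comp _ _ bD) -[RHS]comul1l.
apply: eq_tlift => c1 c2.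
by rewrite tliftE // caut_counit twisted_scaleE rhoK.
Qed.

Fact twisted_rcoact1 (c : T) :
  tlift (fun (y : T) (d : C) => y *r counit d) (twisted_rcoact c) = c.
Proof.
have bal : balanced (fun (y : T) (d : C) => y *r counit d).
  by split=> *; rewrite ?counitD ?ractDl ?ractDr // counitZl ractA.
have bD t u := tliftD t u bal.
rewrite /twisted_rcoact (tlift_comp _ _ bD) -[RHS]comul1r.
by apply: eq_tlift => c1 c2; rewrite tliftE.
Qed.

Definition twist : bicomodule C :=
  Bicomodule twisted_k twisted_lcoact_l twisted_lcoact_r
    twisted_rcoact_l twisted_rcoact_r twisted_lcoactA twisted_lcoact1
    twisted_rcoactA twisted_rcoact1 twisted_bicoact.

End Twist.

Section GradedAut.
Variables (k : comPzRingType) (G : groupType).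
Variables (X : gset G) (A : graded_algebra k G).
Local Notation C := (AkX_coring X A).

(* The equivalence in gra_mor says that both alpha and its inverse respect the
   gradings; compatibility of the inverse with the actions is automatic. *)
Record is_gr_aut (f : G -> G) (phi : X -> X) (alpha : A -> A) : Prop :=
  IsGrAut {
  gra_f_bij : bijective f;
  gra_fM : forall g h, f (g * h)%g = (f g * f h)%g;
  gra_phi_bij : bijective phi;
  gra_phiM : forall x g, phi (gact x g) = gact (phi x) (f g);
  gra_alpha : kalg_aut alpha;
  gra_mor : forall g a, gra_part g a <-> gra_part (f g) (alpha a)
}.

Record gr_aut := GrAut {
  gra_f : G -> G;
  gra_phi : X -> X;
  gra_al : A -> A;
  gr_autP : is_gr_aut gra_f gra_phi gra_al
}.

Lemma gr_aut_ext (s t : gr_aut) : (forall g, gra_f s g = gra_f t g) ->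
  (forall x, gra_phi s x = gra_phi t x) ->
  (forall a, gra_al s a = gra_al t a) -> s = t.
Proof.
case: s t => [f p a sP] [g q b tP] /= /funext fg /funext pq /funext ab.
case: _ / fg tP => tP; case: _ / pq tP => tP; case: _ / ab tP => tP.
by congr GrAut; exact: Prop_irrelevance.
Qed.

Fact gr_aut_id_proof : is_gr_aut id id id.
Proof. by split=> //; [exists id | exists id | exact: kaut_id]. Qed.

Fact gr_aut_comp_proof (s t : gr_aut) :
  is_gr_aut (gra_f s \o gra_f t) (gra_phi s \o gra_phi t)
            (gra_al s \o gra_al t).
Proof.
case: s t => [f p a [f1 f2 p1 p2 a1 a2]] [g q b [g1 g2 q1 q2 b1 b2]] /=.
split=> /=.
- exact: bij_comp.
- by move=> *; rewrite g2 f2.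
- exact: bij_comp.
- by move=> *; rewrite q2 p2.
- exact: kaut_comp.
- by move=> h c; rewrite b2 a2.
Qed.

Fact gr_aut_inv_proof (s : gr_aut) :
  is_gr_aut (binv (gra_f_bij (gr_autP s))) (binv (gra_phi_bij (gr_autP s)))
            (binv (kaut_bij (gra_alpha (gr_autP s)))).
Proof.
have sP := gr_autP s.
have [fK Kf] := binvK (gra_f_bij (gr_autP s)).
have [pK Kp] := binvK (gra_phi_bij (gr_autP s)).
have [aK Ka] := binvK (kaut_bij (gra_alpha (gr_autP s))).
split.
- exact: bijective_binv.
- by move=> g h; apply: (can_inj fK); rewrite (gra_fM sP) !Kf.
- exact: bijective_binv.
- by move=> x g; apply: (can_inj pK); rewrite (gra_phiM sP) !Kp Kf.
- exact: kaut_inv.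
- by move=> g c; rewrite [X in _ <-> X](gra_mor sP) Kf Ka.
Qed.

Definition gr_aut_id : gr_aut := GrAut gr_aut_id_proof.
Definition gr_aut_comp (s t : gr_aut) : gr_aut := GrAut (gr_aut_comp_proof s t).
Definition gr_aut_inv (s : gr_aut) : gr_aut := GrAut (gr_aut_inv_proof s).

Fact gr_aut_compA : associative gr_aut_comp.
Proof. by move=> s t u; apply: gr_aut_ext. Qed.
Fact gr_aut_comp1s : left_id gr_aut_id gr_aut_comp.
Proof. by move=> s; apply: gr_aut_ext. Qed.
Fact gr_aut_comps1 : right_id gr_aut_id gr_aut_comp.
Proof. by move=> s; apply: gr_aut_ext. Qed.
Fact gr_aut_compVs : left_inverse gr_aut_id gr_aut_inv gr_aut_comp.
Proof. by move=> s; apply: gr_aut_ext => y /=; rewrite (proj1 (binvK _)). Qed.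
Fact gr_aut_compsV : right_inverse gr_aut_id gr_aut_inv gr_aut_comp.
Proof. by move=> s; apply: gr_aut_ext => y /=; rewrite (proj2 (binvK _)). Qed.

Definition gr_aut_group : lgroup :=
  LGroup gr_aut_compA gr_aut_comp1s gr_aut_comps1 gr_aut_compVs gr_aut_compsV.

Lemma comul_single x (a : A) : @comul _ _ C (AkX_single x a)
  = tens (AkX_single x a : C) (AkX_single x 1 : C).
Proof. exact: AkX_comul_single. Qed.

Lemma counit_single x (a : A) : @counit _ _ C (AkX_single x a) = a.
Proof. exact: AkX_counit_single. Qed.

Section Induced.
Variable s : gr_aut.
Local Notation f := (gra_f s).
Local Notation phi := (gra_phi s).
Local Notation alpha := (gra_al s).

Let sP := gr_autP s.
Let aP := gra_alpha (gr_autP s).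

(* alpha (x) gamma, with gamma the k-linear extension of phi *)
Definition AkX_map : C -> C :=
  fm_lift (fun x a => AkX_single (phi x) (alpha a)).

Fact AkX_mapD c d : AkX_map (c + d) = AkX_map c + AkX_map d.
Proof. by apply: fm_liftD => *; rewrite (kautD aP) AkX_singleD. Qed.

Lemma AkX_map_single x a :
  AkX_map (AkX_single x a) = AkX_single (phi x) (alpha a).
Proof.
by apply: (fm_lift_single (V := C)) => *; rewrite (kautD aP) AkX_singleD.
Qed.

Fact AkX_mapZl a c : AkX_map (a *: c) = alpha a *: AkX_map c.
Proof.
move: c; apply: AkX_ext => [c d|c d|x b];
  rewrite ?scalerDr ?AkX_mapD ?scalerDr //.
by rewrite AkX_single_scale !AkX_map_single AkX_single_scale (kautM aP).
Qed.

Fact AkX_mapZr c a : AkX_map (c *r a) = AkX_map c *r alpha a.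
Proof.
move: c; apply: AkX_ext => [c d|c d|x b]; rewrite ?ractDl ?AkX_mapD ?ractDl //.
move: a; apply: gra_ext => [u v|u v|g a ag].
- by rewrite ractDr AkX_mapD.
- by rewrite (kautD aP) ractDr.
rewrite (AkX_single_ract _ _ ag) !AkX_map_single.
by rewrite (AkX_single_ract _ _ (proj1 (gra_mor sP _ _) ag)) (gra_phiM sP)
  (kautM aP).
Qed.

Fact AkX_map_comul c : comul (AkX_map c) = tmap AkX_map AkX_map (comul c).
Proof.
have bal : balanced (fun c d : C => tens (AkX_map c) (AkX_map d)).
  split=> *; rewrite ?AkX_mapD ?tensDl ?tensDr //.
  by rewrite AkX_mapZr AkX_mapZl tens_bal.
have [cD _] := comul_l C.
move: c; apply: AkX_ext => [c d|c d|x a].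
- by rewrite AkX_mapD cD.
- by rewrite cD /tmap (tliftD _ _ bal).
by rewrite AkX_map_single !comul_single /tmap (tliftE _ _ bal)
  !AkX_map_single (kaut1 aP).
Qed.

Fact AkX_map_counit c : counit (AkX_map c) = alpha (counit c).
Proof.
move: c; apply: AkX_ext => [c d|c d|x a].
- by rewrite AkX_mapD counitD.
- by rewrite counitD (kautD aP).
by rewrite AkX_map_single !counit_single.
Qed.

End Induced.

Fact AkX_map_bij s : bijective (AkX_map s).
Proof.
have aP := gra_alpha (gr_autP s).
exists (AkX_map (gr_aut_inv s)).
- apply: (AkX_ext (v := id)) => [c d|//|x a]; first by rewrite !AkX_mapD.
  by rewrite !AkX_map_single /= !(proj1 (binvK _)).
- apply: (AkX_ext (v := id)) => [c d|//|x a]; first by rewrite !AkX_mapD.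
  by rewrite !AkX_map_single /= !(proj2 (binvK _)).
Qed.

Definition AkX_aut (s : gr_aut) : coring_aut C :=
  CoringAut (gra_alpha (gr_autP s)) (AkX_map_bij s) (AkX_mapD s) (AkX_mapZl s)
    (AkX_mapZr s) (AkX_map_comul s) (AkX_map_counit s).

Definition in_kernel (s : gr_aut) : Prop :=
  exists p : C -> A, [/\ in_dual p, dual_unit p,
    forall x a, p (AkX_single x a) = gra_al s a * p (AkX_single x 1)
    & forall x h, gact (gra_phi s x) h <> x ->
        gra_comp (p (AkX_single x 1)) h = 0].

End GradedAut.

(* Main.v *)
Require Import Defs.
From mathcomp Require Import all_boot all_order all_algebra.
From HB Require Import structures.
From mathcomp Require Import boolp classical_sets cardinality.
(* Imported again because mathcomp's vector library shadows [hom]. *)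
Require Import Defs.

(* C = A (x) kX is coseparable: gamma((1 (x) x) (x) (1 (x) y)) = [x = y]
   defines a cointegral. For such a coring every element m of a comodule M
   determines a comodule map f_m : C -> M, c |-> sum m_0 gamma(m_1, c); these
   maps generate M, and C acts on the left of every bicomodule Y by
   c . y = sum gamma(c, y_(-1)) y_0. If T is a self-equivalence of the category
   of comodules, the maps T(f_m) generate T M, and m (x) y |-> T(f_m)(y) splits
   a map T M -> M (x)_A T C that identifies T M with the cotensor product
   M [] T C. Hence T |-> T C inverts Y |-> - [] Y, and Pic(C) can be taken to be
   the group of self-equivalences of comodules, which in turn are those of
   graded modules.

   - [] twist(phi, rho) is the functor restricting the action of A along rho
     and the coaction along phi^-1; this is visibly functorial in (phi, rho),
     which makes Theta a homomorphism. Its kernel consists of the t with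
     twist(t) isomorphic to C as a bicomodule; right colinear bijections
     theta of C correspond to units p = epsilon o theta of the dual algebra,
     and left linearity and left colinearity of theta become conditions 1)
     and 2) on p. *)

Set Implicit Arguments.
Unset Strict Implicit.
Unset Printing Implicit Defensive.

Import GRing.Theory.
Local Open Scope ring_scope.

(** * Maps out of tensor products *)

Section TensorCalculus.
Variable A : pzRingType.

(** The group laws for cotensor products of bicomodules are awkward to check directly, on kernels
    inside tensor products that need not be exact. Functors carry the group structure instead. The
    bridge is [represents]: Y is matched with T C as a right comodule, and its left structure with
    the images under T of endomorphisms of C, namely the multiplications by elements of A and the
    orbit maps. A functor does not see a left coaction, but coseparability replaces it by an action
    of the elements of C through right comodule endomorphisms, and on those a functor does act. In
    place of preservation of colimits, the comparison of T with a cotensor functor uses fullness,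
    faithfulness, essential surjectivity and additivity of T. The cointegral comes from two bases: C
    is free on the elements 1 (x) x on the left by construction, and on the right because
    homogeneous elements of A permute these basis elements along orbits; gamma pairs left
    coordinates with right ones. *)

Lemma tlift_tmap (M M' : rmodType A) (N N' : lmodType A) (V : zmodType)
    (f : M' -> N' -> V) (g : M -> M') (h : N -> N') (t : tensor M N) :
  balanced f -> tlift f (tmap g h t) = tlift (fun m n => f (g m) (h n)) t.
Proof.
move=> fb; have fD s u := tliftD s u fb.
by rewrite /tmap (tlift_comp _ _ fD); apply: eq_tlift => m n; rewrite tliftE.
Qed.

Lemma tlift_ract (M : rmodType A) (N : bimodType A) (V : zmodType)
    (f : M -> N -> V) (t : tensor M N) a : balanced f ->
  tlift f (t *r a) = tlift (fun m n => f m (n *r a)) t.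
Proof.
move=> fb; have fD s u := tliftD s u fb.
rewrite -[t *r a]/(tensor_ract t a) /tensor_ract (tlift_comp _ _ fD).
by apply: eq_tlift => m n; rewrite tliftE.
Qed.

Lemma tlift_lact (M : bimodType A) (N : lmodType A) (V : zmodType)
    (f : M -> N -> V) (t : tensor M N) a : balanced f ->
  tlift f (a *: t) = tlift (fun m n => f (a *: m) n) t.
Proof.
move=> fb; have fD s u := tliftD s u fb.
rewrite -[a *: t]/(tensor_lact a t) /tensor_lact (tlift_comp _ _ fD).
by apply: eq_tlift => m n; rewrite tliftE.
Qed.

Lemma tlift_add (M : rmodType A) (N : lmodType A) (V : zmodType)
    (f g : M -> N -> V) (t : tensor M N) :
  tlift (fun m n => f m n + g m n) t = tlift f t + tlift g t.
Proof. exact: big_split. Qed.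

Lemma tliftr (M : rmodType A) (N : bimodType A) (V : rmodType A)
    (f : M -> N -> V) : balanced f -> (forall m n a, f m (n *r a) = f m n *r a) ->
  rlinear (tlift f).
Proof.
move=> fb fr; split=> [s t|t a]; first exact: tliftD.
rewrite tlift_ract // [RHS](tlift_comp (h := fun v => v *r a)).
  by apply: eq_tlift.
by move=> u v; rewrite ractDl.
Qed.

Lemma tliftl (M : bimodType A) (N : lmodType A) (V : lmodType A)
    (f : M -> N -> V) : balanced f -> (forall a m n, f (a *: m) n = a *: f m n) ->
  llinear (tlift f).
Proof.
move=> fb fl; split=> [s t|a t]; first exact: tliftD.
rewrite tlift_lact // [RHS](tlift_comp (h := fun v => a *: v)).
  by apply: eq_tlift.
by move=> u v; rewrite scalerDr.
Qed.

Lemma tmap_comp (M M' M'' : rmodType A) (N N' N'' : lmodType A)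
    (f : M -> M') (g : N -> N') (f' : M' -> M'') (g' : N' -> N'') t :
  rlinear f' -> llinear g' ->
  tmap f' g' (tmap f g t) = tmap (fun m => f' (f m)) (fun n => g' (g n)) t.
Proof. by move=> fl gl; rewrite [LHS]tlift_tmap //; exact: tmap_bal. Qed.

Lemma eq_tmap (M M' : rmodType A) (N N' : lmodType A)
    (f f' : M -> M') (g g' : N -> N') (t : tensor M N) :
  f =1 f' -> g =1 g' -> tmap f g t = tmap f' g' t.
Proof. by move=> ff gg; apply: eq_tlift => m n; rewrite ff gg. Qed.

Lemma tmap_id (M : rmodType A) (N : lmodType A) (t : tensor M N) :
  tmap id id t = t.
Proof. exact: tlift_tens. Qed.

Lemma tmap_r (M M' : rmodType A) (N N' : bimodType A) (f : M -> M')
    (g : N -> N') :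
  rlinear f -> llinear g -> (forall n a, g (n *r a) = g n *r a) ->
  rlinear (tmap f g).
Proof.
move=> fl gl gr; apply: tliftr; first exact: tmap_bal.
by move=> m n a; rewrite gr tens_ract.
Qed.

Lemma tmap_l (M M' : bimodType A) (N N' : lmodType A) (f : M -> M')
    (g : N -> N') :
  rlinear f -> llinear g -> (forall a m, f (a *: m) = a *: f m) ->
  llinear (tmap f g).
Proof.
move=> fl gl fZ; apply: tliftl; first exact: tmap_bal.
by move=> a m n; rewrite fZ tens_lact.
Qed.

Lemma rlinear_comp (M N P : rmodType A) (g : N -> P) (f : M -> N) :
  rlinear g -> rlinear f -> rlinear (fun m => g (f m)).
Proof. by case=> gD gZ [fD fZ]; split=> *; rewrite ?fD ?fZ ?gD ?gZ. Qed.

Lemma can_rlinear (M N : rmodType A) (f : M -> N) (g : N -> M) :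
  cancel f g -> cancel g f -> rlinear f -> rlinear g.
Proof.
move=> fK gK [fD fZ]; split=> [m n|m a]; apply: (can_inj fK).
- by rewrite fD !gK.
- by rewrite fZ !gK.
Qed.

Lemma can_llinear (M N : lmodType A) (f : M -> N) (g : N -> M) :
  cancel f g -> cancel g f -> llinear f -> llinear g.
Proof.
move=> fK gK [fD fZ]; split=> [m n|m a]; apply: (can_inj fK).
- by rewrite fD !gK.
- by rewrite fZ !gK.
Qed.

Section Trilinear.
Variables (M : rmodType A) (N : bimodType A) (P : lmodType A) (V : zmodType).

(** These are the maps that descend to both bracketings of a triple tensor product. *)
Definition trilinear (F : M -> N -> P -> V) : Prop :=
  (forall p, balanced (fun m n => F m n p)) /\ (forall m, balanced (F m)).

Lemma trilinear_tlift (F : M -> N -> P -> V) : trilinear F ->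
  balanced (fun m (t : tensor N P) => tlift (F m) t).
Proof.
case=> F1 F2; split=> [m m' t|m t u|m a t].
- rewrite -tlift_add; apply: eq_tlift => n p; by have [-> _ _] := F1 p.
- exact: tliftD.
- by rewrite tlift_lact //; apply: eq_tlift => n p; have [_ _ ->] := F1 p.
Qed.

Lemma tlift_assoc (F : M -> N -> P -> V) (t : tensor (tensor M N) P) :
  trilinear F ->
  tlift (fun s p => tlift (fun m n => F m n p) s) t
  = tlift (fun m s => tlift (F m) s) (tassoc t).
Proof.
move=> FT; have bo := trilinear_tlift FT; have oD s u := tliftD s u bo.
rewrite /tassoc (tlift_comp _ _ oD); apply: eq_tlift => s p.
rewrite (tlift_comp _ _ oD); apply: eq_tlift => m n.
by rewrite tliftE // tliftE //; case: FT.
Qed.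

Lemma tassoc_tmap (M' : rmodType A) (f : M' -> tensor M N) (t : tensor M' P) :
  tassoc (tmap f id t)
  = tlift (fun m p => tlift (fun m n => tens m (tens n p)) (f m)) t.
Proof.
rewrite (tlift_comp _ _ (@tassocD _ M N P)); apply: eq_tlift => m p.
exact/tliftE/tassoc_bal.
Qed.

(* Applying a map F out of M (x) (N (x) P) to both sides of a coassociativity
   law. *)
Lemma tlift_coassoc (M' : rmodType A) (N' : lmodType A)
    (f : M' -> tensor M N) (g : N' -> tensor N P)
    (t : tensor M' P) (u : tensor M N') (F : M -> N -> P -> V) :
  trilinear F -> tassoc (tmap f id t) = tmap id g u ->
  tlift (fun m' p => tlift (fun m n => F m n p) (f m')) t
  = tlift (fun m n' => tlift (F m) (g n')) u.
Proof.
move=> FT e; have bo := trilinear_tlift FT; have oD s v := tliftD s v bo.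
have := congr1 (tlift (fun m s => tlift (F m) s)) e.
rewrite tlift_tmap // => <-; rewrite tassoc_tmap (tlift_comp _ _ oD).
apply: eq_tlift => m' p; rewrite (tlift_comp _ _ oD); apply: eq_tlift => m n.
by rewrite tliftE // tliftE //; case: FT.
Qed.

End Trilinear.

Section AssocIso.
Variables (M : rmodType A) (N : bimodType A) (P : lmodType A).

(** Besides making the associator injective, the inverse serves as data: the right coaction on M (x)
    Y is defined through it. *)
Definition tassoc_inv : tensor M (tensor N P) -> tensor (tensor M N) P :=
  tlift (fun m s => tlift (fun n p => tens (tens m n) p) s).

Lemma trilinear_tens : trilinear (fun (m : M) (n : N) (p : P) =>
  tens (tens m n) p).
Proof.
split=> [p|m]; split=> *.
- by rewrite tensDl tensDl.
- by rewrite tensDr tensDl.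
- by rewrite tens_bal.
- by rewrite tensDr tensDl.
- by rewrite tensDr.
- by rewrite -tens_ract tens_bal.
Qed.

Lemma tassocK : cancel (@tassoc A M N P) tassoc_inv.
Proof.
move=> t; rewrite /tassoc_inv -tlift_assoc; last exact: trilinear_tens.
rewrite -[RHS]tlift_tens; apply: eq_tlift => s p.
rewrite -[in RHS](tlift_tens s) (tlift_comp (h := fun s => tens s p)) //.
by move=> u v; rewrite tensDl.
Qed.

End AssocIso.

Lemma tassoc_tmap3 (M M' : rmodType A) (N N' : bimodType A) (P P' : lmodType A)
    (f : M -> M') (g : N -> N') (h : P -> P') t :
  rlinear f -> llinear g -> rlinear g -> llinear h ->
  tassoc (tmap (tmap f g) h t) = tmap f (tmap g h) (tassoc t).
Proof.
move=> fl gl gr hl; have tl : llinear (tmap g h).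
  by apply: tmap_l => //; case: gl.
have tr : rlinear (tmap f g) by apply: tmap_r => //; case: gr.
have D s u := tmapD s u tr hl; have D' s u := tmapD s u fl tl.
move: t; apply: tensor_ext => [s u|s u|s p].
- by rewrite D tassocD.
- by rewrite tassocD D'.
rewrite tmapE //; move: s; apply: tensor_ext => [s u|s u|m n].
- by rewrite tmapD // tensDl tassocD.
- by rewrite tensDl tassocD D'.
- by rewrite tmapE // !tassocE !tmapE.
Qed.

End TensorCalculus.

(** * The Picard group of a category *)

Section CategoryTheory.
Variable k : comPzRingType.
Implicit Types C D E : kcategory k.

Lemma is_iso_id C (a : ob C) : is_iso (idm a).
Proof. by exists (idm a); rewrite cmp1l. Qed.

Lemma is_iso_cmp C (a b c : ob C) (g : hom b c) (f : hom a b) :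
  is_iso g -> is_iso f -> is_iso (cmp g f).
Proof.
case=> g' [g'g gg'] [f' [f'f ff']]; exists (cmp f' g'); split.
- by rewrite -cmpA (cmpA g') g'g cmp1l f'f.
- by rewrite -cmpA (cmpA f) ff' cmp1l gg'.
Qed.

Lemma is_iso_fmor C D (F : kfunctor C D) (a b : ob C) (f : hom a b) :
  is_iso f -> is_iso (fmor F f).
Proof.
by case=> f' [f'f ff']; exists (fmor F f'); rewrite -!fmorM f'f ff' !fmor1.
Qed.

Section NatIso.
Variables C D E : kcategory k.

Lemma nat_iso_refl (F : kfunctor C D) : nat_iso F F.
Proof.
exists (fun a => idm (F a)); split=> [a|a b f]; first exact: is_iso_id.
by rewrite cmp1l cmp1r.
Qed.

Lemma nat_iso_sym (F G : kfunctor C D) : nat_iso F G -> nat_iso G F.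
Proof.
case=> eta [iso nat]; exists (fun a => projT1 (cid (iso a))); split.
  by move=> a; case: cid => g /= [ge eg]; exists (eta a).
move=> a b f; case: cid => gb /= [gbe _]; case: cid => ga /= [_ ega].
by rewrite -[RHS]cmp1l -gbe -cmpA (cmpA (eta b)) nat -!cmpA ega cmp1r.
Qed.

Lemma nat_iso_trans (F G H : kfunctor C D) :
  nat_iso F G -> nat_iso G H -> nat_iso F H.
Proof.
case=> eta [iso nat] [eta' [iso' nat']].
exists (fun a => cmp (eta' a) (eta a)); split=> [a|a b f].
  exact: is_iso_cmp.
by rewrite -cmpA nat cmpA nat' cmpA.
Qed.

Lemma nat_iso_compl (G : kfunctor D E) (F F' : kfunctor C D) :
  nat_iso F F' -> nat_iso (fun_comp G F) (fun_comp G F').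
Proof.
case=> eta [iso nat]; exists (fun a => fmor G (eta a)); split=> [a|a b f].
  exact: (is_iso_fmor G (iso a)).
by rewrite /= -!fmorM nat.
Qed.

Lemma nat_iso_compr (G G' : kfunctor D E) (F : kfunctor C D) :
  nat_iso G G' -> nat_iso (fun_comp G F) (fun_comp G' F).
Proof.
case=> eta [iso nat]; exists (fun a => eta (F a)); split=> [a|a b f].
  exact: iso.
exact: nat.
Qed.

Lemma nat_iso_comp1 (F : kfunctor C D) : nat_iso (fun_comp F (fun_id C)) F.
Proof.
exists (fun a => idm (F a)); split=> [a|a b f]; first exact: is_iso_id.
by rewrite cmp1l cmp1r.
Qed.

Lemma nat_iso_1comp (F : kfunctor C D) : nat_iso (fun_comp (fun_id D) F) F.
Proof.
exists (fun a => idm (F a)); split=> [a|a b f]; first exact: is_iso_id.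
by rewrite cmp1l cmp1r.
Qed.

End NatIso.

Lemma nat_iso_compA C D E B (H : kfunctor E B) (G : kfunctor D E)
    (F : kfunctor C D) :
  nat_iso (fun_comp H (fun_comp G F)) (fun_comp (fun_comp H G) F).
Proof.
exists (fun a => idm (H (G (F a)))); split=> [a|a b f]; first exact: is_iso_id.
by rewrite cmp1l cmp1r.
Qed.

(** Each side is recovered from its composite with F by applying G. *)
Lemma nat_iso_cancel C D (F : kfunctor C D) (G : kfunctor D C) (H H' : kfunctor C C) :
  nat_iso (fun_comp G F) (fun_id C) ->
  nat_iso (fun_comp F H) (fun_comp F H') -> nat_iso H H'.
Proof.
move=> GF FH.
have to (K : kfunctor C C) : nat_iso K (fun_comp G (fun_comp F K)).
  apply: nat_iso_trans (nat_iso_sym (nat_iso_compA _ _ _)).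
  apply: nat_iso_trans (nat_iso_sym (nat_iso_1comp _)) _.
  exact/nat_iso_compr/nat_iso_sym.
apply: nat_iso_trans (to H) _; apply: nat_iso_trans (nat_iso_sym (to H')).
exact: nat_iso_compl.
Qed.

Lemma equivalence_id C : is_equivalence (fun_id C).
Proof. by exists (fun_id C); split; exact: nat_iso_comp1. Qed.

Lemma nat_iso_inv_comp C D E (F : kfunctor C D) (F' : kfunctor D C)
    (G : kfunctor D E) (G' : kfunctor E D) :
  nat_iso (fun_comp F' F) (fun_id C) -> nat_iso (fun_comp G' G) (fun_id D) ->
  nat_iso (fun_comp (fun_comp F' G') (fun_comp G F)) (fun_id C).
Proof.
move=> FF GG; apply: nat_iso_trans (nat_iso_compA _ _ _) _.
apply: nat_iso_trans FF; apply: nat_iso_compr.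
apply: nat_iso_trans (nat_iso_sym (nat_iso_compA _ _ _)) _.
by apply: nat_iso_trans (nat_iso_comp1 _); exact: nat_iso_compl.
Qed.

Lemma equivalence_comp C D E (G : kfunctor D E) (F : kfunctor C D) :
  is_equivalence G -> is_equivalence F -> is_equivalence (fun_comp G F).
Proof.
case=> G' [G'G GG'] [F' [F'F FF']]; exists (fun_comp F' G').
by split; apply: nat_iso_inv_comp.
Qed.

Lemma equivalence_faithful C D (F : kfunctor C D) (a b : ob C) (f g : hom a b) :
  is_equivalence F -> fmor F f = fmor F g -> f = g.
Proof.
case=> G [[eta [iso nat]] _] Ffg; have [e [_ ee]] := iso a.
rewrite -[f]cmp1r -[g]cmp1r -ee !cmpA; congr cmp.
by rewrite -[LHS](nat _ _ f) -[RHS](nat _ _ g) /= Ffg.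
Qed.

(** The preimage is the conjugate of [fmor G g] by the isomorphism from GF to the identity. Its
    image under F agrees with g because the images of both under G do, and G is itself faithful. *)
Lemma equivalence_full C D (F : kfunctor C D) (a b : ob C) (g : hom (F a) (F b)) :
  is_equivalence F -> exists f, fmor F f = g.
Proof.
move=> FE; have [G [GF FG]] := FE.
have GE : is_equivalence G by exists F.
have [eta [iso nat]] := GF; have [e [ee ee']] := iso a.
have [d [dd dd']] := iso b.
exists (cmp (eta b) (cmp (fmor G g) e)); apply: (equivalence_faithful GE).
set f := cmp _ _; have nf : cmp (eta b) (fmor G (fmor F f)) = cmp f (eta a).
  exact: nat.
have inj (u v : hom (G (F a)) (G (F b))) :
    cmp (eta b) u = cmp (eta b) v -> u = v.
  by move=> /(congr1 (cmp d)); rewrite !cmpA dd !cmp1l.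
by apply: inj; rewrite nf /f -!cmpA ee cmp1r.
Qed.

Lemma equivalence_surj C D (F : kfunctor C D) (b : ob D) :
  is_equivalence F -> exists a (e : hom (F a) b), is_iso e.
Proof. by case=> G [_ [eta [iso _]]]; exists (G b), (eta b); exact: iso. Qed.

(** * Classes of self-equivalences as a group *)

Section Picard.
Variable D : kcategory k.
Implicit Types S T U : autoequivalence D.

Definition autoeq_class T : autoequivalence D -> Prop := fun S => nat_iso T S.

(** A class is the predicate of its members, so that extensionality turns natural isomorphism into
    equality; representatives are picked by choice. *)
Definition autoeq_classes : Type :=
  {P : autoequivalence D -> Prop | exists T, P = autoeq_class T}.

Lemma autoeq_classesP (P Q : autoeq_classes) :
  proj1_sig P = proj1_sig Q -> P = Q.
Proof.
case: P Q => P p [Q q] /= e; move: p q; rewrite e => p q.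
by congr exist; exact: Prop_irrelevance.
Qed.

Definition to_class T : autoeq_classes :=
  exist _ (autoeq_class T) (ex_intro _ T erefl).

Definition class_repr (P : autoeq_classes) : autoequivalence D :=
  projT1 (cid (proj2_sig P)).

Lemma class_reprK P : to_class (class_repr P) = P.
Proof.
by apply: autoeq_classesP; rewrite /class_repr; case: cid => T /= ->.
Qed.

Lemma to_classP S T : to_class S = to_class T <-> nat_iso S T.
Proof.
split=> [/(congr1 (@proj1_sig _ _)) /= e|ST].
  have : autoeq_class T T by exact: nat_iso_refl.
  by rewrite -e.
apply: autoeq_classesP; apply/funext => U; apply/propext; split=> [|TU].
- exact/nat_iso_trans/nat_iso_sym.
- exact: nat_iso_trans TU.
Qed.

Lemma class_reprP T : nat_iso (class_repr (to_class T)) T.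
Proof. by apply/to_classP; rewrite class_reprK. Qed.

Definition autoeq_comp S T : autoequivalence D :=
  Autoequivalence (equivalence_comp (aeqP S) (aeqP T)).

Definition autoeq_id : autoequivalence D :=
  Autoequivalence (equivalence_id D).

Lemma equivalence_inv T : exists S, nat_iso (fun_comp S T) (fun_id D) /\
  nat_iso (fun_comp T S) (fun_id D).
Proof.
have [S [ST TS]] := aeqP T.
have SE : is_equivalence S by exists T.
by exists (Autoequivalence SE).
Qed.

Definition autoeq_inv T : autoequivalence D := projT1 (cid (equivalence_inv T)).

Lemma autoeq_invP T : nat_iso (fun_comp (autoeq_inv T) T) (fun_id D) /\
  nat_iso (fun_comp T (autoeq_inv T)) (fun_id D).
Proof. exact: projT2 (cid (equivalence_inv T)). Qed.

(** The factors are swapped to follow (T)(S) = (ST). *)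
Definition class_mul (P Q : autoeq_classes) : autoeq_classes :=
  to_class (autoeq_comp (class_repr Q) (class_repr P)).

Definition class_inv (P : autoeq_classes) : autoeq_classes :=
  to_class (autoeq_inv (class_repr P)).

Lemma class_mulE S T :
  class_mul (to_class S) (to_class T) = to_class (autoeq_comp T S).
Proof.
apply/to_classP.
apply: nat_iso_trans (nat_iso_compl _ (class_reprP S)) _.
exact: nat_iso_compr (class_reprP T).
Qed.

Fact class_mulA : associative class_mul.
Proof.
move=> P Q R; rewrite -(class_reprK P) -(class_reprK Q) -(class_reprK R).
rewrite !class_mulE; apply/to_classP.
exact: nat_iso_sym (nat_iso_compA _ _ _).
Qed.

Fact class_mul1 : left_id (to_class autoeq_id) class_mul.
Proof.
move=> P; rewrite -(class_reprK P) class_mulE; apply/to_classP.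
exact: nat_iso_comp1.
Qed.

Fact class_mulr1 : right_id (to_class autoeq_id) class_mul.
Proof.
move=> P; rewrite -(class_reprK P) class_mulE; apply/to_classP.
exact: nat_iso_1comp.
Qed.

Fact class_mulV : left_inverse (to_class autoeq_id) class_inv class_mul.
Proof.
move=> P; rewrite -[in X in class_mul _ X](class_reprK P) class_mulE.
by apply/to_classP; case: (autoeq_invP (class_repr P)).
Qed.

Fact class_mulrV : right_inverse (to_class autoeq_id) class_inv class_mul.
Proof.
move=> P; rewrite -[in X in class_mul X _](class_reprK P) class_mulE.
by apply/to_classP; case: (autoeq_invP (class_repr P)).
Qed.

Definition picard_lgroup : lgroup :=
  LGroup class_mulA class_mul1 class_mulr1 class_mulV class_mulrV.

Fact picard_surj (P : picard_lgroup) : exists T, to_class T = P.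
Proof. by exists (class_repr P); exact: class_reprK. Qed.

Fact picard_mul S T U :
  @lg_mul picard_lgroup (to_class T) (to_class S) = to_class U <->
  nat_iso U (fun_comp S T).
Proof.
rewrite [@lg_mul _ _ _]class_mulE to_classP.
by split=> /nat_iso_sym.
Qed.

Definition picard_category : Pic_category D :=
  @PicCategory _ D picard_lgroup to_class picard_surj to_classP picard_mul.

End Picard.

(** * Picard groups of equivalent categories *)

Section PicardTransport.
Variables (C D : kcategory k) (L : kfunctor D C) (R : kfunctor C D).
Hypotheses (RL : nat_iso (fun_comp R L) (fun_id D))
           (LR : nat_iso (fun_comp L R) (fun_id C)).
Variable PC : Pic_category C.

Lemma equivalence_conj (T : kfunctor D D) : is_equivalence T ->
  is_equivalence (fun_comp L (fun_comp T R)).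
Proof.
move=> TE; apply: equivalence_comp; first by exists R.
by apply: equivalence_comp => //; exists L.
Qed.

Definition autoeq_conj (T : autoequivalence D) : autoequivalence C :=
  Autoequivalence (equivalence_conj (aeqP T)).

(** The group [PC] is kept and only the class map changes, so the two Picard groups will be compared
    by the identity. *)
Definition transport_class (T : autoequivalence D) : PC :=
  picc_class PC (autoeq_conj T).

(** The form without R is the one that describes the isomorphism of Picard groups in the theorem. *)
Lemma conj_nat_iso (F : kfunctor C C) (T : kfunctor D D) :
  nat_iso F (fun_comp L (fun_comp T R)) <->
  nat_iso (fun_comp L T) (fun_comp F L).
Proof.
split=> [FT|TF].
- apply: nat_iso_sym; apply: nat_iso_trans (nat_iso_compr _ FT) _.
  apply: nat_iso_trans (nat_iso_sym (nat_iso_compA _ _ _)) _.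
  apply: nat_iso_compl.
  apply: nat_iso_trans (nat_iso_sym (nat_iso_compA _ _ _)) _.
  apply: nat_iso_trans (nat_iso_comp1 _); exact: nat_iso_compl.
- apply: nat_iso_sym; apply: nat_iso_trans (nat_iso_compA _ _ _) _.
  apply: nat_iso_trans (nat_iso_compr _ TF) _.
  apply: nat_iso_trans (nat_iso_sym (nat_iso_compA _ _ _)) _.
  apply: nat_iso_trans (nat_iso_comp1 _); exact: nat_iso_compl.
Qed.

Lemma conj_inj (S T : kfunctor D D) :
  nat_iso (fun_comp L (fun_comp S R)) (fun_comp L (fun_comp T R)) ->
  nat_iso S T.
Proof.
move/conj_nat_iso => e; apply: (nat_iso_cancel RL).
apply: nat_iso_sym; apply: nat_iso_trans e _; apply/nat_iso_sym/conj_nat_iso.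
exact: nat_iso_refl.
Qed.

Fact transport_surj (p : PC) : exists T, transport_class T = p.
Proof.
have [F <-] := picc_surj p.
have TE : is_equivalence (fun_comp R (fun_comp F L)).
  apply: equivalence_comp; first by exists L.
  apply: equivalence_comp; [exact: aeqP | by exists R].
exists (Autoequivalence TE); apply/picc_eq/nat_iso_sym/conj_nat_iso => /=.
apply: nat_iso_trans (nat_iso_compA _ _ _) _.
by apply: nat_iso_trans (nat_iso_1comp _); apply: nat_iso_compr.
Qed.

Fact transport_eq S T : transport_class S = transport_class T <-> nat_iso S T.
Proof.
split=> [/picc_eq|ST]; first exact: conj_inj.
by apply/picc_eq; apply: nat_iso_compl; exact: nat_iso_compr.
Qed.

Fact transport_mul (S T U : autoequivalence D) :
  lg_mul (transport_class T) (transport_class S) = transport_class U <->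
  nat_iso U (fun_comp S T).
Proof.
have e : nat_iso (fun_comp (autoeq_conj S) (autoeq_conj T))
                 (fun_comp L (fun_comp (fun_comp S T) R)).
  apply: nat_iso_trans (nat_iso_sym (nat_iso_compA _ _ _)) _.
  apply: nat_iso_compl.
  apply: nat_iso_trans (nat_iso_sym (nat_iso_compA _ _ _)) _.
  apply: nat_iso_trans (nat_iso_compA _ _ _).
  apply: nat_iso_compl.
  apply: nat_iso_trans (nat_iso_compA _ _ _) _.
  by apply: nat_iso_trans (nat_iso_1comp _); apply: nat_iso_compr.
rewrite /transport_class picc_mul; split=> [UST|UST].
- by apply: conj_inj; exact: nat_iso_trans e.
- apply: nat_iso_trans (nat_iso_sym e); apply: nat_iso_compl.
  exact: nat_iso_compr.
Qed.

Definition picard_transport : Pic_category D :=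
  PicCategory transport_surj transport_eq transport_mul.

End PicardTransport.

End CategoryTheory.

(** * Coseparable corings *)

Lemma tlift_exchange (A : pzRingType) (M P : rmodType A) (N Q : lmodType A)
    (V : zmodType) (F : M -> N -> P -> Q -> V) (s : tensor P Q) (t : tensor M N) :
  tlift (fun m n => tlift (fun p q => F m n p q) s) t
  = tlift (fun p q => tlift (fun m n => F m n p q) t) s.
Proof. exact: exchange_big. Qed.

Section Coaction.
Variables (k : comPzRingType) (A : kalgebra k) (C : coring A).

Definition regular_comodule : comodule C :=
  Comodule (comul_r C) (@comulA _ _ C) (@comul1r _ _ C).

Lemma coact_lift (M : comodule C) (V : zmodType) (F : M -> C -> C -> V) m :
  trilinear F ->
  tlift (fun m' c => tlift (fun m0 m1 => F m0 m1 c) (coact m')) (coact m)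
  = tlift (fun m0 m' => tlift (F m0) (comul m')) (coact m).
Proof. by move=> FT; apply: tlift_coassoc FT (coactA m). Qed.

Lemma comul_lift (V : zmodType) (F : C -> C -> C -> V) (c : C) :
  trilinear F ->
  tlift (fun m n => tlift (fun m1 m2 => F m1 m2 n) (comul m)) (comul c)
  = tlift (fun m n => tlift (F m) (comul n)) (comul c).
Proof. by move=> FT; apply: tlift_coassoc FT (comulA c). Qed.

Lemma lcoact_lift (Y : bicomodule C) (V : zmodType) (F : C -> C -> Y -> V) y :
  trilinear F ->
  tlift (fun c y' => tlift (fun c1 c2 => F c1 c2 y') (comul c)) (lcoact y)
  = tlift (fun c y' => tlift (F c) (lcoact y')) (lcoact y).
Proof. by move=> FT; apply: tlift_coassoc FT (lcoactA y). Qed.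

Lemma bicoact_lift (Y : bicomodule C) (V : zmodType) (F : C -> Y -> C -> V) y :
  trilinear F ->
  tlift (fun y' d => tlift (fun c y0 => F c y0 d) (lcoact y')) (rcoact y)
  = tlift (fun c y' => tlift (F c) (rcoact y')) (lcoact y).
Proof. by move=> FT; apply: tlift_coassoc FT (bicoact y). Qed.

End Coaction.

(* The splitting of the comultiplication that makes C coseparable. *)
Record cointegral (k : comPzRingType) (A : kalgebra k) (C : coring A)
  (g : C -> C -> A) : Prop := Cointegral {
  ci_Dl : forall c c' d, g (c + c') d = g c d + g c' d;
  ci_Dr : forall c d d', g c (d + d') = g c d + g c d';
  ci_bal : forall c a d, g (c *r a) d = g c (a *: d);
  ci_Zl : forall a c d, g (a *: c) d = a * g c d;
  ci_Zr : forall c d a, g c (d *r a) = g c d * a;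
  ci_comul : forall c, tlift g (comul c) = counit c;
  ci_slide : forall c d, tlift (fun c1 c2 => c1 *r g c2 d) (comul c)
                         = tlift (fun d1 d2 => g c d1 *: d2) (comul d)
}.

Section Coseparable.
Variables (k : comPzRingType) (A : kalgebra k) (C : coring A).
Variables (g : C -> C -> A) (gP : cointegral g).

Definition gE := (ci_Dl gP, ci_Dr gP, ci_Zl gP, ci_Zr gP).

(** * Orbit maps out of the regular comodule *)

Section FromRegular.
Variable M : comodule C.

(* The right-linear colinear map from C to M determined by m; for a graded
   module it sends (1 (x) x) a to m_x a. *)
Definition orbit_map (m : M) (c : C) : M :=
  tlift (fun m0 m1 => m0 *r g m1 c) (coact m).

Lemma orbit_map_bal c : balanced (fun (m0 : M) (m1 : C) => m0 *r g m1 c).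
Proof. by split=> *; rewrite ?gE ?ractDl ?ractDr // ractA. Qed.

Lemma orbit_mapDl m n c : orbit_map (m + n) c = orbit_map m c + orbit_map n c.
Proof.
rewrite /orbit_map (proj1 (coact_r M)); exact/tliftD/orbit_map_bal.
Qed.

Lemma orbit_mapDr m c d : orbit_map m (c + d) = orbit_map m c + orbit_map m d.
Proof.
by rewrite -tlift_add; apply: eq_tlift => m0 m1; rewrite gE ractDr.
Qed.

Lemma orbit_mapZr m c a : orbit_map m (c *r a) = orbit_map m c *r a.
Proof.
rewrite [RHS](tlift_comp (h := fun m => m *r a)) => [|u v]; last exact: ractDl.
by apply: eq_tlift => m0 m1; rewrite gE ractA.
Qed.

Lemma orbit_map_act m a c : orbit_map (m *r a) c = orbit_map m (a *: c).
Proof.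
rewrite /orbit_map (proj2 (coact_r M)) tlift_ract; last exact: orbit_map_bal.
by apply: eq_tlift => m0 m1; rewrite (ci_bal gP).
Qed.

(** By coassociativity the left side is m_0 (x) m_1 g(m_2, c); then [ci_slide] trades the
    comultiplication of m_1 for that of c. *)
Lemma orbit_map_colinear m c :
  coact (orbit_map m c) = tmap (orbit_map m) id (comul c).
Proof.
have [cD cZ] := coact_r M; rewrite /orbit_map (tlift_comp _ _ cD).
pose F (m0 : M) (m1 m2 : C) := tens m0 (m1 *r g m2 c).
transitivity (tlift (fun m' c' => tlift (fun m0 m1 => F m0 m1 c') (coact m'))
  (coact m)).
  apply: eq_tlift => m0 m1; rewrite cZ -[coact m0 in LHS]tlift_tens.
  rewrite (tlift_comp (h := fun t => t *r g m1 c)) => [|u v]; last exact: ractDl.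
  by apply: eq_tlift => m2 m3; rewrite tens_ract.
rewrite coact_lift; last first.
  split=> [p|n]; split=> *; rewrite /F ?gE ?ractDl ?ractDr ?tensDl ?tensDr //.
  - by rewrite lractA tens_bal.
  - by rewrite ractA.
transitivity (tlift (fun m0 m1 => tlift (fun d1 d2 =>
    tens (m0 *r g m1 d1) d2) (comul c)) (coact m)).
  apply: eq_tlift => m0 m1; rewrite /F -tens_tliftr (ci_slide gP) tens_tliftr.
  by apply: eq_tlift => d1 d2; rewrite tens_bal.
by rewrite tlift_exchange; apply: eq_tlift => d1 d2; rewrite tens_tliftl.
Qed.

Lemma orbit_map_hom m :
  comodule_map (M := regular_comodule C) (orbit_map m).
Proof.
split; first by split; [exact: orbit_mapDr | exact: orbit_mapZr].
exact: orbit_map_colinear.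
Qed.

(** Coassociativity and [ci_comul] reduce the sum to m_0 counit(m_1). This is how orbit maps
    generate M, and why arrows out of M can be tested on them. *)
Lemma orbit_map_coact m : tlift orbit_map (coact m) = m.
Proof.
rewrite -[RHS]coact1 /orbit_map coact_lift; last first.
  by split=> [p|n]; split=> *; rewrite ?gE ?ractDl ?ractDr ?(ci_bal gP) // ractA.
apply: eq_tlift => m0 m1; rewrite -(ci_comul gP).
rewrite [RHS](tlift_comp (h := fun a => m0 *r a)) // => a b.
exact: ractDr.
Qed.

End FromRegular.

Lemma orbit_map_nat (M N : comodule C) (h : M -> N) m c :
  comodule_map h -> h (orbit_map m c) = orbit_map (h m) c.
Proof.
case=> [[hD hZ] hco]; rewrite /orbit_map hco tlift_tmap; last exact: orbit_map_bal.
by rewrite (tlift_comp _ _ hD); apply: eq_tlift => m0 m1; rewrite hZ.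
Qed.

(** * The left action of C on a bicomodule *)

Section LeftAction.
Variable Y : bicomodule C.

Definition lact (c : C) (y : Y) : Y := tlift (fun d y0 => g c d *: y0) (lcoact y).

Lemma lact_bal c : balanced (fun (d : C) (y : Y) => g c d *: y).
Proof. by split=> *; rewrite ?gE ?scalerDl ?scalerDr // scalerA. Qed.

Lemma lactDl c d y : lact (c + d) y = lact c y + lact d y.
Proof. by rewrite -tlift_add; apply: eq_tlift => *; rewrite gE scalerDl. Qed.

Lemma lactDr c y z : lact c (y + z) = lact c y + lact c z.
Proof. by rewrite /lact (proj1 (lcoact_l Y)); exact/tliftD/lact_bal. Qed.

Lemma lactZl a c y : lact (a *: c) y = a *: lact c y.
Proof.
rewrite [RHS](tlift_comp (h := fun y => a *: y)) => [|u v].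
  by apply: eq_tlift => *; rewrite gE scalerA.
exact: scalerDr.
Qed.

Lemma lact_balanced : balanced lact.
Proof.
split=> [c d y|c y z|c a y]; [exact: lactDl | exact: lactDr |].
rewrite /lact (proj2 (lcoact_l Y)) tlift_lact; last exact: lact_bal.
by apply: eq_tlift => *; rewrite (ci_bal gP).
Qed.

Lemma lactZr c y a : lact c (y *r a) = lact c y *r a.
Proof.
rewrite /lact (proj2 (lcoact_r Y)) tlift_ract; last exact: lact_bal.
rewrite [RHS](tlift_comp (h := fun y => y *r a)) => [|u v]; last exact: ractDl.
by apply: eq_tlift => *; rewrite lractA.
Qed.

Lemma lact_rcoact c y : rcoact (lact c y) = tmap (lact c) id (rcoact y).
Proof.
have [rD rZ] := rcoact_l Y; rewrite /lact (tlift_comp _ _ rD).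
transitivity (tlift (fun d y' => tlift (fun y0 e => tens (g c d *: y0) e)
    (rcoact y')) (lcoact y)).
  by apply: eq_tlift => d y'; rewrite rZ.
rewrite -(@bicoact_lift _ _ _ _ _ (fun d y0 e => tens (g c d *: y0) e)).
  by apply: eq_tlift => y0 d; rewrite tens_tliftl.
split=> [p|n]; split=> *.
- by rewrite gE scalerDl tensDl.
- by rewrite scalerDr tensDl.
- by rewrite gE scalerA.
- by rewrite scalerDr tensDl.
- by rewrite tensDr.
- by rewrite -lractA tens_bal.
Qed.

(** Functors can therefore be applied to the action of c; this is how left structure passes through
    a cotensor functor. *)
Lemma lact_hom c : comodule_map (M := right_comodule Y) (N := right_comodule Y)
  (lact c).
Proof.
split; last exact: lact_rcoact.
by split=> [y z|y a]; [exact: lactDr | exact: lactZr].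
Qed.

(** The mirror image of [orbit_map_colinear]: coassociativity of the left coaction, then
    [ci_slide]. *)
Lemma lact_lcoact c y :
  lcoact (lact c y) = tlift (fun c1 c2 => tens c1 (lact c2 y)) (comul c).
Proof.
have [rD rZ] := lcoact_l Y; rewrite /lact (tlift_comp _ _ rD).
transitivity (tlift (fun d y' => tlift (fun e y0 => tens (g c d *: e) y0)
    (lcoact y')) (lcoact y)).
  by apply: eq_tlift => d y'; rewrite rZ.
rewrite -(@lcoact_lift _ _ _ _ _ (fun d e y0 => tens (g c d *: e) y0)).
  transitivity (tlift (fun d y0 => tlift (fun c1 c2 => tens c1 (g c2 d *: y0))
      (comul c)) (lcoact y)).
    apply: eq_tlift => d y0; rewrite -tens_tliftl -(ci_slide gP) tens_tliftl.
    by apply: eq_tlift => *; rewrite tens_bal.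
  by rewrite tlift_exchange; apply: eq_tlift => c1 c2; rewrite tens_tliftr.
split=> [p|n]; split=> *.
- by rewrite gE scalerDl tensDl.
- by rewrite scalerDr tensDl.
- by rewrite gE scalerA.
- by rewrite scalerDr tensDl.
- by rewrite tensDr.
- by rewrite -lractA tens_bal.
Qed.

Lemma lact_coact y : tlift lact (lcoact y) = y.
Proof.
rewrite -[RHS]lcoact1 /lact.
rewrite -(@lcoact_lift _ _ _ _ _ (fun c d y0 => g c d *: y0)).
  apply: eq_tlift => c y0; rewrite -(ci_comul gP).
  by rewrite (tlift_comp (h := fun a => a *: y0)) // => a b; rewrite scalerDl.
split=> [p|n]; split=> *; rewrite ?gE ?scalerDl ?scalerDr ?(ci_bal gP) //.
by rewrite scalerA.
Qed.

(* Left A-linear maps compatible with the left action of C are left colinear,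
   because y = sum y_(-1) . y_0. *)
Lemma lact_colinear (V : lmodType A) (actV : C -> V -> V) (lco : V -> tensor C V)
    (h : Y -> V) :
  llinear h -> (forall v w, lco (v + w) = lco v + lco w) ->
  (forall c v, lco (actV c v) = tlift (fun c1 c2 => tens c1 (actV c2 v)) (comul c)) ->
  (forall c y, h (lact c y) = actV c (h y)) ->
  forall y, lco (h y) = tmap id h (lcoact y).
Proof.
move=> [hD hZ] lD lact_ hact y.
pose F (c d : C) (y0 : Y) := tens c (h (lact d y0)).
rewrite -{1}(lact_coact y) (tlift_comp _ _ hD) (tlift_comp _ _ lD).
transitivity (tlift (fun c y0 => tlift (fun c1 c2 => F c1 c2 y0) (comul c))
   (lcoact y)).
  apply: eq_tlift => c y0; rewrite hact lact_.
  by apply: eq_tlift => c1 c2; rewrite /F hact.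
rewrite lcoact_lift.
  apply: eq_tlift => c y0; rewrite /F -tens_tliftr; congr tens.
  by rewrite -(tlift_comp _ _ hD) lact_coact.
have [lb1 lb2 lb3] := lact_balanced.
split=> [p|n]; split=> *; rewrite /F ?lb1 ?lb2 ?lb3 ?hD ?tensDl ?tensDr //.
by rewrite lactZl hZ tens_bal.
Qed.

End LeftAction.

End Coseparable.

(** * Arrows of the comodule category as functions, and induced comodules *)

Section ComoduleHoms.
Variables (k : comPzRingType) (A : kalgebra k) (C : coring A).
Local Notation Cat := (comodule_cat C).
Local Notation chom M N := (@hom k Cat M N).

Definition fn (M N : comodule C) (f : chom M N) : M -> N :=
  hom_fun (f : homs (comodule_hom_pred M N)).

Definition mkhom (M N : comodule C) (f : M -> N) (fP : comodule_map f) :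
  chom M N := Hom (P := comodule_hom_pred M N) fP.

Lemma fnP (M N : comodule C) (f : chom M N) : comodule_map (fn f).
Proof. exact: hom_funP (f : homs (comodule_hom_pred M N)). Qed.

Lemma fn_inj (M N : comodule C) (f h : chom M N) : fn f =1 fn h -> f = h.
Proof. exact: comodule_homP. Qed.

Lemma fnD (M N : comodule C) (f h : chom M N) m : fn (f + h) m = fn f m + fn h m.
Proof. by []. Qed.

Lemma fnZ (M N : comodule C) c (f : chom M N) m :
  fn (c *: f) m = fn f m *r kunit A c.
Proof. by []. Qed.

Lemma fn_cmp (M N P : comodule C) (h : chom N P) (f : chom M N) m :
  fn (cmp h f) m = fn h (fn f m).
Proof. by []. Qed.

Lemma fn_id (M : comodule C) m : fn (@idm k Cat M) m = m.
Proof. by []. Qed.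

Lemma fn_add (M N : comodule C) (f : chom M N) m n :
  fn f (m + n) = fn f m + fn f n.
Proof. by have [[]] := fnP f. Qed.

Lemma fn_ract (M N : comodule C) (f : chom M N) m a :
  fn f (m *r a) = fn f m *r a.
Proof. by have [[]] := fnP f. Qed.

Lemma fn_coact (M N : comodule C) (f : chom M N) m :
  coact (fn f m) = tmap (fn f) id (coact m).
Proof. by have [] := fnP f. Qed.

Lemma fn_tlift (M N : comodule C) (P : rmodType A) (Q : lmodType A)
    (F : P -> Q -> chom M N) t m :
  fn (tlift F t) m = tlift (fun p q => fn (F p q) m) t.
Proof. exact: (tlift_comp (h := fun f : chom M N => fn f m)). Qed.

Lemma can_comodule_map (M N : comodule C) (f : M -> N) (h : N -> M) :
  cancel f h -> cancel h f -> comodule_map f -> comodule_map h.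
Proof.
move=> fK hK [fl fco]; have hl := can_rlinear fK hK fl; split=> // n.
rewrite -{2}(hK n) fco tmap_comp // -[LHS]tmap_id.
by apply: eq_tmap => // m; rewrite fK.
Qed.

Lemma iso_bij (M N : comodule C) (f : chom M N) :
  is_iso f -> bijective (fn f).
Proof.
case=> h [hf fh]; exists (fn h) => m; rewrite -fn_cmp ?hf ?fh //.
Qed.

Lemma bij_iso (M N : comodule C) (f : chom M N) :
  bijective (fn f) -> is_iso f.
Proof.
case=> h fK hK; exists (mkhom (can_comodule_map fK hK (fnP f))).
by split; apply: fn_inj => m; rewrite fn_cmp fn_id /= ?fK ?hK.
Qed.

Section Transfer.
Variables (M : comodule C) (N : rmodType A) (j : M -> N) (j' : N -> M).
Hypotheses (jl : rlinear j) (jK : cancel j j') (j'K : cancel j' j).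

(** Applied below with identity maps, to move the coaction of [T reg] to a synonym of its carrier
    that has a left action as well. *)
Definition transfer_coact (n : N) : tensor N C := tmap j id (coact (j' n)).

Fact transfer_coact_r : rlinear transfer_coact.
Proof.
have jl' := can_rlinear jK j'K jl.
apply: (rlinear_comp (f := fun n => coact (j' n))); first exact: tmap_r.
by apply: rlinear_comp => //; exact: coact_r.
Qed.

Fact transfer_coactA n :
  tassoc (tmap transfer_coact id (transfer_coact n))
  = tmap id (@comul _ _ C) (transfer_coact n).
Proof.
have cl := comul_l C; have rl := transfer_coact_r; have cr := coact_r M.
rewrite !tmap_comp //.
transitivity (tassoc (tmap (tmap j id) (@id C)
  (tmap (@coact _ _ _ M) id (coact (j' n))))).
  congr tassoc; rewrite tmap_comp //; last exact: tmap_r.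
  by apply: eq_tmap => // m; rewrite /transfer_coact jK.
rewrite tassoc_tmap3 // coactA tmap_comp //; last exact: tmap_l.
by apply: eq_tmap => // c; rewrite tmap_id.
Qed.

Fact transfer_coact1 n :
  tlift (fun n c => n *r counit c) (transfer_coact n) = n.
Proof.
have bal : balanced (fun (n : N) (c : C) => n *r counit c).
  by split=> *; rewrite ?counitD ?ractDl ?ractDr // counitZl ractA.
rewrite tlift_tmap // -[RHS]j'K -[in RHS](coact1 (j' n)).
rewrite (tlift_comp _ _ (proj1 jl)); apply: eq_tlift => m c.
by rewrite (proj2 jl).
Qed.

End Transfer.

Fact lscale_hom a : comodule_map (M := regular_comodule C)
  (N := regular_comodule C) (fun c : C => a *: c).
Proof.
split; last exact: (proj2 (comul_l C)).
by split=> [c d|c b]; rewrite ?scalerDr // lractA.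
Qed.

Definition lscale (a : A) : chom (regular_comodule C) (regular_comodule C) :=
  mkhom (lscale_hom a).

Section TensorComodule.
Variables (M : rmodType A) (Y : bimodType A) (r : Y -> tensor Y C).
Hypotheses (rl : llinear r) (rr : rlinear r)
  (rA : forall y, tassoc (tmap r id (r y)) = tmap id (@comul _ _ C) (r y))
  (r1 : forall y, tlift (fun y c => y *r counit c) (r y) = y).

(** Y is only a bimodule with a bilinear right coaction here, because this is applied to T C before
    its left coaction exists; that coaction will be an arrow into such a tensor comodule. *)
Definition tensor_coact (t : tensor M Y) : tensor (tensor M Y) C :=
  tassoc_inv (tmap id r t).

Lemma tens_r (m : M) : rlinear (fun y : Y => tens m y).
Proof. by split=> [y z|y a]; rewrite ?tensDr // tens_ract. Qed.

Lemma trilinear_tens_tlift : balanced (fun (m : M) (s : tensor Y C) =>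
  tlift (fun y c => tens (tens m y) c) s).
Proof. exact/trilinear_tlift/trilinear_tens. Qed.

Lemma tensor_coact_tens m y :
  tensor_coact (tens m y) = tmap (fun y => tens m y) id (r y).
Proof. by rewrite /tensor_coact tmapE // /tassoc_inv tliftE //;
  exact: trilinear_tens_tlift. Qed.

Fact tensor_coact_r : rlinear tensor_coact.
Proof.
apply: rlinear_comp (tmap_r _ rl _) => //; last exact: (proj2 rr).
apply: tliftr; first exact: trilinear_tens_tlift.
move=> m s a; rewrite tlift_ract; last by have [] := trilinear_tens M Y C.
rewrite [RHS](tlift_comp (h := fun u => u *r a)) => [|u v]; last exact: ractDl.
by apply: eq_tlift => y c; rewrite tens_ract.
Qed.

Fact tensor_coactA t : tassoc (tmap tensor_coact id (tensor_coact t))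
  = tmap id (@comul _ _ C) (tensor_coact t).
Proof.
have cr := tensor_coact_r; have cl := comul_l C.
have [cD _] := cr.
have tD u v := tmapD (g := @id C) u v cr (@llinear_id _ _).
have tD' u v := tmapD (f := @id (tensor M Y)) u v (@rlinear_id _ _) cl.
move: t; apply: tensor_ext => [s t|s t|m y].
- by rewrite cD tD tassocD.
- by rewrite cD tD'.
have ml := tens_r m.
rewrite tensor_coact_tens tmap_comp //.
transitivity (tassoc (tmap (tmap (fun y => tens m y) id) (@id C)
    (tmap r id (r y)))).
  congr tassoc; rewrite tmap_comp //; last exact: tmap_r.
  by apply: eq_tmap => // z; rewrite tensor_coact_tens.
rewrite tassoc_tmap3 // rA !tmap_comp //.
- by apply: eq_tmap => // c; rewrite tmap_id.
- exact: tmap_l.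
Qed.

Fact tensor_coact1 t :
  tlift (fun (t : tensor M Y) c => t *r counit c) (tensor_coact t) = t.
Proof.
have bal : balanced (fun (t : tensor M Y) (c : C) => t *r counit c).
  by split=> *; rewrite ?counitD ?ractDl ?ractDr // counitZl ractA.
move: t; apply: (tensor_ext (g := id)) => [s t|//|m y].
  by rewrite (proj1 tensor_coact_r) tliftD.
rewrite tensor_coact_tens tlift_tmap // -[in RHS](r1 y).
rewrite [RHS](tlift_comp (h := fun y => tens m y)) => [|u v]; last exact: tensDr.
by apply: eq_tlift => z c; rewrite tens_ract.
Qed.

Definition tensor_comodule : comodule C :=
  Comodule tensor_coact_r tensor_coactA tensor_coact1.

Lemma tens_hom (E : comodule C) (j : E -> Y) m : rlinear j ->
  (forall e, r (j e) = tmap j id (coact e)) ->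
  comodule_map (N := tensor_comodule) (fun e : E => tens m (j e)).
Proof.
move=> jl jco; split; first exact: rlinear_comp (tens_r m) jl.
move=> e; rewrite [LHS]tensor_coact_tens jco tmap_comp //; exact: tens_r.
Qed.

Lemma tassoc_tensor_coact (t : tensor M Y) :
  tassoc (tensor_coact t) = tmap id r t.
Proof.
have [tD _] := tensor_coact_r; have D u v := tmapD (f := @id M) u v (@rlinear_id _ _) rl.
move: t; apply: tensor_ext => [s t|s t|m y].
- by rewrite tD tassocD.
- by rewrite D.
rewrite tensor_coact_tens tmapE //.
rewrite (tlift_comp _ _ (@tassocD _ M Y C)) -[r y in RHS]tlift_tens.
rewrite [RHS](tlift_comp (h := fun s => tens m s)) => [|u v]; last exact: tensDr.
by apply: eq_tlift => z c; rewrite tassocE.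
Qed.

End TensorComodule.

End ComoduleHoms.

(** * Self-equivalences of the category of comodules *)

Section RegularImage.
Variables (k : comPzRingType) (A : kalgebra k) (C : coring A).
Local Notation Cat := (comodule_cat C).
Local Notation chom M N := (@hom k Cat M N).
Local Notation reg := (regular_comodule C).

(* The image T C of the regular comodule; A acts on the left by functoriality. *)
Definition regular_image (T : kfunctor Cat Cat) : Type :=
  comod_mod (T reg : comodule C).

Variable T : kfunctor Cat Cat.
Local Notation E := (regular_image T).

HB.instance Definition _ := RModule.on E.

Definition image_scale (a : A) (y : E) : E := fn (fmor T (lscale C a)) y.

Lemma lscaleM a b : cmp (lscale C a) (lscale C b) = lscale C (a * b).
Proof. by apply: fn_inj => c; rewrite fn_cmp /= scalerA. Qed.
Lemma lscale1 : lscale C 1 = idm (reg : ob Cat).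
Proof. by apply: fn_inj => c; rewrite fn_id /= scale1r. Qed.
Lemma lscaleD a b : lscale C (a + b) = lscale C a + lscale C b.
Proof. by apply: fn_inj => c; rewrite fnD /= scalerDl. Qed.
(** As k is central in C, left multiplication by c agrees with the k-linear structure of the
    category; a k-linear T then keeps k central on T C. *)
Lemma lscale_kunit c : lscale C (kunit A c) = c *: idm (reg : ob Cat).
Proof. by apply: fn_inj => d; rewrite fnZ /= -coring_k. Qed.

Fact image_scaleA a b y :
  image_scale a (image_scale b y) = image_scale (a * b) y.
Proof. by rewrite /image_scale -lscaleM fmorM. Qed.
Fact image_scale1 : left_id 1 image_scale.
Proof. by move=> y; rewrite /image_scale lscale1 fmor1. Qed.
Fact image_scaleDr : right_distributive image_scale +%R.
Proof. by move=> a y z; exact: fn_add. Qed.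
Fact image_scaleDl y : {morph image_scale^~ y : a b / a + b}.
Proof. by move=> a b; rewrite /image_scale lscaleD fmorD. Qed.

HB.instance Definition _ := GRing.Zmodule_isLmodule.Build A E
  image_scaleA image_scale1 image_scaleDr image_scaleDl.

Fact image_biact a (y : E) b : (a *: y) *r b = a *: (y *r b).
Proof. by rewrite -[LHS](fn_ract (fmor T (lscale C a)) y). Qed.

HB.instance Definition _ := isBimodule.Build A E image_biact.

Fact image_k : kcentral (A := A) E.
Proof.
move=> c y; rewrite -[LHS]/(fn (fmor T (lscale C (kunit A c))) y).
by rewrite lscale_kunit fmorZ fmor1.
Qed.

Local Notation toE := (id : (T reg : comodule C) -> E).

Definition image_rcoact (y : E) : tensor E C :=
  transfer_coact toE (id : E -> (T reg : comodule C)) y.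

Lemma image_rcoactE y : image_rcoact y = tmap toE id (coact y).
Proof. by []. Qed.

Fact image_rcoact_r : rlinear image_rcoact.
Proof. exact: transfer_coact_r. Qed.

Fact image_rcoact_l : llinear image_rcoact.
Proof.
split=> [|a y]; first exact: (proj1 image_rcoact_r).
rewrite -[LHS]/(tmap toE id (coact (fn (fmor T (lscale C a)) y))) fn_coact.
rewrite tmap_comp // -[RHS]/(tmap (fun y : E => a *: y) id (tmap toE id _)).
rewrite tmap_comp //.
by split=> [z w|z b]; rewrite ?scalerDr ?lractA.
Qed.

Fact image_rcoactA (y : E) : tassoc (tmap image_rcoact id (image_rcoact y))
  = tmap id (@comul _ _ C) (image_rcoact y).
Proof. exact: transfer_coactA. Qed.

Fact image_rcoact1 (y : E) :
  tlift (fun (y : E) c => y *r counit c) (image_rcoact y) = y.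
Proof. exact: transfer_coact1. Qed.

Variables (g : C -> C -> A) (gP : cointegral g).

Definition orbit_hom (M : comodule C) (m : M) : chom reg M :=
  mkhom (orbit_map_hom gP m).

Lemma orbitD (M : comodule C) (m n : M) : orbit_hom (m + n) = orbit_hom m + orbit_hom n.
Proof. apply: fn_inj => c; exact: (orbit_mapDl gP). Qed.

Lemma orbit_act (M : comodule C) (m : M) a :
  orbit_hom (m *r a) = cmp (orbit_hom m) (lscale C a).
Proof. apply: fn_inj => c; exact: (orbit_map_act gP). Qed.

Lemma cmp_orbit (M N : comodule C) (f : chom M N) m :
  cmp f (orbit_hom m) = orbit_hom (fn f m).
Proof. apply: fn_inj => c; exact: (orbit_map_nat gP _ _ (fnP f)). Qed.

Lemma orbit_epi (M N : comodule C) (f h : chom M N) :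
  (forall m, cmp f (orbit_hom m) = cmp h (orbit_hom m)) -> f = h.
Proof.
move=> fh; apply: fn_inj => m; rewrite -(orbit_map_coact gP m).
rewrite !(tlift_comp _ _ (@fn_add _ _ _ _ _ _)); apply: eq_tlift => m0 m1.
exact: (congr1 (fun e : chom reg N => fn e m1) (fh m0)).
Qed.

Hypothesis TE : is_equivalence T.

(** Replacing the target by an isomorphic T N', both arrows come from arrows M -> N' by fullness,
    and these are separated by orbit maps. *)
Lemma image_orbit_epi (M N : comodule C) (f h : chom (T M : comodule C) N) :
  (forall m : M, cmp f (fmor T (orbit_hom m)) = cmp h (fmor T (orbit_hom m))) -> f = h.
Proof.
have [N' [e [e' [e'e ee']]]] := equivalence_surj (N : ob Cat) TE => fh.
have [f' ff'] := equivalence_full (cmp e' f) TE.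
have [h' hh'] := equivalence_full (cmp e' h) TE.
suff fh' : f' = h'.
  by rewrite -[f]cmp1l -[h]cmp1l -ee' -!cmpA -ff' -hh' fh'.
apply: orbit_epi => m; apply: (equivalence_faithful TE).
by rewrite !fmorM ff' hh' -!cmpA fh.
Qed.

(** * The comparison between T M and M (x) T C *)

Section Comparison.
Variable M : comodule C.

Local Notation ME := (@tensor_comodule _ _ C M E image_rcoact image_rcoact_l
  image_rcoact_r image_rcoactA image_rcoact1).

Fact tens_image_hom (m : M) : comodule_map (M := (T reg : comodule C)) (N := ME)
  (fun y => tens m (y : E)).
Proof.
exact: (@tens_hom _ _ C M E _ _ _ _ _ (T reg : comodule C) toE).
Qed.

Definition tens_image (m : M) : chom (T reg : comodule C) ME :=
  mkhom (tens_image_hom m).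

Definition image_orbit (m : M) (y : E) : (T M : comodule C) :=
  fn (fmor T (orbit_hom m)) y.

Lemma image_orbit_bal : balanced image_orbit.
Proof.
split=> [m m' y|m y z|m a y].
- by rewrite /image_orbit orbitD fmorD fnD.
- exact: fn_add.
- by rewrite /image_orbit orbit_act fmorM.
Qed.

Definition uncoact : tensor M E -> (T M : comodule C) := tlift image_orbit.

Lemma uncoact_hom : comodule_map (M := ME) uncoact.
Proof.
have ul : rlinear uncoact.
  by apply: tliftr; [exact: image_orbit_bal | move=> m y a; exact: fn_ract].
split=> // t; have [cD _] := coact_r ME.
have D u v := tmapD (g := @id C) u v ul (@llinear_id _ _).
move: t; apply: tensor_ext => [s t|s t|m y].
- by rewrite (proj1 ul) (proj1 (coact_r _)).
- by rewrite cD D.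
rewrite [uncoact _](tliftE _ _ image_orbit_bal) [LHS]fn_coact.
rewrite [coact _ in RHS]tensor_coact_tens; last exact: image_rcoact_l.
rewrite image_rcoactE [RHS]tmap_comp // [RHS]tmap_comp //; last first.
  by apply: rlinear_comp ul _; exact: tens_r.
apply: eq_tmap => // z; by rewrite [RHS](tliftE _ _ image_orbit_bal).
Qed.

(* The comparison map T M -> M (x) T C is the mate of a comodule map from M to
   a preimage of M (x) T C under T. *)
Lemma image_coact_exists : exists i : chom (T M : comodule C) ME,
  forall m y, fn i (image_orbit m y) = tlift (fun m0 (m1 : C) =>
    tens m0 (fn (fmor T (orbit_hom (M := reg) m1)) y : E)) (coact m).
Proof.
have [N [e [e' [e'e ee']]]] := equivalence_surj (ME : ob Cat) TE.
have bP m : exists f : chom reg N, cmp e (fmor T f) = tens_image m.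
  have [f ff] := equivalence_full (cmp e' (tens_image m)) TE.
  by exists f; rewrite ff cmpA ee' cmp1l.
pose b m := projT1 (cid (bP m)).
have bE m : cmp e (fmor T (b m)) = tens_image m := projT2 (cid (bP m)).
(* The b_m are merely chosen; uniqueness of mates makes them additive and balanced in m. *)
have b_uniq m f : cmp e (fmor T f) = tens_image m -> f = b m.
  move=> fm; apply: (equivalence_faithful TE).
  by rewrite -[LHS]cmp1l -[RHS]cmp1l -e'e -!cmpA fm bE.
have bD m m' : b (m + m') = b m + b m'.
  apply/esym/b_uniq; rewrite fmorD cmpDr !bE; apply: fn_inj => y.
  by rewrite fnD /= tensDl.
have b_act m a : b (m *r a) = cmp (b m) (lscale C a).
  apply/esym/b_uniq; rewrite fmorM cmpA bE; apply: fn_inj => y.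
  by rewrite /= tens_bal.
have bbal : balanced (fun m (c : C) => fn (b m) c).
  split=> [m m' c|m c d|m a c]; first by rewrite bD.
  - exact: fn_add.
  - by rewrite b_act.
(* Summing the b_m along the coaction, as in [orbit_map_coact], glues them into one map out of M. *)
pose h (m : M) := tlift (fun m0 (m1 : C) => fn (b m0) m1) (coact m).
have hl : rlinear h.
  apply: (rlinear_comp (f := @coact _ _ _ M)); last exact: coact_r.
  by apply: tliftr => // m c a; exact: fn_ract.
have hP : comodule_map (N := N) h.
  split=> // m; have [cD _] := coact_r N.
  rewrite /h (tlift_comp _ _ cD).
  pose F (m0 : M) (m1 m2 : C) := tens (fn (b m0) m1) m2.
  transitivity (tlift (fun m0 m1 => tlift (F m0) (comul m1)) (coact m)).
    by apply: eq_tlift => m0 m1; rewrite fn_coact.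
  rewrite -coact_lift; first by apply: eq_tlift => m0 m1; rewrite tens_tliftl.
  have [b1 b2 b3] := bbal.
  split=> [p|m0]; split=> *; rewrite /F ?b1 ?b2 ?b3 ?tensDl ?tensDr //.
  by rewrite -tens_bal fn_ract.
(* Applying T and composing with e turns this into the required formula, since e T(b_m) is y |-> m
   (x) y. *)
have h_orbit m : cmp (mkhom hP) (orbit_hom m)
    = tlift (fun m0 (m1 : C) => cmp (b m0) (orbit_hom (M := reg) m1)) (coact m).
  apply: fn_inj => c; rewrite fn_tlift fn_cmp /= /orbit_map.
  rewrite (tlift_comp _ _ (proj1 hl)).
  pose F (m0 : M) (m1 m2 : C) := fn (b m0) (m1 *r g m2 c).
  transitivity (tlift (fun m' c' => tlift (fun m0 m1 => F m0 m1 c') (coact m'))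
     (coact m)).
    apply: eq_tlift => m0 m1; rewrite (proj2 hl) /h.
    rewrite (tlift_comp (h := fun n => n *r g m1 c)) => [|u v]; last exact: ractDl.
    by apply: eq_tlift => m2 m3; rewrite /F fn_ract.
  rewrite coact_lift.
    by apply: eq_tlift => m0 m1; rewrite /F -(tlift_comp _ _ (@fn_add _ _ _ _ _ _)).
  have [b1 b2 b3] := bbal.
  split=> [p|m0]; split=> *; rewrite /F ?b1 ?b3 ?gE ?ractDl ?ractDr ?fn_add //.
  - by rewrite lractA.
  - by rewrite ractA.
exists (cmp e (fmor T (mkhom hP))) => m y.
rewrite /image_orbit -fn_cmp -cmpA -fmorM h_orbit.
rewrite (tlift_comp _ _ (@fmorD _ _ _ T _ _)) (tlift_comp _ _ (@cmpDr _ _ _ _ _ _)).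
rewrite fn_tlift; apply: eq_tlift => m0 m1.
by rewrite fmorM cmpA bE.
Qed.

End Comparison.

Local Notation tensE M := (@tensor_comodule _ _ C M E image_rcoact
  image_rcoact_l image_rcoact_r image_rcoactA image_rcoact1).

Definition image_coact (M : comodule C) : chom (T M : comodule C) (tensE M) :=
  projT1 (cid (image_coact_exists M)).

Lemma image_coactE (M : comodule C) (m : M) y :
  fn (image_coact M) (image_orbit m y)
  = tlift (fun m0 (m1 : C) => tens m0 (image_orbit (M := reg) m1 y : E)) (coact m).
Proof. exact: (projT2 (cid (image_coact_exists M))). Qed.

Lemma image_orbitD (M : comodule C) (m n : M) y :
  image_orbit (m + n) y = image_orbit m y + image_orbit n y.
Proof. by have [-> _ _] := image_orbit_bal M. Qed.

Lemma image_orbit_tlift (M : comodule C) (P : rmodType A) (Q : lmodType A)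
    (F : P -> Q -> M) t y :
  image_orbit (tlift F t) y = tlift (fun p q => image_orbit (F p q) y) t.
Proof.
by rewrite (tlift_comp (h := fun m => image_orbit m y)) // => m n;
  exact: image_orbitD.
Qed.

Lemma fn_image_orbit (M N : comodule C) (f : chom M N) m y :
  fn (fmor T f) (image_orbit m y) = image_orbit (fn f m) y.
Proof. by rewrite /image_orbit -fn_cmp -fmorM cmp_orbit. Qed.

(** By joint epimorphy it is enough to compare on the T(f_m), where the claim is the image under T
    of m = sum f_{m_0}(m_1). *)
Lemma image_coactK (M : comodule C) :
  cancel (fn (image_coact M)) (uncoact (M := M)).
Proof.
suff e : cmp (mkhom (uncoact_hom M)) (image_coact M) = idm (T M).
  by move=> p; rewrite -[RHS]fn_id -e.
apply: image_orbit_epi => m; rewrite cmp1l; apply: fn_inj => y.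
rewrite -[RHS]/(image_orbit m y).
rewrite -[LHS]/(uncoact (fn (image_coact M) (image_orbit m y))).
have [uD _] := proj1 (uncoact_hom M).
rewrite image_coactE (tlift_comp _ _ uD) -[in RHS](orbit_map_coact gP m).
rewrite image_orbit_tlift; apply: eq_tlift => m0 m1.
rewrite [LHS](tliftE _ _ (image_orbit_bal M)).
by rewrite [LHS](fn_image_orbit (orbit_hom m0)).
Qed.

(** [uncoact] is onto, so the elements T(f_m)(y) generate T M as an abelian group. *)
Lemma image_ext (M : comodule C) (V : zmodType) (u v : (T M : comodule C) -> V) :
  (forall p q, u (p + q) = u p + u q) -> (forall p q, v (p + q) = v p + v q) ->
  (forall m y, u (image_orbit m y) = v (image_orbit m y)) -> u =1 v.
Proof.
move=> uD vD uv p; rewrite -(image_coactK p) /uncoact.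
rewrite (tlift_comp _ _ uD) (tlift_comp _ _ vD); exact: eq_tlift.
Qed.

Definition image_lcoact (y : E) : tensor C E := fn (image_coact reg) y.

Local Notation orb := (image_orbit (M := reg) : C -> E -> E).

Lemma image_lcoactE c y :
  image_lcoact (orb c y) = tlift (fun c1 c2 => tens c1 (orb c2 y)) (comul c).
Proof. exact: (@image_coactE reg). Qed.

Lemma image_orbitZ a c y : orb (a *: c) y = a *: orb c y.
Proof. by rewrite [RHS](fn_image_orbit (M := reg) (lscale C a)). Qed.

Fact image_lcoactD y z : image_lcoact (y + z) = image_lcoact y + image_lcoact z.
Proof. exact: (fn_add (image_coact reg)). Qed.

Lemma tens_orbit_bal (M : comodule C) y :
  balanced (fun (m : M) c => tens m (orb c y)).
Proof.
split=> [m n c|m c d|m a c]; first exact: tensDl.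
- by rewrite image_orbitD tensDr.
- by rewrite image_orbitZ tens_bal.
Qed.

Fact image_lcoact_l : llinear image_lcoact.
Proof.
split=> [|a]; first exact: image_lcoactD.
apply: (image_ext (M := reg)) => [y z|y z|c y].
- by rewrite -image_lcoactD -scalerDr.
- by rewrite image_lcoactD scalerDr.
rewrite -[X in X = _]/(image_lcoact (a *: orb c y)) -image_orbitZ.
rewrite -[X in _ = X]/(a *: image_lcoact (orb c y)) !image_lcoactE.
rewrite (proj2 (comul_l C)) tlift_lact; last exact: (tens_orbit_bal reg).
rewrite [RHS](tlift_comp (h := fun t => a *: t)) => [|u v].
  by apply: eq_tlift => c1 c2; rewrite tens_lact.
exact: scalerDr.
Qed.

Fact image_lcoact_r : rlinear image_lcoact.
Proof. by have [] := fnP (image_coact reg). Qed.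

Fact image_lcoactA y : tassoc (tmap (@comul _ _ C) id (image_lcoact y))
  = tmap id image_lcoact (image_lcoact y).
Proof.
have ll := image_lcoact_l; have cr := comul_r C.
have tD (t u : tensor C E) := tmapD (g := @id E) t u cr (@llinear_id _ _).
have tD' t u := tmapD (f := @id C) t u (@rlinear_id _ _) ll.
move: y; apply: (image_ext (M := reg)) => [y z|y z|c y].
- by rewrite -tassocD -tD -image_lcoactD.
- by rewrite -tD' -image_lcoactD.
rewrite -[image_orbit c y]/(orb c y) image_lcoactE.
rewrite (tlift_comp _ _ tD) (tlift_comp _ _ (@tassocD _ _ _ _)).
rewrite (tlift_comp _ _ tD').
pose F (a b c : C) := tens a (tens b (orb c y)).
transitivity (tlift (fun c1 c2 => tlift (fun a b => F a b c2) (comul c1))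
    (comul c)).
  apply: eq_tlift => c1 c2; rewrite tmapE // -[comul c1 in LHS]tlift_tens.
  rewrite tens_tliftl (tlift_comp _ _ (@tassocD _ _ _ _)).
  by apply: eq_tlift => a b; rewrite tassocE.
rewrite comul_lift.
  by apply: eq_tlift => c1 c2; rewrite /F tmapE // image_lcoactE tens_tliftr.
have [b1 b2 b3] := tens_orbit_bal reg y.
split=> [p|n]; split=> *; rewrite /F ?tensDl ?tensDr //.
- by rewrite tens_bal tens_lact.
- by rewrite b2 tensDr.
- by rewrite b3.
Qed.

Fact image_lcoact1 y : tlift (fun c y => counit c *: y) (image_lcoact y) = y.
Proof.
have bal : balanced (fun (c : C) (y : E) => counit c *: y).
  by split=> *; rewrite ?counitD ?scalerDl ?scalerDr // counitZr scalerA.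
have bD s t := tliftD s t bal.
move: y; apply: (image_ext (M := reg) (v := id)) => [y z|//|c y].
  by rewrite -bD -image_lcoactD.
rewrite -[image_orbit c y]/(orb c y) image_lcoactE (tlift_comp _ _ bD).
rewrite -[in RHS](comul1l c) [RHS]image_orbit_tlift; apply: eq_tlift => c1 c2.
by rewrite tliftE // image_orbitZ.
Qed.

(** This is colinearity of the comparison arrow at C, read through the associator. *)
Fact image_bicoact y : tassoc (tmap image_lcoact id (image_rcoact y))
  = tmap id image_rcoact (image_lcoact y).
Proof.
rewrite -tassoc_tensor_coact; [|exact: image_rcoact_l|exact: image_rcoact_r].
congr tassoc; rewrite image_rcoactE tmap_comp //; last exact: image_lcoact_r.
exact: esym (fn_coact (image_coact reg) y).
Qed.

Definition image_bicomodule : bicomodule C :=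
  Bicomodule image_k image_lcoact_l image_lcoact_r image_rcoact_l
    image_rcoact_r image_lcoactA image_lcoact1 image_rcoactA image_rcoact1
    image_bicoact.

Lemma uncoact_regular_l : llinear (uncoact (M := reg) : tensor C E -> E).
Proof.
apply: tliftl; first exact: (image_orbit_bal reg).
by move=> a c y; exact: image_orbitZ.
Qed.

Lemma image_cotensor (M : comodule C) :
  is_cotensor (Y := image_bicomodule) (fn (image_coact M)).
Proof.
have [il ico] := fnP (image_coact M); have cr := coact_r M.
have ll := image_lcoact_l.
have tD (t u : tensor M E) := tmapD (g := @id E) t u cr (@llinear_id _ _).
have tD' t u := tmapD (f := @id M) t u (@rlinear_id _ _) ll.
split=> //; first exact: can_inj (@image_coactK M); last first.
  move=> p; rewrite -[RHS]tassoc_tensor_coact;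
    [|exact: image_rcoact_l|exact: image_rcoact_r].
  by congr tassoc; rewrite -ico.
move=> t; split=> [[p <-]|e].
- move: p; apply: image_ext => [p q|p q|m y].
  + by rewrite (proj1 il) tD tassocD.
  + by rewrite (proj1 il) tD'.
  rewrite image_coactE (tlift_comp _ _ tD) (tlift_comp _ _ (@tassocD _ _ _ _)).
  rewrite (tlift_comp _ _ tD').
  pose F (a : M) (b c : C) := tens a (tens b (orb c y)).
  transitivity (tlift (fun c1 c2 => tlift (fun a b => F a b c2) (coact c1))
      (coact m)).
    apply: eq_tlift => c1 c2; rewrite tmapE // -[coact c1 in LHS]tlift_tens.
    rewrite tens_tliftl (tlift_comp _ _ (@tassocD _ _ _ _)).
    by apply: eq_tlift => a b; rewrite tassocE.
  rewrite coact_lift.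
    apply: eq_tlift => c1 c2; rewrite /F tmapE // -tens_tliftr.
    by rewrite -image_lcoactE.
  have [b1 b2 b3] := tens_orbit_bal reg y.
  split=> [p|n]; split=> *; rewrite /F ?tensDl ?tensDr //.
  + by rewrite tens_bal tens_lact.
  + by rewrite b2 tensDr.
  + by rewrite b3.
- exists (uncoact t); have ul := uncoact_regular_l.
  (* Apply M (x) [uncoact] to the cotensor equation: its right side becomes t, as [uncoact] splits
     the left coaction, and its left side is the comparison map at [uncoact t]. *)
  have := congr1 (tmap id (uncoact (M := reg) : tensor C E -> E)) e.
  rewrite tmap_comp // (eq_tmap (f' := id) (g' := id)) //; last first.
    by move=> y; exact: (@image_coactK reg).
  rewrite tmap_id => e'; rewrite -[RHS]e' {e'}.
  have uD s u := tmapD (f := @id M) s u (@rlinear_id _ _) ul.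
  rewrite tassoc_tmap [RHS](tlift_comp _ _ uD) [in LHS]/uncoact.
  rewrite [LHS](tlift_comp _ _ (proj1 il)).
  apply: eq_tlift => m y; rewrite image_coactE (tlift_comp _ _ uD).
  apply: eq_tlift => m0 m1; rewrite tmapE //; congr tens.
  by rewrite [RHS](tliftE _ _ (image_orbit_bal reg)).
Qed.

(* Eilenberg-Watts for self-equivalences. *)
Theorem image_cotensor_functor : is_cotensor_functor image_bicomodule T.
Proof.
exists (fun M => fn (image_coact M)); split=> [M|M N f0]; first exact: image_cotensor.
pose f : chom M N := f0; suff : forall z, fn (image_coact N) (fn (fmor T f) z)
  = tmap (fn f) id (fn (image_coact M) z) by [].
have fl := proj1 (fnP f).
have tD (t u : tensor M E) := tmapD (g := @id E) t u fl (@llinear_id _ _).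
apply: image_ext => [p q|p q|m y].
- by rewrite (fn_add (fmor T f)) (fn_add (image_coact N)).
- by rewrite (fn_add (image_coact M)) tD.
rewrite [X in fn _ X](fn_image_orbit f) !image_coactE fn_coact.
rewrite tlift_tmap; last exact: tens_orbit_bal.
by rewrite [RHS](tlift_comp _ _ tD); apply: eq_tlift => m0 m1; rewrite tmapE.
Qed.

End RegularImage.

(** * Cotensor functors and the Picard group of a coseparable coring *)

Section BicomoduleIso.
Variables (k : comPzRingType) (A : kalgebra k) (C : coring A).

Lemma tmapl_bij (M N : rmodType A) (P : lmodType A) (f : M -> N) (f' : N -> M) :
  rlinear f -> cancel f f' -> cancel f' f -> cancel (tmap f (@id P)) (tmap f' id).
Proof.
move=> fl fK f'K t; rewrite tmap_comp //; last exact: can_rlinear f'K _.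
by rewrite -[RHS]tmap_id; apply: eq_tmap.
Qed.

Lemma tmapr_bij (M : rmodType A) (N P : lmodType A) (f : N -> P) (f' : P -> N) :
  llinear f -> cancel f f' -> cancel f' f -> cancel (tmap (@id M) f) (tmap id f').
Proof.
move=> fl fK f'K t; rewrite tmap_comp //; last exact: can_llinear f'K _.
by rewrite -[RHS]tmap_id; apply: eq_tmap.
Qed.

Lemma bicomodule_iso_sym (Y Z : bicomodule C) :
  bicomodule_iso Y Z -> bicomodule_iso Z Y.
Proof.
case=> f [[f' fK f'K] fl fr flc frc].
have fl' := can_llinear fK f'K fl; have fr' := can_rlinear fK f'K fr.
exists f'; split=> //; first by exists f.
- move=> z; apply: (can_inj (tmapr_bij fl fK f'K)).
  by rewrite -flc f'K tmap_comp // -[LHS]tmap_id; apply: eq_tmap.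
- move=> z; apply: (can_inj (tmapl_bij fr fK f'K)).
  by rewrite -frc f'K tmap_comp // -[LHS]tmap_id; apply: eq_tmap.
Qed.

Lemma cotensor_transport (M : comodule C) (Y Z : bicomodule C) (P : comodule C)
    (i : P -> tensor M Y) (h : Y -> Z) (h' : Z -> Y) :
  cancel h h' -> cancel h' h -> llinear h -> rlinear h ->
  (forall y, lcoact (h y) = tmap id h (lcoact y)) ->
  (forall y, rcoact (h y) = tmap h id (rcoact y)) ->
  is_cotensor i -> is_cotensor (fun p => tmap id h (i p)).
Proof.
move=> hK h'K hl hr hlc hrc [il iinj iker ico].
have hl' := can_llinear hK h'K hl; have hr' := can_rlinear hK h'K hr.
have cr := coact_r M; have cl := lcoact_l Y; have cl' := lcoact_l Z.
have idhl : llinear (tmap (@id C) h) by exact: tmap_l.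
have ker (t : tensor M Y) : tassoc (tmap (@coact _ _ _ M) id (tmap id h t))
    = tmap id (tmap id h) (tassoc (tmap (@coact _ _ _ M) id t)).
  rewrite -tassoc_tmap3 // !tmap_comp //; last exact: tmap_r.
  by congr tassoc; apply: eq_tmap => // m; rewrite tmap_id.
have co (t : tensor M Y) : tmap id (@lcoact _ _ _ Z) (tmap id h t)
    = tmap id (tmap id h) (tmap id (@lcoact _ _ _ Y) t).
  by rewrite !tmap_comp //; apply: eq_tmap.
split.
- by apply: rlinear_comp => //; apply: tmap_r => //; case: hr.
- by move=> p q /(can_inj (tmapr_bij hl hK h'K)) /iinj.
- move=> t; split=> [[p <-]|].
    by rewrite ker co; congr tmap; apply/iker; exists p.
  rewrite -(tmapr_bij hl' h'K hK t) ker co => e.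
  have /iker [p <-] := can_inj (tmapr_bij idhl (tmapr_bij hl hK h'K)
    (tmapr_bij hl' h'K hK)) e.
  by exists p.
- move=> p; have hidl : llinear (tmap h (@id C)) by apply: tmap_l => //; case: hl.
  have rl := rcoact_l Y; have rl' := rcoact_l Z.
  transitivity (tassoc (tmap (tmap id h) (@id C) (tmap i id (coact p)))).
    congr tassoc; rewrite tmap_comp //.
    by apply: tmap_r => //; case: hr.
  rewrite tassoc_tmap3 // ico !tmap_comp //.
  by apply: eq_tmap => // y; rewrite hrc.
Qed.

Lemma cotensor_precomp (M : comodule C) (Y : bicomodule C) (P Q : comodule C)
    (i : P -> tensor M Y) (v : Q -> P) :
  bijective v -> comodule_map v -> is_cotensor i -> is_cotensor (fun q => i (v q)).
Proof.
case=> v' vK v'K [vl vco] [il iinj iker ico]; split.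
- exact: rlinear_comp.
- by move=> p q /iinj /(can_inj vK).
- move=> t; rewrite -iker; split=> [[q <-]|[p <-]]; first by exists (v q).
  by exists (v' p); rewrite v'K.
- by move=> q; rewrite -ico vco tmap_comp.
Qed.

Lemma cotensor_functor_transport (Y Z : bicomodule C) F :
  bicomodule_iso Y Z -> is_cotensor_functor Y F -> is_cotensor_functor Z F.
Proof.
case=> h [[h' hK h'K] hl hr hlc hrc] [i [ic inat]].
exists (fun M p => tmap id h (i M p)); split=> [M|M N f z].
  exact: cotensor_transport (ic M).
have [fl _] := fnP (f : @hom _ (comodule_cat C) M N).
by rewrite inat !tmap_comp.
Qed.

(** The unit law C [] Y = Y; the inverse applies the counit to the factor C. *)
Lemma lcoact_cotensor (Y : bicomodule C) :
  is_cotensor (M := regular_comodule C) (Y := Y) (P := right_comodule Y)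
    (@lcoact _ _ _ Y).
Proof.
have cl := lcoact_l Y; have cr := comul_r C.
split; [exact: lcoact_r | | | exact: bicoact].
- by move=> y z e; rewrite -[y]lcoact1 e lcoact1.
move=> t; split=> [[y <-]|e]; first exact: lcoactA.
have bal : balanced (fun (c : C) (y : Y) => counit c *: y).
  by split=> *; rewrite ?counitD ?scalerDl ?scalerDr // counitZr scalerA.
have bal' : balanced (fun (c : C) (s : tensor C Y) => counit c *: s).
  by split=> *; rewrite ?counitD ?scalerDl ?scalerDr // counitZr scalerA.
have bD s u := tliftD s u bal'.
exists (tlift (fun (c : C) (y : Y) => counit c *: y) t).
have := congr1 (tlift (fun (c : C) (s : tensor C Y) => counit c *: s)) e.
rewrite tlift_tmap // => e'; rewrite (tlift_comp _ _ (proj1 cl)).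
transitivity (tlift (fun (c : C) (y : Y) => counit c *: lcoact y) t).
  by apply: eq_tlift => c y; rewrite (proj2 cl).
rewrite -e' tassoc_tmap (tlift_comp _ _ bD) -[RHS]tlift_tens.
apply: eq_tlift => c y; rewrite (tlift_comp _ _ bD) -[in RHS](comul1l c).
rewrite [RHS](tlift_comp (h := fun c => tens c y)) => [|u v]; last exact: tensDl.
by apply: eq_tlift => c1 c2; rewrite tliftE // tens_lact.
Qed.

End BicomoduleIso.

(** * Uniqueness of cotensor products and representing bicomodules *)

Section Represent.
Variables (k : comPzRingType) (A : kalgebra k) (C : coring A).
Variables (g : C -> C -> A) (gP : cointegral g).
Local Notation Cat := (comodule_cat C).
Local Notation chom M N := (@hom k Cat M N).
Local Notation reg := (regular_comodule C).

(* The projection of M (x) Y onto the cotensor product. *)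
Definition cotensor_proj (M : comodule C) (Y : bicomodule C) :
    tensor M Y -> tensor M Y :=
  tlift (fun m y => tlift (fun m0 m1 => tens m0 (lact g m1 y)) (coact m)).

Section Projection.
Variables (M : comodule C) (Y : bicomodule C).

Lemma tens_lact_trilinear :
  trilinear (fun (m : M) (c : C) (y : Y) => tens m (lact g c y)).
Proof.
have [b1 b2 b3] := lact_balanced gP Y.
split=> [p|n]; split=> *; rewrite ?b1 ?b2 ?b3 ?tensDl ?tensDr //.
by rewrite (lactZl gP) tens_bal.
Qed.

Lemma cotensor_proj_bal : balanced (fun (m : M) (y : Y) =>
  tlift (fun m0 m1 => tens m0 (lact g m1 y)) (coact m)).
Proof.
have [t1 t2] := tens_lact_trilinear; have [cD cZ] := coact_r M.
split=> [m n y|m y z|m a y].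
- by rewrite cD tliftD.
- by rewrite -tlift_add; apply: eq_tlift => m0 m1; have [_ -> _] := t2 m0.
- rewrite cZ tlift_ract //; apply: eq_tlift => m0 m1.
  by have [_ _ ->] := t2 m0.
Qed.

Lemma cotensor_proj_r : rlinear (@cotensor_proj M Y).
Proof.
apply: tliftr; first exact: cotensor_proj_bal.
move=> m y a; rewrite [RHS](tlift_comp (h := fun t => t *r a)) => [|u v].
  by apply: eq_tlift => *; rewrite (lactZr gP) tens_ract.
exact: ractDl.
Qed.

(** On m (x) y both sides are m_0 (x) m_1 (x) m_2 . y, by coassociativity of M on the left and
    [lact_lcoact] on the right. *)
Lemma cotensor_proj_ker t : tassoc (tmap (@coact _ _ _ M) id (cotensor_proj t))
  = tmap id (@lcoact _ _ _ Y) (cotensor_proj t).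
Proof.
have [pD _] := cotensor_proj_r; have cr := coact_r M; have ll := lcoact_l Y.
have tD (t u : tensor M Y) := tmapD (g := @id Y) t u cr (@llinear_id _ _).
have tD' t u := tmapD (f := @id M) t u (@rlinear_id _ _) ll.
move: t; apply: tensor_ext => [s t|s t|m y].
- by rewrite pD tD tassocD.
- by rewrite pD tD'.
rewrite /cotensor_proj tliftE; last exact: cotensor_proj_bal.
rewrite (tlift_comp _ _ tD) (tlift_comp _ _ (@tassocD _ _ _ _)) (tlift_comp _ _ tD').
pose F (a : M) (b c : C) := tens a (tens b (lact g c y)).
transitivity (tlift (fun c1 c2 => tlift (fun a b => F a b c2) (coact c1))
    (coact m)).
  apply: eq_tlift => c1 c2; rewrite tmapE // -[coact c1 in LHS]tlift_tens.
  rewrite tens_tliftl (tlift_comp _ _ (@tassocD _ _ _ _)).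
  by apply: eq_tlift => a b; rewrite tassocE.
rewrite coact_lift.
  apply: eq_tlift => c1 c2; rewrite /F tmapE // -tens_tliftr.
  by rewrite (lact_lcoact gP).
have [b1 b2 b3] := lact_balanced gP Y.
split=> [p|n]; split=> *; rewrite /F ?b1 ?b2 ?b3 ?tensDl ?tensDr //.
- by rewrite tens_bal tens_lact.
- by rewrite (lactZl gP) tens_bal.
Qed.

(** Applying M (x) [lact] to the cotensor equation gives the projection on one side, and t on the
    other by [lact_coact]. *)
Lemma cotensor_proj_id t :
  tassoc (tmap (@coact _ _ _ M) id t) = tmap id (@lcoact _ _ _ Y) t ->
  cotensor_proj t = t.
Proof.
have lb := lact_balanced gP Y.
have ll : llinear (tlift (@lact _ _ _ g Y)).
  by apply: tliftl => // *; exact: lactZl.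
have uD s u := tmapD (f := @id M) s u (@rlinear_id _ _) ll.
move=> /(congr1 (tmap id (tlift (@lact _ _ _ g Y)))).
rewrite tmap_comp // (eq_tmap (f' := id) (g' := id)) //; last exact: lact_coact.
rewrite tmap_id => e; rewrite -[RHS]e tassoc_tmap (tlift_comp _ _ uD).
apply: eq_tlift => m y; rewrite (tlift_comp _ _ uD).
by apply: eq_tlift => m0 m1; rewrite tmapE // tliftE.
Qed.

Lemma cotensor_retract (P : comodule C) (i : P -> tensor M Y) :
  is_cotensor i -> exists r : tensor M Y -> P, rlinear r /\ cancel i r.
Proof.
case=> [il iinj iker ico].
have ex t : exists p, i p = cotensor_proj t.
  by apply/iker; exact: cotensor_proj_ker.
pose r t := projT1 (cid (ex t)).
have rE t : i (r t) = cotensor_proj t := projT2 (cid (ex t)).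
have [pD pZ] := cotensor_proj_r; have [iD iZ] := il.
exists r; split.
  by split=> [s t|t a]; apply: iinj; rewrite ?iD ?iZ !rE ?pD ?pZ.
move=> p; apply: iinj; rewrite rE cotensor_proj_id //.
by apply/iker; exists p.
Qed.

(** Coseparability stands in for flatness: i has an A-linear retraction, so i (x) C is injective and
    i determines the coaction of the cotensor product. *)
Lemma cotensor_co_inj (P : comodule C) (i : P -> tensor M Y) :
  is_cotensor i -> injective (fun t : tensor P C => tassoc (tmap i id t)).
Proof.
move=> ic; have [r [rl iK]] := cotensor_retract ic.
move=> s t /(can_inj (@tassocK _ _ _ _)) /(congr1 (tmap r id)).
by rewrite !tmap_comp // !(eq_tmap (f' := id) (g' := id)) // !tmap_id.
Qed.

Lemma cotensor_lift (P P' : comodule C) (i : P -> tensor M Y)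
    (i' : P' -> tensor M Y) : is_cotensor i -> is_cotensor i' ->
  exists2 w : P -> P', comodule_map w & forall p, i' (w p) = i p.
Proof.
case=> [[iD iZ] iinj iker ico] ic'; have [il' iinj' iker' ico'] := ic'.
have ex p : exists p', i' p' = i p by apply/iker'/iker; exists p.
pose w p := projT1 (cid (ex p)).
have wE p : i' (w p) = i p := projT2 (cid (ex p)).
have [iD' iZ'] := il'.
have wl : rlinear w.
  by split=> [p q|p a]; apply: iinj'; rewrite ?iD' ?iZ' !wE ?iD ?iZ.
exists w => //; split=> // p; apply: (cotensor_co_inj ic').
rewrite ico' wE -ico tmap_comp //.
by congr tassoc; apply: eq_tmap => // q; rewrite wE.
Qed.

Lemma cotensor_iso (P P' : comodule C) (i : P -> tensor M Y)
    (i' : P' -> tensor M Y) : is_cotensor i -> is_cotensor i' ->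
  exists w : P -> P', [/\ bijective w, comodule_map w & forall p, i' (w p) = i p].
Proof.
move=> ic ic'; have [w wP wE] := cotensor_lift ic ic'.
have [w' _ wE'] := cotensor_lift ic' ic.
have [_ iinj _ _] := ic; have [_ iinj' _ _] := ic'.
exists w; split=> //; exists w' => p.
- by apply: iinj; rewrite wE' wE.
- by apply: iinj'; rewrite wE wE'.
Qed.

End Projection.

Lemma cotensor_functor_uniq (Y : bicomodule C) F F' :
  is_cotensor_functor Y F -> is_cotensor_functor Y F' -> nat_iso F F'.
Proof.
case=> i [ic inat] [i' [ic' inat']].
have ex M := cotensor_iso (ic M) (ic' M).
pose w M := projT1 (cid (ex M)).
have wP M : [/\ bijective (w M), comodule_map (w M)
  & forall p, i' M (w M p) = i M p] := projT2 (cid (ex M)).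
have wco M : comodule_map (w M) by case: (wP M).
exists (fun M : comodule C => mkhom (wco M) : hom (F M) (F' M)); split=> [M|M N f].
  by apply: bij_iso; case: (wP M).
apply: fn_inj => p; have [_ iinj _ _] := ic' N; apply: iinj.
have [_ _ wN] := wP N; have [_ _ wM] := wP M.
rewrite [LHS]wN; transitivity (tmap (fn f) id (i M p)); first exact: inat.
by rewrite -wM; symmetry; exact: inat'.
Qed.

(* Y is T C, with its left structure determined by T. *)
Definition represents (Y : bicomodule C) (T : kfunctor Cat Cat) : Prop :=
  exists j : Y -> (T reg : comodule C),
    [/\ bijective j, comodule_map (M := right_comodule Y) j,
        forall a y, j (a *: y) = fn (fmor T (lscale C a)) (j y)
      & forall c y, j (lact g c y) = fn (fmor T (orbit_hom gP (M := reg) c)) (j y)].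

(** On generators, c acts on T(f_d)(z) by replacing d with sum g(c, d_1) d_2, which is f_c(d) by
    [ci_slide]. *)
Lemma image_represents (T : kfunctor Cat Cat) (TE : is_equivalence T) :
  represents (image_bicomodule gP TE) T.
Proof.
exists (id : regular_image T -> (T reg : comodule C)); split=> //.
- by exists id.
- split=> // y; rewrite -[@coact _ _ _ (right_comodule _) y]/(image_rcoact y).
  by rewrite image_rcoactE tmap_comp // tmap_id.
move=> c; apply: (image_ext (gP := gP) TE (M := reg)) => [y z|y z|d z].
- by rewrite -[RHS](lactDr gP (Y := image_bicomodule gP TE)).
- exact: fn_add.
rewrite [RHS](fn_image_orbit gP (orbit_hom gP (M := reg) c)).
have bal := lact_bal gP (image_bicomodule gP TE) c.
have bD s t := tliftD s t bal.
rewrite [LHS]/lact -[lcoact _]/(image_lcoact gP TE _) image_lcoactE.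
rewrite (tlift_comp _ _ bD).
rewrite -[fn _ d]/(tlift (fun c1 c2 => c1 *r g c2 d) (comul c)) (ci_slide gP).
rewrite [RHS]image_orbit_tlift; apply: eq_tlift => d1 d2.
by rewrite tliftE // image_orbitZ.
Qed.

(** Both bicomodules are T C with left actions read off from T, so the composite bijection respects
    the actions of A and C; [lact_colinear] upgrades this to left colinearity. *)
Lemma represents_iso (Y Z : bicomodule C) T :
  represents Y T -> represents Z T -> bicomodule_iso Y Z.
Proof.
case=> j [jb [jl jco] jZ jact] [h [hb [hl hco] hZ hact]].
have [j' jK j'K] := jb; have [h' hK h'K] := hb.
have [h'l h'co] := can_comodule_map (M := right_comodule Z) hK h'K (conj hl hco).
pose f y := h' (j y); have fr : rlinear f by exact: rlinear_comp.
have fl : llinear f.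
  split=> [y z|a y]; first exact: (proj1 fr).
  by apply: (can_inj hK); rewrite hZ !h'K jZ.
exists f; split=> //.
- by exists (fun z => j' (h z)) => y; rewrite /f ?h'K ?jK // j'K hK.
- apply: (@lact_colinear _ _ _ _ gP _ _ (@lact _ _ _ g Z) _ f) => //.
  + exact: (proj1 (lcoact_l Z)).
  + exact: lact_lcoact.
  + by move=> c y; apply: (can_inj hK); rewrite hact !h'K jact.
- move=> y; rewrite [LHS]h'co jco tmap_comp //; exact: eq_tmap.
Qed.

Lemma represents_nat_iso (Y : bicomodule C) T T' :
  nat_iso T T' -> represents Y T -> represents Y T'.
Proof.
case=> eta [iso nat] [j [jb [jl jco] jZ jact]].
have [el eco] := fnP (eta reg).
have nat_fn (f : chom reg reg) x :
    fn (eta reg) (fn (fmor T f) x) = fn (fmor T' f) (fn (eta reg) x).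
  by rewrite -!fn_cmp nat.
exists (fun y => fn (eta reg) (j y)); split.
- by apply: (bij_comp _ jb); exact: iso_bij.
- split; first exact: rlinear_comp.
  by move=> y; rewrite eco jco tmap_comp.
- by move=> a y; rewrite jZ nat_fn.
- by move=> c y; rewrite jact nat_fn.
Qed.

Lemma represents_cotensor (Y : bicomodule C) T :
  is_equivalence T -> represents Y T -> is_cotensor_functor Y T.
Proof.
move=> TE YT; apply: cotensor_functor_transport (image_cotensor_functor gP TE).
exact: represents_iso (image_represents TE) YT.
Qed.

(** Under Y = C [] Y, the action of c is the orbit map of c on the factor C: the last clause of
    [represents] for a cotensor functor. *)
Lemma lact_orbit (Y : bicomodule C) c (y : Y) :
  lcoact (lact g c y) = tmap (orbit_map g (M := reg) c) id (lcoact y).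
Proof.
rewrite (lact_lcoact gP); under [LHS]eq_tlift do rewrite tens_tliftr.
rewrite tlift_exchange; apply: eq_tlift => d y0; rewrite tens_tliftl.
by apply: eq_tlift => c1 c2; rewrite tens_bal.
Qed.

Lemma cotensor_represents (Y : bicomodule C) F :
  is_cotensor_functor Y F -> represents Y F.
Proof.
case=> i [ic inat].
have [j [jb jP jE]] := cotensor_iso (lcoact_cotensor Y) (ic reg).
have [_ iinj _ _] := ic reg; have [lD lZ] := lcoact_l Y.
have nat (f : chom reg reg) z : i reg (fn (fmor F f) z) = tmap (fn f) id (i reg z).
  exact: inat.
exists j; split=> // [a y|c y]; apply: iinj; rewrite nat !jE; first exact: lZ.
exact: lact_orbit.
Qed.

(** * Cotensor products against composition of functors *)

Section Product.
Variables (Y Z : bicomodule C) (F F' : kfunctor Cat Cat).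
Hypotheses (FY : is_cotensor_functor Y F) (FZ : is_cotensor_functor Z F').

Local Notation rY := (right_comodule Y).

Fact bilscale_hom a : comodule_map (M := rY) (N := rY) (fun y : Y => a *: y).
Proof.
split; first by split=> [y z|y b]; rewrite ?scalerDr // lractA.
exact: (proj2 (rcoact_l Y)).
Qed.

(** As a right comodule W is F' Y by uniqueness of cotensor products, hence F'(F C) after applying
    F' to Y = F C. *)
Lemma bicotensor_represents (W : bicomodule C) :
  is_bicotensor Y Z W -> represents W (fun_comp F' F).
Proof.
case=> iW [icW iWl iWco]; have [_ iWZ] := iWl; have [i [ic inat]] := FZ.
have [j [jb jP jZ jact]] := cotensor_represents FY.
have [w [wb wP wE]] := cotensor_iso icW (ic rY).
have [_ iinj _ _] := ic rY.
have nat (f : chom rY rY) z : i rY (fn (fmor F' f) z) = tmap (fn f) id (i rY z).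
  exact: inat.
pose jh : chom rY (F reg : comodule C) := mkhom jP.
have [[jhl jhco] wl] := (fnP (fmor F' jh), proj1 wP).
(* If an endomorphism f of Y corresponds to F f' under j, then F' f corresponds to F'F f'. This
   serves both for scalars and for the action of C. *)
have jwE (f : chom rY rY) (f' : chom reg reg) z :
    (forall y, fn jh (fn f y) = fn (fmor F f') (fn jh y)) ->
    fn (fmor F' jh) (fn (fmor F' f) z)
    = fn (fmor (fun_comp F' F) f') (fn (fmor F' jh) z).
  move=> ff; transitivity (fn (fmor F' (cmp jh f)) z); first by rewrite fmorM.
  have -> : cmp jh f = cmp (fmor F f') jh by exact: fn_inj.
  by rewrite fmorM.
exists (fun x => fn (fmor F' jh) (w x)); split.
- apply: (bij_comp _ wb); apply: iso_bij; apply: is_iso_fmor.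
  exact: (bij_iso (f := jh)).
- by split; [exact: rlinear_comp | move=> x; rewrite jhco (proj2 wP) tmap_comp].
- move=> a x; rewrite -(jwE (mkhom (bilscale_hom a))); last exact: jZ.
  by congr fn; apply: iinj; rewrite nat !wE iWZ.
- move=> c x; rewrite -(jwE (mkhom (lact_hom gP Y c))); last exact: jact.
  congr fn; apply: iinj; rewrite nat !wE.
  have bal : balanced (fun (d : C) (s : tensor Y Z) => g c d *: s).
    by split=> *; rewrite ?(gE gP) ?scalerDl ?scalerDr // scalerA.
  have bD s u := tliftD s u bal.
  transitivity (tlift (fun (d : C) (s : tensor Y Z) => g c d *: s)
      (tmap id iW (lcoact x))).
    rewrite tlift_tmap // /lact (tlift_comp _ _ (proj1 iWl)).
    by apply: eq_tlift => d y; rewrite iWZ.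
  rewrite iWco tassoc_tmap (tlift_comp _ _ bD); apply: eq_tlift => y z.
  rewrite (tlift_comp _ _ bD) /lact tens_tliftl; apply: eq_tlift => d y0.
  by rewrite tliftE // tens_lact.
Qed.

(** The embedding of W is the cotensor embedding of F' Y, precomposed with W = F'(F C) = F' Y. *)
Lemma represents_bicotensor (W : bicomodule C) :
  represents W (fun_comp F' F) -> is_bicotensor Y Z W.
Proof.
case=> h [hb hP hZ hact]; have [i [ic inat]] := FZ.
have [j [jb jP jZ jact]] := cotensor_represents FY.
have nat (f : chom rY rY) z : i rY (fn (fmor F' f) z) = tmap (fn f) id (i rY z).
  exact: inat.
have [j' jK j'K] := jb.
pose jh : chom (F reg : comodule C) rY := mkhom (can_comodule_map (M := rY) jK j'K jP).
have jhE (f : chom rY rY) (f' : chom reg reg) z :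
    (forall y, j (fn f y) = fn (fmor F f') (j y)) ->
    fn (fmor F' jh) (fn (fmor (fun_comp F' F) f') z)
    = fn (fmor F' f) (fn (fmor F' jh) z).
  move=> ff; transitivity (fn (fmor F' (cmp jh (fmor F f'))) z).
    by rewrite fmorM.
  have -> : cmp jh (fmor F f') = cmp f jh.
    apply: fn_inj => x; apply: (can_inj jK).
    by rewrite !fn_cmp /= j'K ff j'K.
  by rewrite fmorM.
pose v x := fn (fmor F' jh) (h x).
have vb : bijective v.
  apply: (bij_comp _ hb); apply: iso_bij; apply: is_iso_fmor.
  by apply: (bij_iso (f := jh)); exists j.
have [ul uco] := fnP (fmor F' jh); have [hl hco] := hP.
have vP : comodule_map (M := right_comodule W) v.
  split; first exact: rlinear_comp.
  by move=> x; rewrite /v uco hco tmap_comp.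
have icv := cotensor_precomp (Q := right_comodule W) vb vP (ic rY).
have ivl : llinear (fun x => i rY (v x)).
  split=> [x y|a x]; first by case: icv => [[]].
  rewrite /v hZ (jhE (mkhom (bilscale_hom a))); last exact: jZ.
  by rewrite nat.
exists (fun x => i rY (v x)); split=> // x; symmetry.
have lr := lcoact_r Y.
have D s u := tmapD (g := @id Z) s u lr (@llinear_id _ _).
(* Y (x) Z is given the left action and coaction of its factor Y. *)
apply: (lact_colinear (actV := fun c => tmap (@lact _ _ _ g Y c) id)
  (lco := fun t => tassoc (tmap (@lcoact _ _ _ Y) id t)) gP ivl).
- by move=> s u; rewrite D tassocD.
- move=> c; have [cl _] := lact_hom gP Y c.
  have cD s u := tmapD (g := @id Z) s u cl (@llinear_id _ _).
  apply: tensor_ext => [s u|s u|y z].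
  + by rewrite cD D tassocD.
  + rewrite -tlift_add; apply: eq_tlift => c1 c2.
    have [cl2 _] := lact_hom gP Y c2.
    by rewrite (tmapD _ _ cl2) // tensDr.
  rewrite !tmapE // (lact_lcoact gP) tens_tliftl.
  rewrite (tlift_comp _ _ (@tassocD _ _ _ _)); apply: eq_tlift => c1 c2.
  by rewrite tassocE tmapE //; case: (lact_hom gP Y c2).
- move=> c y; rewrite /v hact (jhE (mkhom (lact_hom gP Y c))); last exact: jact.
  by rewrite nat.
Qed.

End Product.

Section Picard.
Variable PK : Pic_category Cat.

Definition cotensor_equivalence (Y : inv_bicomodule C) : autoequivalence Cat :=
  Autoequivalence (proj2 (projT2 (cid (inv_bicomodP Y)))).

Lemma cotensor_equivalenceP (Y : inv_bicomodule C) :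
  is_cotensor_functor Y (cotensor_equivalence Y).
Proof. exact: (proj1 (projT2 (cid (inv_bicomodP Y)))). Qed.

(** Pic(C) takes its carrier and product from [PK]; what remains is that every class comes from a
    bicomodule and that equality and product mean what they should. *)
Definition cotensor_class (Y : inv_bicomodule C) : PK :=
  picc_class PK (cotensor_equivalence Y).

Lemma cotensor_classE (Y : inv_bicomodule C) (F : autoequivalence Cat) :
  is_cotensor_functor Y F -> cotensor_class Y = picc_class PK F.
Proof.
by move=> FY; apply/picc_eq; exact: cotensor_functor_uniq (cotensor_equivalenceP Y) FY.
Qed.

Fact cotensor_class_surj (p : PK) : exists Y, cotensor_class Y = p.
Proof.
have [T <-] := picc_surj p; have TC := image_cotensor_functor gP (aeqP T).
have Yinv : invertible (image_bicomodule gP (aeqP T)).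
  by exists T; split=> //; exact: aeqP.
by exists (InvBicomodule Yinv); exact: cotensor_classE.
Qed.

Fact cotensor_class_eq (Y Z : inv_bicomodule C) :
  cotensor_class Y = cotensor_class Z <-> bicomodule_iso Y Z.
Proof.
have FY := cotensor_equivalenceP Y; have FZ := cotensor_equivalenceP Z.
split=> [/picc_eq FF|YZ].
- apply: represents_iso (cotensor_represents FZ).
  exact: represents_nat_iso FF (cotensor_represents FY).
- by apply: cotensor_classE; apply: cotensor_functor_transport FZ; exact: bicomodule_iso_sym.
Qed.

Fact cotensor_class_mul (Y Z W : inv_bicomodule C) :
  lg_mul (cotensor_class Y) (cotensor_class Z) = cotensor_class W <->
  is_bicotensor Y Z W.
Proof.
have FY := cotensor_equivalenceP Y; have FZ := cotensor_equivalenceP Z.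
have FW := cotensor_equivalenceP W.
rewrite /cotensor_class picc_mul; split=> [FF|YZW].
- apply: (represents_bicotensor FY FZ).
  exact: represents_nat_iso FF (cotensor_represents FW).
- apply: cotensor_functor_uniq FW _; apply: represents_cotensor.
    by apply: equivalence_comp; exact: aeqP.
  exact: bicotensor_represents YZW.
Qed.

Definition picard_coring : Pic_coring C :=
  PicCoring cotensor_class_surj cotensor_class_eq cotensor_class_mul.

End Picard.

End Represent.

(** * The coring of a graded algebra acting on a set *)

Lemma fin_supp_bigsum (I J : Type) (V : zmodType) (r : seq J) (F : J -> I -> V) :
  (forall j, fin_supp (F j)) ->
  fin_supp (fun i => \sum_(j <- r) F j i) /\
  fsum (fun i => \sum_(j <- r) F j i) = \sum_(j <- r) fsum (F j).
Proof.
move=> Fj; elim: r => [|j r [fr sr]].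
  have -> : (fun i => \sum_(j <- [::]) F j i) = (fun=> 0).
    by apply/funext => i; rewrite big_nil.
  by rewrite big_nil; split; [exact: fin_supp0 | exact: fsum0].
have -> : (fun i => \sum_(l <- j :: r) F l i)
    = (fun i => F j i + \sum_(l <- r) F l i).
  by apply/funext => i; rewrite big_cons.
by rewrite big_cons -sr; split; [exact: fin_suppD | exact: fsumD].
Qed.

Section GradedCointegral.
Variables (k : comPzRingType) (G : groupType).
Variables (X : gset G) (A : graded_algebra k G).
Local Notation C := (AkX_coring X A).
Local Notation "a # x" := (AkX_single x a : C) (at level 35).

Lemma AkX_hom_ext (V : zmodType) (u v : C -> V) :
  (forall c d, u (c + d) = u c + u d) -> (forall c d, v (c + d) = v c + v d) ->
  (forall x g a, gra_part g a -> u (a # x) = v (a # x)) -> forall c, u c = v c.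
Proof.
move=> uD vD uv; apply: AkX_ext => // x; apply: gra_ext => [a b|a b|g a ag].
- by rewrite AkX_singleD uD.
- by rewrite AkX_singleD vD.
- exact: uv ag.
Qed.

(** The part of b in degrees belonging to S. A set of degrees is needed because several h may carry
    x to the same y when stabilizers are nontrivial. *)
Definition gra_res (S : G -> Prop) (b : A) : A :=
  fsum (fun h => if pselect (S h) then gra_comp b h else 0).

Lemma gra_res_fin S (b : A) :
  fin_supp (fun h => if pselect (S h) then gra_comp b h else 0).
Proof.
apply: sub_finite_set (hcomp_fin (gra_sum A) b) => h /=.
by case: pselect => // Sh bh.
Qed.

Lemma gra_resD S a b : gra_res S (a + b) = gra_res S a + gra_res S b.
Proof.
rewrite -fsumD; try exact: gra_res_fin.
by apply: eq_fsum => h; case: pselect => /= _; rewrite ?addr0 // gra_compD.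
Qed.

Lemma gra_res_hom S h (b : A) :
  gra_part h b -> gra_res S b = if pselect (S h) then b else 0.
Proof.
move=> bh; rewrite /gra_res (@fsum1 _ _ h) => [|l lh].
  by rewrite /gra_comp (hcomp_id _ bh).
by rewrite /gra_comp (hcomp_ne _ bh lh); case: pselect.
Qed.

Lemma gra_comp_res S (b : A) h : ~ S h -> gra_comp (gra_res S b) h = 0.
Proof.
move=> Sh; transitivity (if pselect (S h) then gra_comp b h else 0); last first.
  by case: pselect.
apply: (hcomp_uniq (gra_sum A) (f := fun h => if pselect (S h) then gra_comp b h else 0)).
- by move=> l; case: pselect => /= _; [exact: hcompP | exact: (ds_zero (gra_sum A))].
- exact: gra_res_fin.
- by [].
Qed.

(* The x-th coordinate in the basis (1 (x) x)_x of C as a right A-module. *)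
Definition rcoord (x : X) (d : C) : A :=
  fm_lift (fun y b => gra_res (fun h => gact x h = y) b) d.

Lemma rcoordD x c d : rcoord x (c + d) = rcoord x c + rcoord x d.
Proof. by apply: fm_liftD => y; exact: gra_resD. Qed.

Lemma rcoord_res x y (b : A) :
  rcoord x (b # y) = gra_res (fun h => gact x h = y) b.
Proof. by apply: fm_lift_single => z; exact: gra_resD. Qed.

(** For b of degree h, b (x) y = (1 (x) y h^-1) b, so only the coordinate at y h^-1 survives. *)
Lemma rcoord_single x y h (b : A) : gra_part h b ->
  rcoord x (b # y) = if pselect (gact x h = y) then b else 0.
Proof. by move=> bh; rewrite rcoord_res (gra_res_hom _ bh). Qed.

Lemma rcoord1 x y : rcoord x (1 # y) = if pselect (x = y) then 1 else 0.
Proof. by rewrite (rcoord_single _ _ (gra_one A)) gact1. Qed.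

Lemma gact_inj g (x y : X) : gact x g = gact y g -> x = y.
Proof.
move=> /(congr1 (fun z => gact z g^-1%g)).
by rewrite !gactM mulgV !gact1.
Qed.

Lemma rcoordZr x d (a : A) : rcoord x (d *r a) = rcoord x d * a.
Proof.
move: d; apply: AkX_hom_ext => [c d|c d|y h b bh].
- by rewrite ractDl rcoordD.
- by rewrite rcoordD mulrDl.
move: a; apply: gra_ext => [a a'|a a'|l a al].
- by rewrite ractDr rcoordD.
- by rewrite mulrDr.
rewrite (AkX_single_ract _ _ al) (rcoord_single _ _ (gra_mul bh al)).
rewrite (rcoord_single _ _ bh) -gactM.
case: pselect => /= [/gact_inj xy|xy]; case: pselect => //= e.
- by case: xy; rewrite e.
- by rewrite mul0r.
Qed.

(** For a of degree g, a (1 (x) xg) = (1 (x) x) a moves the coordinate at xg to x. *)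
Lemma rcoordZl x g (a : A) d :
  gra_part g a -> rcoord x (a *: d) = a * rcoord (gact x g) d.
Proof.
move=> ag; move: d; apply: AkX_hom_ext => [c d|c d|y h b bh].
- by rewrite scalerDr rcoordD.
- by rewrite rcoordD mulrDr.
rewrite AkX_single_scale (rcoord_single _ _ (gra_mul ag bh)).
by rewrite (rcoord_single _ _ bh) gactM; case: pselect => //= _; rewrite mulr0.
Qed.

(* gamma((1 (x) x) (x)_A (1 (x) y)) is 1 for x = y and 0 otherwise. *)
Definition AkX_gamma (c d : C) : A := fm_lift (fun x a => a * rcoord x d) c.

Lemma AkX_gammaDl c c' d :
  AkX_gamma (c + c') d = AkX_gamma c d + AkX_gamma c' d.
Proof. by apply: fm_liftD => *; rewrite mulrDl. Qed.

Lemma AkX_gamma_single x a d : AkX_gamma (a # x) d = a * rcoord x d.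
Proof. by apply: fm_lift_single => *; rewrite mulrDl. Qed.

(** Left coordinates are finitely supported, so this makes the components of an element of a
    comodule finitely supported as well. *)
Lemma AkX_gamma1 c x : AkX_gamma c (1 # x) = fm_fun c x.
Proof.
rewrite /AkX_gamma /fm_lift (@fsum1 _ _ x) => [|y yx]; rewrite rcoord1.
  by case: pselect => //= _; rewrite mulr1.
by case: pselect => //= _; rewrite mulr0.
Qed.

Lemma AkX_cointegral : cointegral AkX_gamma.
Proof.
have DR c d d' : AkX_gamma c (d + d') = AkX_gamma c d + AkX_gamma c d'.
  move: c; apply: AkX_ext => [c c'|c c'|x a]; rewrite ?AkX_gammaDl //.
    by rewrite addrACA.
  by rewrite !AkX_gamma_single rcoordD mulrDr.
have Zl a c d : AkX_gamma (a *: c) d = a * AkX_gamma c d.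
  move: c; apply: AkX_ext => [c c'|c c'|x b].
  - by rewrite scalerDr AkX_gammaDl.
  - by rewrite AkX_gammaDl mulrDr.
  - by rewrite AkX_single_scale !AkX_gamma_single mulrA.
have bal c a d : AkX_gamma (c *r a) d = AkX_gamma c (a *: d).
  move: c; apply: AkX_ext => [c c'|c c'|x b].
  - by rewrite ractDl AkX_gammaDl.
  - by rewrite AkX_gammaDl.
  move: a; apply: gra_ext => [a a'|a a'|g a ag].
  - by rewrite ractDr AkX_gammaDl.
  - by rewrite scalerDl DR.
  by rewrite (AkX_single_ract _ _ ag) !AkX_gamma_single (rcoordZl _ _ ag) mulrA.
have gb : balanced AkX_gamma by split=> *; rewrite ?AkX_gammaDl ?DR ?bal.
have gD s t := tliftD s t gb.
have Zr c d a : AkX_gamma c (d *r a) = AkX_gamma c d * a.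
  move: c; apply: AkX_ext => [c c'|c c'|x b].
  - by rewrite AkX_gammaDl.
  - by rewrite AkX_gammaDl mulrDl.
  - by rewrite !AkX_gamma_single rcoordZr mulrA.
have [cD _] := comul_l C.
split=> //; first exact: AkX_gammaDl.
- apply: AkX_ext => [c d|c d|x a]; first by rewrite cD gD.
    exact: counitD.
  rewrite comul_single tliftE // AkX_gamma_single rcoord1 counit_single.
  by case: pselect => //= _; rewrite mulr1.
- move=> c d.
  have b1 d' : balanced (fun c1 c2 : C => c1 *r AkX_gamma c2 d').
    by split=> *; rewrite ?ractDl ?AkX_gammaDl ?ractDr // Zl ractA.
  have b2 c' : balanced (fun d1 d2 : C => AkX_gamma c' d1 *: d2).
    by split=> *; rewrite ?DR ?scalerDl ?scalerDr // Zr scalerA.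
  move: c; apply: AkX_ext => [c c'|c c'|x a].
  - by rewrite cD tliftD.
  - by rewrite -tlift_add; apply: eq_tlift => *; rewrite AkX_gammaDl scalerDl.
  rewrite comul_single tliftE // AkX_gamma_single mul1r.
  move: d; apply: AkX_hom_ext => [d d'|d d'|y h b bh].
  - by rewrite rcoordD ractDr.
  - by rewrite cD tliftD.
  rewrite comul_single tliftE // AkX_gamma_single (rcoord_single _ _ bh).
  (* Both sides vanish unless xh = y, and then both are ab (x) y. *)
  rewrite AkX_single_scale mulr1; case: pselect => /= [<-|_].
    by rewrite (AkX_single_ract _ _ bh).
  by rewrite ract0r mulr0; apply: (addrI (0 # y)); rewrite -AkX_singleD !addr0.
Qed.

(** * Comodules over A (x) kX as graded modules *)

Section ToGraded.
Variable M : comodule C.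

Definition comod_comp (x : X) (m : M) : M := orbit_map AkX_gamma m (1 # x).

Lemma comod_compD x m n : comod_comp x (m + n) = comod_comp x m + comod_comp x n.
Proof. exact: (orbit_mapDl AkX_cointegral). Qed.

Lemma comod_compE x m :
  comod_comp x m = tlift (fun m0 (c : C) => m0 *r fm_fun c x) (coact m).
Proof. by apply: eq_tlift => m0 c; rewrite AkX_gamma1. Qed.

Lemma comod_comp_act x g m (a : A) : gra_part g a ->
  comod_comp (gact x g) (m *r a) = comod_comp x m *r a.
Proof.
move=> ag; rewrite /comod_comp (orbit_map_act AkX_cointegral).
rewrite -(orbit_mapZr AkX_cointegral) AkX_single_scale mulr1.
by rewrite (AkX_single_ract _ _ ag) mul1r.
Qed.

(** Orbit maps are colinear and 1 (x) x is grouplike. *)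
Lemma coact_comp x m : coact (comod_comp x m) = tens (comod_comp x m) (1 # x).
Proof.
rewrite (orbit_map_colinear AkX_cointegral) comul_single tmapE //.
by case: (orbit_map_hom AkX_cointegral m).
Qed.

Lemma comod_comp_tens x y m :
  coact m = tens m (1 # y) -> comod_comp x m = if pselect (x = y) then m else 0.
Proof.
move=> my; have bal := orbit_map_bal AkX_cointegral M (1 # x).
rewrite /comod_comp /orbit_map my tliftE // AkX_gamma_single mul1r rcoord1.
case: pselect => [yx|yx]; case: pselect => //= e; first by rewrite ract1.
- by rewrite yx in e.
- by rewrite e in yx.
- exact: ract0r.
Qed.

(** The coaction of m is a finite sum of pairs whose second entries have finite support, and adding
    up coordinates in C is the counit. *)
Lemma comod_comp_fin m : fin_supp (comod_comp^~ m) /\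
  fsum (comod_comp^~ m) = m.
Proof.
have mD (n : M) a b : n *r (a + b) = n *r a + n *r b by exact: ractDr.
have Fj (p : M * C) : fin_supp (fun x => p.1 *r fm_fun p.2 x).
  exact: (fin_supp_morph (mD p.1) (fm_fin p.2)).
have -> : comod_comp^~ m = (fun x => \sum_(p <- repr (coact m))
    p.1 *r fm_fun p.2 x).
  by apply/funext => x; rewrite comod_compE.
have [f s] := fin_supp_bigsum (repr (coact m)) Fj.
split=> //; rewrite s -[RHS]coact1; apply: eq_bigr => p _.
by rewrite -(fsum_morph (mD p.1) (fm_fin p.2)).
Qed.

Definition comod_part (x : X) : set M := fun m => comod_comp x m = m.

Fact comod_part_sum : direct_sum comod_part.
Proof.
have c0 x : comod_comp x 0 = 0 by exact: additive0 (comod_compD x).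
split.
- exact: c0.
- move=> x u v ux vx; apply: (addIr v).
  by rewrite subrK -{2}ux -{2}[v]vx /comod_part -comod_compD subrK.
- move=> m; have [f s] := comod_comp_fin m.
  exists (comod_comp^~ m); split=> // x.
  by rewrite /comod_part (comod_comp_tens _ (coact_comp x m)); case: pselect.
- move=> f h fP hP ff fh e x.
  have comp (u : X -> M) : (forall i, comod_part i (u i)) -> fin_supp u ->
      comod_comp x (fsum u) = u x.
    move=> uP fu; rewrite (fsum_morph (comod_compD x) fu) (@fsum1 _ _ x) =>
      [|y yx]; first exact: uP.
    have uy : coact (u y) = tens (u y) (1 # y).
      by rewrite -[u y](uP y : comod_comp y (u y) = u y) coact_comp.
    by rewrite (comod_comp_tens _ uy); case: pselect => // xy; case: yx.
  by rewrite -(comp f) // -(comp h) // e.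
Qed.

Fact comod_part_act x g m (a : A) :
  comod_part x m -> gra_part g a -> comod_part (gact x g) (m *r a).
Proof. by move=> mx ag; rewrite /comod_part (comod_comp_act _ _ ag) mx. Qed.

Definition to_graded : graded_module X A :=
  GradedModule comod_part_sum comod_part_act.

Lemma coact_part x m : comod_part x m -> coact m = tens m (1 # x).
Proof. by move=> mx; rewrite -mx coact_comp. Qed.

End ToGraded.

Fact to_graded_map (M N : comodule C) (f : M -> N) :
  comodule_map f -> graded_map (M := to_graded M) (N := to_graded N) f.
Proof.
move=> fP; split=> [|x m mx]; first by case: fP.
rewrite /= /comod_part /comod_comp -(orbit_map_nat AkX_cointegral _ _ fP).
by congr f; exact: mx.
Qed.

Definition comodule_to_graded : kfunctor (comodule_cat C) (graded_cat X A).
Proof.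
exists (to_graded : ob (comodule_cat C) -> ob (graded_cat X A))
  (fun (M N : comodule C) (f : comodule_hom M N) =>
     Hom (P := graded_hom_pred (to_graded M) (to_graded N))
       (to_graded_map (hom_funP f))).
all: by move=> *; exact: graded_homP.
Defined.

(** Both round trips keep the underlying module, so identity maps give the isomorphisms; only
    coactions, respectively gradings, are compared. *)
Lemma graded_comoduleK :
  nat_iso (fun_comp (graded_to_comodule X A) comodule_to_graded)
          (fun_id (comodule_cat C)).
Proof.
have idP (M : comodule C) :
    comodule_map (M := grm_comodule (to_graded M)) (N := M) id.
  split=> // m; rewrite tmap_id; have [cD _] := coact_r M; move: m.
  apply: (grm_ext (M := to_graded M)) => [m n|m n|x m mx].
  - exact: cD.
  - exact: (grm_coactD (M := to_graded M)).
  - by rewrite [RHS](grm_coact_hom mx); exact: coact_part.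
exists (fun M : comodule C => mkhom (idP M)); split=> [M|M N f].
  by apply: bij_iso; exists id.
exact: fn_inj.
Qed.

Lemma comodule_gradedK :
  nat_iso (fun_comp comodule_to_graded (graded_to_comodule X A))
          (fun_id (graded_cat X A)).
Proof.
have part (M : graded_module X A) x (m : M) :
    @grm_part _ _ _ _ (to_graded (grm_comodule M)) x m <-> grm_part x m.
  split=> [mx|mx].
  - suff -> : m = hcomp (grm_sum M) m x by exact: hcompP.
    rewrite -[LHS]mx; move: {mx} m.
    apply: grm_ext => [m n|m n|y m my].
    + exact: (@comod_compD (grm_comodule M)).
    + exact: hcompD.
    + by rewrite (@comod_comp_tens (grm_comodule M) _ _ _ (grm_coact_hom my)) (hcomp_hom _ _ my).
  - rewrite /= /comod_part (@comod_comp_tens (grm_comodule M) _ _ _ (grm_coact_hom mx)).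
    by case: pselect.
have idP (M : graded_module X A) :
    graded_map (M := to_graded (grm_comodule M)) (N := M) id.
  by split=> // x m /part.
have idP' (M : graded_module X A) :
    graded_map (N := to_graded (grm_comodule M)) (M := M) id.
  by split=> // x m /part.
exists (fun M : graded_module X A =>
  Hom (P := graded_hom_pred (to_graded (grm_comodule M)) M) (idP M)).
split=> [M|M N f].
  exists (Hom (P := graded_hom_pred M (to_graded (grm_comodule M))) (idP' M)).
  by split; exact: graded_homP.
exact: graded_homP.
Qed.

End GradedCointegral.

(** * Twists by coring automorphisms *)

Section TwistFunctor.
Variables (k : comPzRingType) (A : kalgebra k) (C : coring A).
Local Notation Cat := (comodule_cat C).
Local Notation reg := (regular_comodule C).

Definition caut_inv (s : coring_aut C) : C -> C := binv (caut_bij s).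
Definition caut_alg_inv (s : coring_aut C) : A -> A :=
  binv (kaut_bij (caut_algP s)).

Section Inverse.
Variable s : coring_aut C.
Local Notation phi := (caut s).
Local Notation rho := (caut_alg s).
Local Notation phi' := (caut_inv s).
Local Notation rho' := (caut_alg_inv s).

Lemma caut_invK : cancel phi' phi. Proof. exact: proj2 (binvK (caut_bij s)). Qed.
Lemma cautK : cancel phi phi'. Proof. exact: proj1 (binvK (caut_bij s)). Qed.
Lemma caut_alg_invK : cancel rho' rho.
Proof. exact: proj2 (binvK (kaut_bij (caut_algP s))). Qed.
Lemma caut_algK : cancel rho rho'.
Proof. exact: proj1 (binvK (kaut_bij (caut_algP s))). Qed.

Lemma caut_invD c d : phi' (c + d) = phi' c + phi' d.
Proof. by apply: (can_inj cautK); rewrite cautD !caut_invK. Qed.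
Lemma caut_invZl a c : phi' (a *: c) = rho' a *: phi' c.
Proof. by apply: (can_inj cautK); rewrite cautZl !caut_invK caut_alg_invK. Qed.
Lemma caut_invZr c a : phi' (c *r a) = phi' c *r rho' a.
Proof. by apply: (can_inj cautK); rewrite cautZr !caut_invK caut_alg_invK. Qed.

Lemma caut_inv_comul c :
  comul (phi' c) = tmap phi' phi' (comul c).
Proof.
have bal : balanced (fun c1 c2 => tens (phi' c1) (phi' c2)).
  split=> *; rewrite ?caut_invD ?tensDl ?tensDr //.
  by rewrite caut_invZr caut_invZl tens_bal.
rewrite -{2}(caut_invK c) caut_comul [RHS](tlift_tmap _ _ _ bal).
by rewrite -[LHS]tlift_tens; apply: eq_tlift => c1 c2; rewrite !cautK.
Qed.

Lemma caut_inv_counit c : counit (phi' c) = rho' (counit c).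
Proof.
by apply: (can_inj caut_algK); rewrite -caut_counit caut_invK caut_alg_invK.
Qed.

Definition coring_aut_inv : coring_aut C :=
  CoringAut (kaut_inv (caut_algP s)) (bijective_binv (caut_bij s)) caut_invD
    caut_invZl caut_invZr caut_inv_comul caut_inv_counit.

(* The comodule M with m . a = m rho(a) and coaction m_0 (x) phi^-1(m_1). *)
Section Object.
Variable M : comodule C.

Definition restricted (s : coring_aut C) (M : comodule C) : Type := comod_mod M.
Local Notation R := (restricted s M).

HB.instance Definition _ := GRing.Zmodule.on R.

Definition restricted_ract (m : R) (a : A) : R := (m : M) *r rho a.

Fact restricted_ractA m a b :
  restricted_ract (restricted_ract m a) b = restricted_ract m (a * b).
Proof. by rewrite /restricted_ract ractA (kautM (caut_algP s)). Qed.
Fact restricted_ract1 m : restricted_ract m 1 = m.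
Proof. by rewrite /restricted_ract (kaut1 (caut_algP s)) ract1. Qed.
Fact restricted_ractDl m n a :
  restricted_ract (m + n) a = restricted_ract m a + restricted_ract n a.
Proof. exact: ractDl. Qed.
Fact restricted_ractDr m a b :
  restricted_ract m (a + b) = restricted_ract m a + restricted_ract m b.
Proof. by rewrite /restricted_ract (kautD (caut_algP s)) ractDr. Qed.

HB.instance Definition _ := isRightModule.Build A R
  restricted_ractA restricted_ract1 restricted_ractDl restricted_ractDr.

Lemma restricted_ractE (m : R) a : m *r a = (m : M) *r rho a.
Proof. by []. Qed.

Definition restricted_coact (m : R) : tensor R C :=
  tlift (fun (m0 : M) c => tens (m0 : R) (phi' c)) (coact (m : M)).

Lemma restricted_bal : balanced (fun (m : M) c => tens (m : R) (phi' c)).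
Proof.
split=> [m n c|m c d|m a c]; rewrite ?caut_invD ?tensDr ?tensDl //.
by rewrite caut_invZl -tens_bal restricted_ractE caut_alg_invK.
Qed.

Fact restricted_coact_r : rlinear restricted_coact.
Proof.
have [cD cZ] := coact_r M; have bal := restricted_bal.
split=> [m n|m a]; first by rewrite /restricted_coact cD tliftD.
rewrite /restricted_coact [coact _]cZ tlift_ract //.
rewrite [RHS](tlift_comp (h := fun t => t *r a)) => [|u v]; last exact: ractDl.
by apply: eq_tlift => m0 c; rewrite tens_ract caut_invZr caut_algK.
Qed.

Fact restricted_coactA m :
  tassoc (tmap restricted_coact id (restricted_coact m))
  = tmap id (@comul _ _ C) (restricted_coact m).
Proof.
have cl := comul_l C; have cr := restricted_coact_r.
have tD (t u : tensor R C) := tmapD (g := @id C) t u cr (@llinear_id _ _).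
have tD' t u := tmapD (f := @id R) t u (@rlinear_id _ _) cl.
rewrite {2 3}/restricted_coact (tlift_comp _ _ tD) (tlift_comp _ _ tD').
rewrite (tlift_comp _ _ (@tassocD _ _ _ _)).
pose F (m0 : M) (c d : C) := tens (m0 : R) (tens (phi' c) (phi' d)).
transitivity (tlift (fun m' c => tlift (fun m0 m1 => F m0 m1 c) (coact m'))
    (coact m)).
  apply: eq_tlift => m' c; rewrite tmapE // /restricted_coact.
  rewrite (tlift_comp (h := fun t => tens t (phi' c))) => [|u v]; last exact: tensDl.
  rewrite (tlift_comp _ _ (@tassocD _ _ _ _)).
  by apply: eq_tlift => m0 m1; rewrite tassocE.
rewrite coact_lift.
  apply: eq_tlift => m0 c; rewrite tmapE // caut_inv_comul /tmap tens_tliftr.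
  exact: eq_tlift.
have [b1 b2 b3] := restricted_bal.
split=> [p|n]; split=> *; rewrite /F ?caut_invD ?tensDl ?tensDr //.
- by rewrite caut_invZl -tens_lact -tens_bal restricted_ractE caut_alg_invK.
- by rewrite caut_invZr caut_invZl tens_bal.
Qed.

Fact restricted_coact1 m :
  tlift (fun (m : R) c => m *r counit c) (restricted_coact m) = m.
Proof.
have bal : balanced (fun (m : R) (c : C) => m *r counit c).
  by split=> *; rewrite ?counitD ?ractDl ?ractDr // counitZl ractA.
have bD t u := tliftD t u bal.
rewrite /restricted_coact (tlift_comp _ _ bD) -[RHS](coact1 (m : M)).
apply: eq_tlift => m0 c.
by rewrite tliftE // caut_inv_counit restricted_ractE caut_alg_invK.
Qed.

Definition restricted_comodule : comodule C :=
  Comodule restricted_coact_r restricted_coactA restricted_coact1.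

Lemma restricted_coactE (m : restricted_comodule) : coact m
  = tlift (fun (m0 : M) c => tens (m0 : R) (phi' c)) (coact (m : M)).
Proof. by []. Qed.

End Object.

Fact restricted_map (M N : comodule C) (f : M -> N) : comodule_map f ->
  comodule_map (M := restricted_comodule M) (N := restricted_comodule N) f.
Proof.
case=> [[fD fZ] fco].
have fl : rlinear (f : restricted s M -> restricted s N).
  by split=> // m a; exact: fZ.
split=> // m; rewrite [LHS]restricted_coactE fco.
rewrite tlift_tmap; last exact: restricted_bal.
have tD t u := tmapD (g := @id C) t u fl (@llinear_id _ _).
rewrite [RHS](tlift_comp _ _ tD); apply: eq_tlift => m0 c.
by rewrite tmapE.
Qed.

Definition twist_functor : kfunctor Cat Cat.
Proof.
exists (restricted_comodule : ob Cat -> ob Cat)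
  (fun (M N : comodule C) (f : comodule_hom M N) =>
     Hom (P := comodule_hom_pred (restricted_comodule M) (restricted_comodule N))
       (restricted_map (hom_funP f))).
- by move=> *; exact: comodule_homP.
- move=> M N x f; apply: comodule_homP => m /=.
  by rewrite restricted_ractE (kaut_unit (caut_algP s)).
- by move=> *; exact: comodule_homP.
- by move=> *; exact: comodule_homP.
Defined.

End Inverse.

(** Restricting along s and then along t gives m . a = m s(t(a)). This reversal of order matches
    (T)(S) = (ST), so Theta is a homomorphism and not an antihomomorphism. Taking any u that agrees
    pointwise with the composite lets the lemma serve inverses too. *)
Lemma twist_functor_comp (s t u : coring_aut C) :
  (forall a, caut_alg u a = caut_alg s (caut_alg t a)) ->
  (forall c, u c = s (t c)) ->
  nat_iso (twist_functor u) (fun_comp (twist_functor t) (twist_functor s)).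
Proof.
move=> ra pc.
have pc' c : caut_inv u c = caut_inv t (caut_inv s c).
  by apply: (can_inj (cautK u)); rewrite caut_invK pc !caut_invK.
pose stM M := restricted_comodule t (restricted_comodule s M).
have idP (M : comodule C) :
    comodule_map (M := restricted_comodule u M) (N := stM M) id.
  have il : rlinear (id : restricted_comodule u M -> stM M).
    by split=> // m a; rewrite [LHS]restricted_ractE ra.
  split=> // m; have tD v w := tmapD (g := @id C) v w il (@llinear_id _ _).
  rewrite [RHS](tlift_comp _ _ tD) [LHS]restricted_coactE.
  have bD v w := tliftD v w (restricted_bal t (restricted_comodule s M)).
  rewrite [LHS](tlift_comp _ _ bD); apply: eq_tlift => m0 c.
  by rewrite tliftE ?tmapE // ?pc' //; exact: restricted_bal.
exists (fun M : comodule C => mkhom (idP M)); split=> [M|M N f].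
  by apply: bij_iso; exists id.
exact: fn_inj.
Qed.

Lemma twist_functor_id (s : coring_aut C) :
  (forall a, caut_alg s a = a) -> (forall c, s c = c) ->
  nat_iso (twist_functor s) (fun_id Cat).
Proof.
move=> ra pc.
have pc' c : caut_inv s c = c by rewrite -[LHS]pc caut_invK.
have idP (M : comodule C) : comodule_map (M := restricted_comodule s M) (N := M) id.
  have il : rlinear (id : restricted_comodule s M -> M).
    by split=> // m a; rewrite [LHS]restricted_ractE ra.
  split=> // m; have tD v w := tmapD (g := @id C) v w il (@llinear_id _ _).
  rewrite [RHS](tlift_comp _ _ tD) -[LHS]tlift_tens; apply: eq_tlift => m0 c.
  by rewrite tmapE // pc'.
exists (fun M : comodule C => mkhom (idP M)); split=> [M|M N f].
  by apply: bij_iso; exists id.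
exact: fn_inj.
Qed.

Fact coring_id_comul (c : C) : comul c = tmap id id (comul c).
Proof. by rewrite tmap_id. Qed.

Definition coring_aut_id : coring_aut C.
Proof.
by apply: (@CoringAut _ _ C id id) => //; [exact: kaut_id | exists id |
  exact: coring_id_comul].
Defined.

Lemma twist_functor_equivalence (s : coring_aut C) :
  is_equivalence (twist_functor s).
Proof.
have e : nat_iso (twist_functor coring_aut_id) (fun_id Cat).
  exact: twist_functor_id.
exists (twist_functor (coring_aut_inv s)).
split; apply: nat_iso_trans e; apply: nat_iso_sym; apply: twist_functor_comp.
- by move=> a; exact/esym/caut_alg_invK.
- by move=> c; exact/esym/caut_invK.
- by move=> a; exact/esym/caut_algK.
- by move=> c; exact/esym/cautK.
Qed.

Definition regular_bicomodule : bicomodule C :=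
  Bicomodule (@coring_k _ _ C) (comul_l C) (comul_r C) (comul_l C) (comul_r C)
    (@comulA _ _ C) (@comul1l _ _ C) (@comulA _ _ C) (@comul1r _ _ C)
    (@comulA _ _ C).

Variables (g : C -> C -> A) (gP : cointegral g).

Lemma regular_represents : represents gP regular_bicomodule (fun_id Cat).
Proof.
exists (id : C -> C); split=> //.
- by exists id.
- by split=> // c; rewrite tmap_id.
- by move=> c d; rewrite /= /orbit_map [RHS](ci_slide gP).
Qed.

(** The isomorphism is phi itself: it turns the plain right structure of the twist into the
    restricted one and the twisted left structure into the plain one. *)
Lemma twist_represents (s : coring_aut C) :
  represents gP (twist s) (twist_functor s).
Proof.
have jl : rlinear (caut s : twist s -> restricted_comodule s reg).
  by split=> [c d|c a]; [exact: cautD | exact: cautZr].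
exists (caut s : C -> C); split=> //.
- exact: caut_bij.
- split=> // c; rewrite [LHS]restricted_coactE [coact _]caut_comul.
  rewrite tlift_tmap; last exact: restricted_bal.
  have tD v w := tmapD (g := @id C) v w jl (@llinear_id _ _).
  rewrite [RHS](tlift_comp _ _ tD); apply: eq_tlift => c1 c2.
  by rewrite tmapE // cautK.
- by move=> a c; rewrite twisted_scaleE cautZl caut_alg_invK.
- move=> c d; rewrite [RHS](ci_slide gP) caut_comul.
  have bal : balanced (fun d1 d2 : C => g c d1 *: d2).
    by split=> *; rewrite ?(gE gP) ?scalerDl ?scalerDr // scalerA.
  rewrite tlift_tmap //.
  have bD v w := tliftD v w (lact_bal gP (twist s) c).
  rewrite /lact [tlift _ _](tlift_comp _ _ bD).
  rewrite (tlift_comp (h := caut s)) => [|u v]; last exact: cautD.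
  apply: eq_tlift => d1 d2; rewrite tliftE; last exact: lact_bal.
  by rewrite twisted_scaleE cautZl caut_alg_invK.
Qed.

Definition twist_autoeq (s : coring_aut C) : autoequivalence Cat :=
  Autoequivalence (twist_functor_equivalence s).

Lemma twist_cotensor (s : coring_aut C) :
  is_cotensor_functor (twist s) (twist_functor s).
Proof.
exact: represents_cotensor (twist_functor_equivalence s) (twist_represents s).
Qed.

Lemma twist_invertible (s : coring_aut C) : invertible (twist s).
Proof.
by exists (twist_functor s); split; [exact: twist_cotensor |
  exact: twist_functor_equivalence].
Qed.

(** C represents the identity functor, so triviality in the Picard group becomes an isomorphism of
    bicomodules. *)
Lemma twist_functor_trivial (s : coring_aut C) :
  nat_iso (twist_functor s) (fun_id Cat) <->
  bicomodule_iso (twist s) regular_bicomodule.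
Proof.
split=> [e|e].
- apply: represents_iso regular_represents.
  exact: represents_nat_iso e (twist_represents s).
- apply: (@cotensor_functor_uniq _ _ _ _ gP regular_bicomodule).
    exact: cotensor_functor_transport e (twist_cotensor s).
  apply: represents_cotensor regular_represents; exact: equivalence_id.
Qed.

End TwistFunctor.

(** * The kernel *)

Section DualMaps.
Variables (k : comPzRingType) (A : kalgebra k) (C : coring A).
Local Notation reg := (regular_comodule C).

(* Comodule endomorphisms of C correspond to elements of the dual algebra via
   theta |-> counit o theta, with inverse the following map. *)
Definition dual_map (p : C -> A) (c : C) : C :=
  tlift (fun c1 c2 => p c1 *: c2) (comul c).

Lemma counit_dual_map (h : C -> C) : comodule_map (M := reg) (N := reg) h ->
  dual_map (fun c => counit (h c)) =1 h.
Proof.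
case=> hl hco c; rewrite -[RHS]comul1l [comul (h c)]hco tlift_tmap //.
by split=> *; rewrite ?counitD ?scalerDl ?scalerDr // counitZr scalerA.
Qed.

Section Dual.
Variables (p : C -> A) (pP : in_dual p).

Lemma dual_map_bal : balanced (fun c1 c2 : C => p c1 *: c2).
Proof.
case: pP => pD pZ; split=> *; rewrite ?pD ?scalerDl ?scalerDr //.
by rewrite pZ scalerA.
Qed.

Lemma dual_map_hom : comodule_map (M := reg) (N := reg) (dual_map p).
Proof.
have [cD cZ] := comul_l C; have bal := dual_map_bal; have [pD pZ] := pP.
split.
  apply: rlinear_comp (comul_r C); apply: tliftr => // c1 c2 a.
  by rewrite lractA.
move=> c; rewrite [LHS](tlift_comp _ _ cD).
transitivity (tlift (fun c1 c' => tlift (fun c2 c3 => tens (p c1 *: c2) c3)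
    (comul c')) (comul c)).
  apply: eq_tlift => c1 c'; rewrite cZ -[comul c' in LHS]tlift_tens.
  rewrite (tlift_comp (h := fun t => p c1 *: t)) => [|u v]; last exact: scalerDr.
  by apply: eq_tlift => c2 c3; rewrite tens_lact.
rewrite -comul_lift; last first.
  split=> [c3|c1]; split=> *; rewrite ?pD ?scalerDl ?scalerDr ?tensDl ?tensDr //.
  - by rewrite pZ scalerA.
  - by rewrite -lractA tens_bal.
by apply: eq_tlift => c1 c2; rewrite tens_tliftl.
Qed.

Lemma dual_mulE q c : in_dual q -> dual_mul p q c = q (dual_map p c).
Proof. by case=> qD _; rewrite /dual_map (tlift_comp _ _ qD). Qed.

End Dual.

(** [dual_map] sends p * q to [dual_map q] after [dual_map p], and the counit to the identity. *)
Lemma dual_mapK (p q : C -> A) : in_dual p -> in_dual q ->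
  dual_mul p q =1 @counit _ _ C -> cancel (dual_map p) (dual_map q).
Proof.
move=> pP qP pq c; have [_ co] := dual_map_hom pP.
rewrite {1}/dual_map [comul _]co tlift_tmap; last exact: dual_map_bal.
rewrite -[RHS]comul1l; apply: eq_tlift => c1 c2.
by rewrite -pq (dual_mulE p _ qP).
Qed.

Lemma counit_in_dual (h : C -> C) :
  comodule_map (M := reg) (N := reg) h -> in_dual (fun c => counit (h c)).
Proof.
by case=> [[hD hZ] _]; split=> *; rewrite ?hD ?hZ ?counitD ?counitZr.
Qed.

Lemma counit_dual_unit (h : C -> C) : bijective h ->
  comodule_map (M := reg) (N := reg) h -> dual_unit (fun c => counit (h c)).
Proof.
case=> h' hK h'K hP.
have h'P := can_comodule_map (M := reg) (N := reg) hK h'K hP.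
exists (fun c => counit (h' c)); split; first exact: counit_in_dual.
- by move=> c; rewrite dual_mulE ?counit_dual_map ?hK //; exact: counit_in_dual.
- by move=> c; rewrite dual_mulE ?counit_dual_map ?h'K //; exact: counit_in_dual.
Qed.

End DualMaps.

Section Kernel.
Variables (k : comPzRingType) (G : groupType).
Variables (X : gset G) (A : graded_algebra k G).
Local Notation C := (AkX_coring X A).
Local Notation "a # x" := (AkX_single x a : C) (at level 35).

(** This recasts condition 2) as an equation in C. The left side is the sum of the u_h (x) yh;
    conversely, taking y-th right coordinates shows that u equals its part in the degrees h with yh
    = x. *)
Lemma single1_ract (x y : X) (u : A) :
  (forall h, gact y h <> x -> gra_comp u h = 0) <-> (1 # y) *r u = u # x.
Proof.
split=> [u0|e h hx].
  rewrite [LHS]AkX_ract_single1 /AkX_ract1 -[in RHS](hcomp_sum (gra_sum A) u).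
  rewrite (fsum_morph (AkX_singleD x) (hcomp_fin _ _)); apply: eq_fsum => h.
  rewrite mul1r; have [<-//|hx] := pselect (gact y h = x).
  rewrite u0 // -/(gra_comp u h) u0 //.
  rewrite (additive0 (AkX_singleD _)) (additive0 (AkX_singleD _)) //.
have : rcoord y ((1 # y) *r u) = gra_res (fun h => gact y h = x) u.
  by rewrite e rcoord_res.
rewrite rcoordZr rcoord1; case: pselect => //= _; rewrite mul1r => ->.
exact: gra_comp_res.
Qed.

Variable t : gr_aut X A.
Local Notation s := (AkX_aut t).

Lemma twisted_lcoact_single x (a : A) : twisted_lcoact (s := s) (a # x)
  = tens (gra_al t a # gra_phi t x) ((1 # x) : twisted s).
Proof.
rewrite /twisted_lcoact comul_single tliftE; last exact: twisted_lbal.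
by rewrite [caut _ _]AkX_map_single.
Qed.

(** For an isomorphism h and p = counit o h, right colinearity gives h(1 (x) x) = p(1 (x) x) (x) x.
    Left linearity reads h(ac) = alpha(a) h(c), which yields 1). Left colinearity at 1 (x) x, after
    the counit on the second factor, reads h(1 (x) x) = (1 (x) phi(x)) p(1 (x) x), which is 2). *)
Lemma kernelP :
  bicomodule_iso (twist s) (regular_bicomodule C) <-> in_kernel t.
Proof.
split=> [[h [hb [hD hZl] hr hlc hrc]]|[p [pP pU pal p0]]].
- have hP : comodule_map (M := regular_comodule C) (N := regular_comodule C) h.
    split=> [|c]; first exact: hr.
    rewrite [LHS]hrc /twisted_rcoact.
    have D u v := tmapD (M := twist s) (g := @id C) u v hr (@llinear_id _ _).
    rewrite [LHS](tlift_comp _ _ D); apply: eq_tlift => c1 c2.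
    by rewrite tmapE.
  have hal a (c : C) : h (a *: c) = gra_al t a *: h c.
    rewrite -[RHS]hZl; congr h.
    exact: esym (congr1 (fun b : A => b *: (c : C)) (caut_algK s a)).
  have hs x a : h (a # x) = gra_al t a *: h (1 # x).
    by rewrite -hal AkX_single_scale mulr1.
  exists (fun c => counit (h c)); split.
  + exact: counit_in_dual.
  + exact: counit_dual_unit.
  + by move=> x a; rewrite hs counitZl.
  + move=> x; apply/single1_ract.
    have h1 : h (1 # x) = counit (h (1 # x)) # x.
      rewrite -[LHS](counit_dual_map hP) /dual_map comul_single.
      rewrite tliftE; last exact: dual_map_bal (counit_in_dual hP).
      by rewrite AkX_single_scale mulr1.
    have bal : balanced (fun c1 c2 : C => c1 *r counit c2).
      by split=> *; rewrite ?counitD ?ractDl ?ractDr // counitZl ractA.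
    have := congr1 (tlift (fun c1 c2 : C => c1 *r counit c2)) (hlc (1 # x)).
    rewrite [@lcoact _ _ _ (twist s) (1 # x)]twisted_lcoact_single.
    rewrite [LHS]comul1r tmapE // tliftE //.
    by rewrite (kaut1 (gra_alpha (gr_autP t))) => <-.
- have pE a c : p (a *: c) = gra_al t a * p c.
    have [pD _] := pP; move: c; apply: AkX_ext => [c d|c d|x b].
    + by rewrite scalerDr pD.
    + by rewrite pD mulrDr.
    rewrite AkX_single_scale pal (kautM (gra_alpha (gr_autP t))) -mulrA.
    by rewrite -pal.
  have [q [qP pq qp]] := pU.
  have [[hD hZ] hco] := dual_map_hom pP.
  have hs x a : dual_map p (a # x) = p (a # x) # x.
    rewrite /dual_map comul_single tliftE; last exact: dual_map_bal.
    by rewrite AkX_single_scale mulr1.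
  have hl : llinear (dual_map p : twist s -> regular_bicomodule C).
    split=> // a c; rewrite twisted_scaleE /dual_map (proj2 (comul_l C)).
    rewrite tlift_lact; last exact: dual_map_bal.
    rewrite [RHS](tlift_comp (h := fun c => a *: c)) => [|u v].
      by apply: eq_tlift => c1 c2; rewrite pE [gra_al t _](caut_alg_invK s a) scalerA.
    exact: scalerDr.
  exists (dual_map p : twist s -> regular_bicomodule C); split=> //.
  + by exists (dual_map q); exact: dual_mapK.
  + have [cD _] := comul_l C; have [tD _] := twisted_lcoact_l s.
    have D u v := tmapD (N := twist s) (f := @id C) u v (@rlinear_id _ _) hl.
    apply: AkX_ext => [c d|c d|x a].
    * by rewrite hD; exact: cD.
    * by rewrite [@lcoact _ _ _ (twist s) _]tD D.
    rewrite [@lcoact _ _ _ (twist s) (a # x)]twisted_lcoact_single tmapE // hs.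
    rewrite [LHS]comul_single hs.
    (* The scalar p(1 (x) x) crosses the tensor sign and multiplies 1 (x) phi(x), where condition 2)
       applies. *)
    rewrite -[p (1 # x)]mulr1 -[X in _ = tens _ X]AkX_single_scale -tens_bal.
    rewrite -[gra_al t a]mulr1 -AkX_single_scale lractA.
    have /single1_ract -> := p0 x.
    by rewrite AkX_single_scale -pal.
  + move=> c; rewrite [LHS]hco -[@rcoact _ _ _ (twist s) c]/(twisted_rcoact (s := s) c).
    have D u v := tmapD (M := twist s) (g := @id C) u v (conj hD hZ) (@llinear_id _ _).
    rewrite [RHS](tlift_comp _ _ D); apply: eq_tlift => c1 c2.
    by rewrite tmapE.
Qed.

End Kernel.

Theorem proposition4p3p7 (k : comPzRingType) (G : groupType) (X : gset G)
    (A : graded_algebra k G) :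
  exists (PicC : Pic_coring (AkX_coring X A))
         (PicM : Pic_category (graded_cat X A)),
    (exists Psi : PicC -> PicM,
       lgroup_hom Psi /\ bijective Psi /\
       forall (Y : inv_bicomodule (AkX_coring X A))
              (T : autoequivalence (graded_cat X A)),
         Psi (picr_class PicC Y) = picc_class PicM T <->
         exists F : kfunctor (comodule_cat (AkX_coring X A))
                             (comodule_cat (AkX_coring X A)),
           is_cotensor_functor Y F /\
           nat_iso (fun_comp (graded_to_comodule X A) T)
                   (fun_comp F (graded_to_comodule X A))) /\
    (exists Theta : gr_aut_group X A -> PicC,
       lgroup_hom Theta /\
       (forall t : gr_aut_group X A, exists tP : invertible (twist (AkX_aut t)),
          Theta t = picr_class PicC (InvBicomodule tP)) /\
       (forall t : gr_aut_group X A, Theta t = lg_one PicC <-> in_kernel t)).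
Proof.
have gP := AkX_cointegral X A.
pose PK := picard_category (comodule_cat (AkX_coring X A)).
have RL := comodule_gradedK X A; have LR := graded_comoduleK X A.
exists (picard_coring gP PK), (picard_transport RL LR PK); split.
  (* Both groups have [PK] as carrier; only the meaning of the class maps has to be compared. *)
  exists id; split=> //; split=> [|Y T]; first by exists id.
  have FY := cotensor_equivalenceP Y.
  have class_eq := to_classP (cotensor_equivalence Y) (autoeq_conj RL LR T).
  split=> [/class_eq /(conj_nat_iso RL LR) e|[F [FF /(conj_nat_iso RL LR) e]]].
    by exists (cotensor_equivalence Y); split.
  by apply/class_eq; apply: nat_iso_trans e; exact: (cotensor_functor_uniq gP FY FF).
exists (fun t => picc_class PK (twist_autoeq (AkX_aut t))); split; last split.
- move=> s t; apply/esym/picc_mul; apply: twist_functor_comp => //.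
  apply: (AkX_ext (v := fun c => AkX_map s (AkX_map t c))) => [c d|c d|x a].
  + exact: AkX_mapD.
  + by rewrite !AkX_mapD.
  + by rewrite !AkX_map_single; exact: AkX_map_single.
- move=> t; exists (twist_invertible gP (AkX_aut t)).
  apply/esym; refine (cotensor_classE gP PK (Y := InvBicomodule _)
    (F := twist_autoeq (AkX_aut t)) _); exact: (twist_cotensor gP).
- move=> t; rewrite -kernelP -(twist_functor_trivial gP).
  exact: (to_classP (twist_autoeq (AkX_aut t)) (autoeq_id _)).
Qed.
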